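(* Let $\alpha>0$, let $\mathfrak{a}$ be a real-valued random variable, and let $\mathfrak{a}(1),\dots,\mathfrak{a}(N)$ be i.i.d. copies of $\mathfrak{a}$. Let $H_N^\alpha=H_N^\infty+\operatorname{diag}(N^{-\alpha}\mathfrak{a}(1),\dots,N^{-\alpha}\mathfrak{a}(N))$, where $H_N^\infty$ is the $N\times N$ symmetric tridiagonal matrix with zeros on the diagonal and ones on the first sub- and super-diagonals, and let $\lambda_1(N)\ge\lambda_2(N)\ge\cdots$ be the eigenvalues of $H_N^\alpha$ in decreasing order. (a) Assume that for some $C>0$, $C_1>0$ we have, for all $t>1$, $\mathbb{P}(\mathfrak{a}>t)=Ct^{-1/\alpha}$ and $\mathbb{P}(\mathfrak{a}<-t)\le C_1t^{-1/\alpha}$. Then for every $\epsilon>0$, the point process of the eigenvalues of $H_N^\alpha$ lying in $(2+\epsilon,\infty)$ converges in law, as $N\to\infty$, to the (restriction to $(2+\epsilon,\infty)$ of the) random point process which is the image under the map $x\mapsto\sqrt{x^2+4}$ of the Poisson process on $[0,\infty)$ with intensity $\frac{C}{\alpha x^{\frac1\alpha+1}}$, $x>0$. (b) Assume that for some $0<\beta<\frac1\alpha$, $C>0$, $C_1>0$ we have, for all $t>1$, $\mathbb{P}(\mathfrak{a}>t)=Ct^{-\beta}$ and $\mathbb{P}(\mathfrak{a}<-t)\le C_1t^{-\beta}$. Then the point process $$N^{\alpha-\frac1\beta}\lambda_1(N)\ge N^{\alpha-\frac1\beta}\lambda_2(N)\ge\cdots$$ converges in law, as $N\to\infty$, to the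 Poisson point process on $[0,\infty)$ with intensity $\frac{C\beta}{x^{\beta+1}}$, $x>0$.
   Context: All matrices are real symmetric $N\times N$ matrices; $\operatorname{diag}(x_1,\dots,x_N)$ is the diagonal matrix with the given diagonal entries. The law of $\mathfrak{a}$ does not depend on $N$. The intensities are densities with respect to Lebesgue measure on $(0,\infty)$; they are integrable at $+\infty$ but not at $0$, so the Poisson processes have finitely many points in $(\delta,\infty)$ for each $\delta>0$ and a well-defined decreasing enumeration of their points. Convergence in (b) means that, for each fixed $k$, the largest $k$ points converge jointly in law to the $k$ largest points of the limiting Poisson process. *)

(* Defs.v *)
From HB Require Import structures.
From mathcomp Require Import all_boot all_order all_algebra.
From mathcomp Require Import all_classical all_reals all_analysis.
From mathcomp Require Import measurable_realfun.
Set Implicit Arguments.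
Unset Strict Implicit.
Unset Printing Implicit Defensive.
Import Order.TTheory GRing.Theory Num.Theory.
Import numFieldNormedType.Exports.
Local Open Scope classical_set_scope.
Local Open Scope ring_scope.

(* The roots of the characteristic polynomial, with multiplicity, in decreasing
   order. Such a sequence is unique, and it exists when A is symmetric. *)
Definition eigenvalues (R : realType) (n : nat) (A : 'M[R]_n) : seq R :=
  xget [::] [set s | sorted >=%R s /\ char_poly A = \prod_(x <- s) ('X - x%:P)].

Definition tridiag (R : realType) (N : nat) : 'M[R]_N :=
  \matrix_(i, j) ((i == j.+1 :> nat) || (j == i.+1 :> nat))%:R.

Definition Hmx (R : realType) (N : nat) (alpha : R) (a : 'I_N -> R) : 'M[R]_N :=
  tridiag R N + diag_mx (\row_i (N%:R `^ (- alpha) * a i)).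

(* Taking some of the B i equal to setT gives the product rule for every
   subfamily. *)
Definition mutually_independent (R : realType) (d d' : measure_display)
    (Omega : measurableType d) (T : measurableType d') (P : probability Omega R)
    (n : nat) (X : 'I_n -> Omega -> T) : Prop :=
  forall B : 'I_n -> set T, (forall i, measurable (B i)) ->
    P (\bigcap_i (X i @^-1` B i)) = (\prod_i P (X i @^-1` B i))%E.

Definition borel_measure (R : realType) : Type :=
  {measure set R -> \bar R}.

HB.instance Definition _ (R : realType) := gen_eqMixin (borel_measure R).
HB.instance Definition _ (R : realType) := gen_choiceMixin (borel_measure R).

Definition bounded_continuous (R : realType) : Type :=
  {f : R -> R | continuous f /\ exists M, forall x, `|f x| <= M}.

Definition integrals (R : realType) (mu : borel_measure R) :
    prod_topology (fun _ : bounded_continuous R => \bar R) :=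
  fun f => (\int[mu]_x (sval f x)%:E)%E.

(* The weak topology of measures. It is meaningful on finite_measures only,
   where all the integrals above are finite. *)
Definition weak_measures (R : realType) : topologicalType :=
  initial_topology (@integrals R).

Definition finite_measures (R : realType) : set (weak_measures R) :=
  [set mu : borel_measure R | (mu setT < +oo)%E].

(* Convergence in law, as n tends to infinity, of the random elements X n of
   the subspace S of E to the random element Y of S; the X n and Y may live on
   different probability spaces. *)
Definition cvg_in_law (R : realType) (E : topologicalType) (S : set E)
    (d : nat -> measure_display) (Omega : forall n, measurableType (d n))
    (P : forall n, probability (Omega n) R) (X : forall n, Omega n -> E)
    (d' : measure_display) (Omega' : measurableType d')
    (Q : probability Omega' R) (Y : Omega' -> E) : Prop :=
  forall F : E -> R, {within S, continuous F} ->
    (exists M, forall x, S x -> `|F x| <= M) ->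
    [/\ forall n, measurable_fun setT (F \o X n),
        measurable_fun setT (F \o Y) &
        ('E_(P n)[F \o X n])%E @[n --> \oo] --> ('E_Q[F \o Y])%E].

Definition point_measure (R : realType) (u : nat -> R) : borel_measure R :=
  mseries (fun j => dirac (u j)) 0.

Definition restrict_measure (R : realType) (c : R) (mu : borel_measure R) :
    borel_measure R :=
  mrestr mu (measurable_itv `]c, +oo[).

Definition intensity (R : realType) (rho : R -> R) (B : set R) : \bar R :=
  (\int[lebesgue_measure]_(x in `]0%R, +oo[ `&` B) (rho x)%:E)%E.

(* The library's poisson_pmf is not used because it equals 1 for every k
   when the rate is 0. *)
Definition poisson_mass (R : realType) (rate : R) (k : nat) : R :=
  expR (- rate) * rate ^+ k / k`!%:R.

(* eta is the decreasing enumeration of a Poisson process whose intensity rho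
   has infinite mass near 0 and finite mass near +oo. *)
Definition poisson_process (R : realType) (d : measure_display)
    (Omega : measurableType d) (Q : probability Omega R)
    (rho : R -> R) (eta : nat -> {RV Q >-> R}) : Prop :=
  let count B w := point_measure (fun j => eta j w) B in
  [/\ forall w, [/\ forall j, 0 < eta j w,
                    forall j, eta j.+1 w <= eta j w &
                    eta j w @[j --> \oo] --> 0],
      forall B : set R, measurable B -> (intensity rho B < +oo)%E ->
        forall k : nat, Q [set w | count B w = k%:R%:E] =
          (poisson_mass (fine (intensity rho B)) k)%:E &
      forall (n : nat) (B : 'I_n -> set R), (forall i, measurable (B i)) ->
        (forall i j, i != j -> B i `&` B j = set0) ->
        mutually_independent Q (fun i => count (B i))].

(* Main.v *)
(* Let V be the diagonal of H. The large entries of V sit at sites which, with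
   high probability, are far from each other and from the boundary. An isolated
   site with potential x > 0 creates the eigenvalue r + 1/r = sqrt (x ^ 2 + 4),
   where 1/r - r = x, with eigenvector r ^ |n - i|. Gluing truncations of these
   profiles gives a positive supersolution away from the k largest sites (hence
   an upper bound for the eigenvalue of index k) and k + 1 subsolutions with
   disjoint supports (hence a lower bound), so the eigenvalue of index k is close
   to the image of the k-th largest entry of V. In (b) the tridiagonal part, of
   norm at most 2, tends to 0 after rescaling. In both cases the order
   statistics of the rescaled i.i.d. sample converge to the points of the
   Poisson process, because the counts in finitely many cells are multinomial
   with a Poisson limit. In (a), a functional of the restricted point measure is,
   up to an event of small probability, a continuous function of finitely many
   eigenvalues. *)

Require Import Defs.
From HB Require Import structures.
From mathcomp Require Import all_boot all_order all_fingroup all_algebra.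
From mathcomp Require Import all_classical all_reals all_analysis.
From mathcomp Require Import measurable_realfun.
From mathcomp Require Import complex ring lra zify.
Set Implicit Arguments.
Unset Strict Implicit.
Unset Printing Implicit Defensive.
Import Order.TTheory GRing.Theory Num.Theory.
Import numFieldNormedType.Exports.
Local Open Scope classical_set_scope.
Local Open Scope ring_scope.

(** * Spectral theorem and variational bounds *)

(** The profiles satisfy the eigenvalue equation exactly except at the peak and from the cutoff
    distance on. At the cutoff the inequality has the favourable sign; at the peak the defect is at
    most 2 / (L + 1) times the profile, uniformly in r. Uniformity matters: r is fixed by a random
    potential and tends to 1 as that potential tends to 0, where the decay of r ^ L gives nothing.
    Hence L and the threshold delta for large entries are chosen before N tends to infinity, and
    large sites at bounded distance from each other or from the ends then have probability O(1 / N).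
    The comparison is made where the order statistic of index k exceeds delta, which costs little
    because its limit is positive. Elsewhere that statistic may be negative or, for N <= k, absent,
    so the order statistics enter through their positive parts. In (a) the obstacle is that
    restriction to ]2 + eps, +oo[ is not continuous: a point can cross the threshold. Almost surely
    the limit has no point at the threshold, so continuous cutoffs can replace the count of points
    above it. *)

Definition dotv (R : comPzRingType) n (u v : 'rV[R]_n) : R := \sum_i u 0 i * v 0 i.

Lemma dotvE (R : comPzRingType) n (u v : 'rV[R]_n) : u *m v^T = (dotv u v)%:M.
Proof.
apply/matrixP=> i j; rewrite !ord1 !mxE /dotv; rewrite eqxx mulr1n.
by apply: eq_bigr=> k _; rewrite mxE.
Qed.

Lemma dotvv_ge0 (R : realDomainType) n (u : 'rV[R]_n) : 0 <= dotv u u.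
Proof. by apply: sumr_ge0=> i _; rewrite -expr2 sqr_ge0. Qed.

Lemma dotvv_gt0 (R : realDomainType) n (u : 'rV[R]_n) : u != 0 -> 0 < dotv u u.
Proof.
move=> u0; rewrite lt_neqAle dotvv_ge0 andbT eq_sym.
apply: contra u0=> /eqP; rewrite /dotv => /psumr_eq0P h.
apply/eqP/rowP=> i; rewrite mxE; have := h _ i isT.
by move=> /(_ (fun i _ => sqr_ge0 (u 0 i)))/eqP; rewrite mulf_eq0 orbb => /eqP.
Qed.

(* A complex eigenvector exists; its real and imaginary parts span a space on
   which the symmetry of A forces the eigenvalue to be real. *)
Lemma symmetric_eigenvector (R : rcfType) n (A : 'M[R]_n.+1) : A^T = A ->
  exists (v : 'rV[R]_n.+1) (l : R), v != 0 /\ v *m A = l *: v.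
Proof.
move=> As; pose f := real_complex R; pose AC := map_mx f A.
have [l /eigenvalueP[z zA z0]] := @eigenvalue_closed _ n.+1 AC isT.
pose x := map_mx (@complex.Re R) z; pose y := map_mx (@complex.Im R) z.
have e u : map_mx (@complex.Re R) (u *m AC) = map_mx (@complex.Re R) u *m A.
  apply/matrixP=> i j; rewrite !mxE raddf_sum; apply: eq_bigr=> k _.
  by rewrite !mxE; case: (u i k)=> a b /=; rewrite mulr0 subr0.
have e' u : map_mx (@complex.Im R) (u *m AC) = map_mx (@complex.Im R) u *m A.
  apply/matrixP=> i j; rewrite !mxE raddf_sum; apply: eq_bigr=> k _.
  by rewrite !mxE; case: (u i k)=> a b /=; rewrite mulr0 add0r.
case: l zA => a b zA.
have ex : x *m A = a *: x - b *: y.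
  rewrite -e zA; apply/matrixP=> i j; rewrite !mxE.
  by case: (z i j).
have ey : y *m A = a *: y + b *: x.
  rewrite -e' zA; apply/matrixP=> i j; rewrite !mxE.
  by case: (z i j).
have h : x *m A *m y^T = y *m A *m x^T.
  have -> : x *m A *m y^T = (x *m A *m y^T)^T.
    by apply/matrixP=> i j; rewrite !ord1 [RHS]mxE.
  by rewrite !trmx_mul trmxK As mulmxA.
have nz : 0 < dotv x x + dotv y y.
  have [x0|x0] := eqVneq x 0.
    have [y0|y0] := eqVneq y 0; last by rewrite ltr_wpDl ?dotvv_ge0 ?dotvv_gt0.
    case/eqP: z0; apply/matrixP=> i j; move/matrixP/(_ i j): x0.
    move/matrixP/(_ i j): y0; rewrite !mxE; case: (z i j)=> c d /= -> ->.
    by [].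
  by rewrite ltr_wpDr ?dotvv_ge0 ?dotvv_gt0.
have b0 : b = 0.
  move: h; rewrite ex ey mulmxBl mulmxDl -!scalemxAl !dotvE.
  move/matrixP/(_ 0 0); rewrite !mxE eqxx !mulr1n.
  have -> : dotv y x = dotv x y by apply: eq_bigr=> i _; rewrite mulrC.
  move=> hh; have : b * (dotv x x + dotv y y) = 0 by lra.
  by move/eqP; rewrite mulf_eq0 (gt_eqF nz) orbF => /eqP.
move: ex ey; rewrite b0 !scale0r subr0 addr0 => ex ey.
have [x0|x0] := eqVneq x 0; last by exists x, a.
exists y, a; split=> //; apply: contraL nz => /eqP ->; rewrite x0.
by rewrite /dotv !big1 ?addr0 ?ltxx// => i _; rewrite mxE mul0r.
Qed.

(** The reflection in the hyperplane orthogonal to u - e exchanges the unit vectors u and e. The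
    case u = e is apart because the normal vanishes. Vectors are rows, and matrices act on the
    right. *)
Lemma householder (R : rcfType) n (u : 'rV[R]_n.+1) : dotv u u = 1 ->
  exists Q : 'M[R]_n.+1, Q *m Q^T = 1%:M /\ delta_mx 0 0 *m Q = u.
Proof.
move=> u1; pose e : 'rV[R]_n.+1 := delta_mx 0 0.
have [->|ue] := eqVneq u e.
  by exists 1%:M; rewrite trmx1 !mulmx1.
pose w := u - e.
have w0 : 0 < dotv w w by rewrite dotvv_gt0// subr_eq0.
have ee : e *m e^T = 1%:M.
  rewrite dotvE; congr (_%:M); rewrite /dotv (bigD1 ord0)//= big1 ?addr0.
    by rewrite !mxE !eqxx mulr1.
  by move=> i i0; rewrite !mxE (negPf i0) andbF mulr0.
(* Equal norms give |u - e|^2 = 2 - 2 <u, e>, so <e, w> = - |w|^2 / 2, and reflecting e adds exactly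
   w to it. *)
have ew : e *m w^T = (- (dotv w w / 2))%:M.
  have eu : u *m e^T = e *m u^T.
    by rewrite -[LHS]trmxK trmx_mul trmxK !dotvE tr_scalar_mx.
  have : (u - e) *m (u - e)^T = (dotv w w)%:M by rewrite dotvE.
  rewrite [(u - e)^T]linearB /= mulmxBl !mulmxBr ee (dotvE u u) u1 eu.
  move=> h; apply/matrixP=> i j; rewrite !ord1.
  by move/matrixP/(_ 0 0): h; rewrite !mxE !eqxx !mulr1n; lra.
pose Q := 1%:M - (2 / dotv w w) *: (w^T *m w).
have Qt : Q^T = Q.
  by rewrite /Q linearB /= linearZ /= trmx_mul trmxK trmx1.
exists Q; split; last first.
  rewrite /Q mulmxBr mulmx1 -scalemxAr mulmxA ew mul_scalar_mx scalerA.
  have -> : 2 / dotv w w * - (dotv w w / 2) = -1 by field; rewrite gt_eqF.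
  by rewrite scaleN1r opprK /w addrC subrK.
have ww : w^T *m w *m (w^T *m w) = dotv w w *: (w^T *m w).
  by rewrite mulmxA -(mulmxA w^T) dotvE mul_mx_scalar -scalemxAl.
rewrite Qt /Q; move: (w^T *m w) (dotv w w) w0 ww => M d d0 MM.
rewrite mulmxBl mul1mx mulmxBr mulmx1 -scalemxAl -scalemxAr MM.
rewrite !scalerA; apply/matrixP=> i j; rewrite !mxE.
by field; rewrite gt_eqF.
Qed.

(** Deflation: in an orthonormal basis starting with a unit eigenvector, the first row of the matrix
    is a multiple of the first basis vector and, by symmetry, so is the first column; the induction
    hypothesis handles the remaining block. The rows of P are the eigenvectors. *)
Lemma real_spectral (R : rcfType) n (A : 'M[R]_n) : A^T = A ->
  exists (P : 'M[R]_n) (D : 'rV[R]_n),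
    P *m P^T = 1%:M /\ A = P^T *m diag_mx D *m P.
Proof.
elim: n A => [|n IH] A As.
  by exists 1%:M, 0; split; apply/matrixP=> -[].
have [v [l [v0 vA]]] := symmetric_eigenvector As.
have [u [u1 uA]] : exists u, dotv u u = 1 /\ u *m A = l *: u.
  have vv := dotvv_gt0 v0; pose c := (Num.sqrt (dotv v v))^-1.
  have c2 : c ^+ 2 * dotv v v = 1.
    by rewrite /c exprVn sqr_sqrtr ?ltW// mulVf// gt_eqF.
  exists (c *: v); split; last by rewrite -scalemxAl vA !scalerA mulrC.
  rewrite -c2 /dotv mulr_sumr; apply: eq_bigr=> i _; rewrite !mxE; ring.
have [Q [QQ eQ]] := householder u1.
have QQ' : Q^T *m Q = 1%:M by apply: mulmx1C.
pose B := Q *m A *m Q^T.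
have Bs : B^T = B by rewrite /B !trmx_mul trmxK As mulmxA.
have eB : delta_mx 0 0 *m B = l *: delta_mx 0 0 :> 'rV_n.+1.
  by rewrite /B !mulmxA eQ uA -scalemxAl -eQ -mulmxA QQ mulmx1.
have AE : A = Q^T *m B *m Q.
  by rewrite /B !mulmxA QQ' mul1mx -mulmxA QQ' mulmx1.
clearbody B.
have B0 j : B 0 j = l *+ (j == 0).
  have := congr1 (fun M : 'rV_n.+1 => M 0 j) eB; rewrite -rowE !mxE => ->.
  by rewrite eqxx mulr_natr.
have [P [D [PP BE]]] : exists (P : 'M[R]_n) (D : 'rV[R]_n),
    P *m P^T = 1%:M /\ drsubmx (B : 'M[R]_(1 + n)) = P^T *m diag_mx D *m P.
  by apply: IH; rewrite trmx_drsub; congr drsubmx; exact: Bs.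
have Bblock : (B : 'M[R]_(1 + n)) = block_mx l%:M 0 0 (drsubmx (B : 'M[R]_(1 + n))).
  have l0 : lshift n 0 = 0 :> 'I_(1 + n) by apply/val_inj.
  have B0' j : (B : 'M[R]_(1 + n)) 0 j = l *+ (j == 0) by exact: B0.
  have Bs' i j : (B : 'M[R]_(1 + n)) i j = (B : 'M[R]_(1 + n)) j i.
    by rewrite -{1}Bs mxE.
  rewrite -[LHS](submxK (B : 'M[R]_(1 + n))); congr block_mx;
    apply/matrixP=> i j; rewrite !mxE ?(ord1 i) ?(ord1 j) ?l0 ?B0'//.
  by rewrite Bs' B0'.
pose P' : 'M[R]_(1 + n) := block_mx 1%:M 0 0 P.
have P'P' : P' *m P'^T = 1%:M.
  rewrite /P' tr_block_mx mulmx_block !trmx0 trmx1 !mulmx0 !mul0mx mulmx1.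
  by rewrite PP !addr0 !add0r -scalar_mx_block.
exists (P' *m Q), (row_mx l%:M D : 'rV_(1 + n)); split.
  by rewrite trmx_mul mulmxA -(mulmxA P') QQ mulmx1 P'P'.
rewrite AE; have -> : B = P'^T *m diag_mx (row_mx l%:M D : 'rV_(1 + n)) *m P'.
  rewrite [LHS]Bblock BE diag_mx_row /P' tr_block_mx !trmx0 trmx1.
  rewrite !mulmx_block !mulmx0 !mul0mx !mul1mx !mulmx1 !addr0 !add0r !mul0mx.
  have -> : diag_mx (l%:M : 'M[R]_1) = l%:M by apply/matrixP=> i j; rewrite !ord1 !mxE !eqxx.
  by [].
by rewrite trmx_mul !mulmxA.
Qed.

Lemma char_poly_conj (R : comNzRingType) n (P Q A : 'M[R]_n) : P *m Q = 1%:M ->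
  char_poly (Q *m A *m P) = char_poly A.
Proof.
move=> PQ; pose f := map_mx (@polyC R).
have QP : f _ _ Q *m f _ _ P = 1%:M by rewrite -map_mxM mulmx1C// map_mx1.
rewrite /char_poly /char_poly_mx !map_mxM.
have -> : 'X%:M - f _ _ Q *m f _ _ A *m f _ _ P =
          f _ _ Q *m ('X%:M - f _ _ A) *m f _ _ P.
  rewrite mulmxBr mulmxBl; congr (_ - _).
  by rewrite mul_mx_scalar -scalemxAl QP scalemx1.
by rewrite !det_mulmx mulrC mulrA -det_mulmx mulmx1C// det1 mul1r.
Qed.

Lemma char_poly_diag_mx (R : comNzRingType) n (D : 'rV[R]_n) :
  char_poly (diag_mx D) = \prod_(x <- [seq D 0 i | i : 'I_n]) ('X - x%:P).
Proof.
rewrite char_poly_trig ?diag_mx_is_trig// big_image /=.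
by apply: eq_bigr=> i _; rewrite mxE eqxx.
Qed.

(** The condition inside [eigenvalues], isolated so that bounds are proved for any list satisfying
    it, independently of the choice operator. *)
Definition spectrum (R : rcfType) n (A : 'M[R]_n) (s : seq R) : Prop :=
  sorted >=%R s /\ char_poly A = \prod_(x <- s) ('X - x%:P).

Lemma spectrum_exists (R : rcfType) n (A : 'M[R]_n) : A^T = A ->
  exists s, spectrum A s.
Proof.
move=> /real_spectral[P [D [PP ->]]].
exists (sort >=%R [seq D 0 i | i : 'I_n]); split.
  by apply: sort_sorted=> x y; exact: le_total.
rewrite char_poly_conj// char_poly_diag_mx; apply/perm_big.
by rewrite perm_sym perm_sort.
Qed.

Lemma spectrum_inj (R : rcfType) n (A : 'M[R]_n) s t :
  spectrum A s -> spectrum A t -> s = t.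
Proof.
move=> [ss As] [st At]; apply: (sorted_eq _ _ ss st).
- by move=> x y z /= h1 h2; exact: le_trans h2 h1.
- by move=> x y /=; rewrite andbC => /le_anti.
- by apply: prod_XsubC_eq; rewrite -As -At.
Qed.

Lemma spectrum_size (R : rcfType) n (A : 'M[R]_n) s : spectrum A s -> size s = n.
Proof.
by case=> _ /(congr1 (size \o polyseq)) /=; rewrite size_char_poly size_prod_XsubC => -[].
Qed.

Lemma spectrum_le (R : rcfType) n (A : 'M[R]_n) s i j : spectrum A s ->
  (i <= j < n)%N -> s`_j <= s`_i.
Proof.
move=> As /andP[ij jn]; have sz := spectrum_size As.
apply: (sorted_leq_nth _ _ 0 As.1) => //; rewrite ?inE ?sz//.
- by move=> x y z /= h1 h2; exact: le_trans h2 h1.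
- by move=> x; exact: lexx.
- exact: leq_ltn_trans ij jn.
Qed.

(** Unique factorisation of the characteristic polynomial makes s a permutation of the diagonal
    given by [real_spectral]; the same permutation of the rows of the orthogonal matrix puts it in
    decreasing order. *)
Lemma spectrum_basis (R : rcfType) n (A : 'M[R]_n) s : A^T = A -> spectrum A s ->
  exists P : 'M[R]_n, P *m P^T = 1%:M /\
    A = P^T *m diag_mx (\row_(i < n) s`_i) *m P.
Proof.
move=> /real_spectral[P [D [PP AE]]] [_ As].
have st : perm_eq s [tuple D 0 i | i < n].
  apply: prod_XsubC_eq; rewrite -As AE char_poly_conj// char_poly_diag_mx.
  by rewrite /= /image_mem.
have /tuple_permP[p sE] := st.
have sD (i : 'I_n) : s`_i = D 0 (p i).
  by rewrite sE -tnth_nth !tnth_mktuple.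
exists (row_perm p P); split.
  apply/matrixP=> i j; have := congr1 (fun M : 'M[R]_n => M (p i) (p j)) PP.
  rewrite !mxE (inj_eq perm_inj) => <-; apply: eq_bigr=> k _.
  by rewrite !mxE.
rewrite {1}AE; apply/matrixP=> i j; rewrite !mxE (reindex_inj (@perm_inj _ p)).
by apply: eq_bigr=> k _; rewrite !mul_mx_diag !mxE sD.
Qed.

Definition qform (R : comPzRingType) n (A : 'M[R]_n) (u : 'rV[R]_n) : R :=
  dotv (u *m A) u.

Lemma dotv_mul (R : comPzRingType) n (P : 'M[R]_n) (u v : 'rV[R]_n) :
  dotv (u *m P^T) v = dotv u (v *m P).
Proof.
have : (dotv (u *m P^T) v)%:M = (dotv u (v *m P))%:M :> 'M[R]_1.
  by rewrite -!dotvE trmx_mul mulmxA.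
by move/matrixP/(_ 0 0); rewrite !mxE.
Qed.

Lemma qform_diag (R : comPzRingType) n (D : 'rV[R]_n) (u : 'rV[R]_n) :
  qform (diag_mx D) u = \sum_i D 0 i * u 0 i ^+ 2.
Proof.
by apply: eq_bigr => i _; rewrite mul_mx_diag mxE expr2 mulrA (mulrC (D 0 i)).
Qed.

Lemma exists_kernel (F : fieldType) k (M : 'M[F]_(k.+1, k)) :
  exists2 w : 'rV[F]_k.+1, w != 0 & w *m M = 0.
Proof.
have /rowV0Pn[w /sub_kermxP wM w0] : kermx M != 0.
  by rewrite kermx_eq0 /row_free neq_ltn ltnS rank_leq_col.
by exists w.
Qed.

Lemma dotv_isometry (R : comNzRingType) n (P : 'M[R]_n) (u : 'rV[R]_n) :
  P *m P^T = 1%:M -> dotv (u *m P^T) (u *m P^T) = dotv u u.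
Proof. by move=> PP; rewrite dotv_mul -mulmxA mulmx1C// mulmx1. Qed.

Lemma qform_spectral (R : comNzRingType) n (P : 'M[R]_n) (D u : 'rV[R]_n) :
  qform (P^T *m diag_mx D *m P) u = \sum_i D 0 i * (u *m P^T) 0 i ^+ 2.
Proof. by rewrite -qform_diag /qform -dotv_mul trmxK !mulmxA. Qed.

Lemma dotvv_sum (R : comPzRingType) n (u : 'rV[R]_n) :
  dotv u u = \sum_i u 0 i ^+ 2.
Proof. by []. Qed.

Lemma mulmx_pid_eq0 (R : nzRingType) n k (v : 'rV[R]_n) (i : 'I_n) :
  v *m (\matrix_(i < n, j < k) (i == j :> nat)%:R) = 0 -> (i < k)%N -> v 0 i = 0.
Proof.
move=> h ik; move/matrixP/(_ 0 (Ordinal ik)): h; rewrite !mxE (bigD1 i)//=.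
rewrite !mxE eqxx mulr1 big1 ?addr0// => j ji; rewrite mxE.
by rewrite -(inj_eq val_inj) in ji; rewrite (negPf ji) mulr0.
Qed.

(** Courant-Fischer: the kernel of B has codimension at most k, so it meets the span of the k + 1
    first eigenvectors, where the form is at least the eigenvalue of index k. *)
Lemma spectrum_upper (R : rcfType) n k (A : 'M[R]_n) s (B : 'M[R]_(n, k)) c :
  A^T = A -> spectrum A s -> (k < n)%N ->
  (forall u, u *m B = 0 -> qform A u <= c * dotv u u) -> s`_k <= c.
Proof.
move=> At As kn hB; have [P [PP AE]] := spectrum_basis At As.
pose W : 'M[R]_(k.+1, n) := \matrix_(i, j) (i == j :> nat)%:R.
(* A combination of the rows 0 to k of P that satisfies the k linear conditions of B. *)
have [w w0 wM] := exists_kernel (W *m P *m B).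
pose v := w *m W; pose u := v *m P.
have uP : u *m P^T = v by rewrite /u -mulmxA PP mulmx1.
have v0 (i : 'I_n) : (k < i)%N -> v 0 i = 0.
  move=> ki; rewrite mxE big1// => j _; rewrite mxE.
  have jk : (j <= k)%N by rewrite -ltnS ltn_ord.
  by rewrite ltn_eqF ?mulr0// (leq_ltn_trans jk).
have vw (i : 'I_k.+1) : v 0 (widen_ord kn i) = w 0 i.
  rewrite mxE (bigD1 i)//= !mxE eqxx mulr1 big1 ?addr0// => j ji; rewrite mxE.
  by rewrite -(inj_eq val_inj) /= in ji; rewrite /= (negPf ji) mulr0.
have vn0 : v != 0.
  apply: contra w0 => /eqP v0'; apply/eqP/rowP=> i.
  by rewrite -vw v0' !mxE.
have := hB u; rewrite {1}/u /v !mulmxA in wM *; move=> /(_ wM).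
rewrite {1}AE qform_spectral uP -(dotv_isometry u PP) uP => le.
rewrite -(ler_pM2r (dotvv_gt0 vn0)); apply: le_trans le.
rewrite dotvv_sum mulr_sumr ler_sum// => i _; rewrite [X in _ <= X * _]mxE.
have [ik|/v0 ->] := leqP i k; last by rewrite expr0n /= !mulr0.
by rewrite ler_wpM2r ?sqr_ge0// (spectrum_le As)// ik.
Qed.

(** Dual Courant-Fischer bound: a space of dimension k + 1 contains a nonzero vector orthogonal to
    the k first eigenvectors. The clause that [w *m B] is nonzero says that the rows of B are
    independent. *)
Lemma spectrum_lower (R : rcfType) n k (A : 'M[R]_n) s (B : 'M[R]_(k.+1, n)) c :
  A^T = A -> spectrum A s -> (k < n)%N ->
  (forall w, w != 0 -> w *m B != 0 /\
     c * dotv (w *m B) (w *m B) <= qform A (w *m B)) -> c <= s`_k.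
Proof.
move=> At As kn hB; have [P [PP AE]] := spectrum_basis At As.
pose W : 'M[R]_(n, k) := \matrix_(i, j) (i == j :> nat)%:R.
have [w w0 wM] := exists_kernel (B *m P^T *m W).
have [u0 le] := hB w w0; pose v := w *m B *m P^T.
have v0 (i : 'I_n) : (i < k)%N -> v 0 i = 0.
  by apply: mulmx_pid_eq0; rewrite -!mulmxA mulmxA in wM *.
move: le; rewrite {1}AE qform_spectral -(dotv_isometry _ PP) -/v => le.
have vv : 0 < dotv v v by rewrite dotv_isometry// dotvv_gt0.
rewrite -(ler_pM2r vv); apply: le_trans le _.
rewrite dotvv_sum mulr_sumr ler_sum// => i _; rewrite [X in X * _ <= _]mxE.
have [ik|ki] := ltnP i k; first by rewrite v0// expr0n /= !mulr0.
by rewrite ler_wpM2r ?sqr_ge0// (spectrum_le As)// ki ltn_ord.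
Qed.

(** One-sided Weyl inequality: orthogonality to the k first eigenvectors of B is k linear
    conditions, under which the form of B is at most its eigenvalue of index k, so [spectrum_upper]
    applies to A. *)
Lemma spectrum_perturb (R : rcfType) n k (A B : 'M[R]_n) s t e :
  A^T = A -> B^T = B -> spectrum A s -> spectrum B t -> (k < n)%N ->
  (forall u, qform A u <= qform B u + e * dotv u u) -> s`_k <= t`_k + e.
Proof.
move=> At Bt As Bs kn hAB; have [P [PP BE]] := spectrum_basis Bt Bs.
pose W : 'M[R]_(n, k) := \matrix_(i, j) (i == j :> nat)%:R.
apply: (spectrum_upper (B := P^T *m W)) At As kn _ => u; rewrite mulmxA => uW.
apply: le_trans (hAB u) _; rewrite mulrDl lerD2r {1}BE qform_spectral.
rewrite -(dotv_isometry u PP) dotvv_sum mulr_sumr ler_sum// => i _; rewrite [X in X * _ <= _]mxE.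
have [ik|ki] := ltnP i k.
  by rewrite (mulmx_pid_eq0 uW ik) expr0n /= !mulr0.
by rewrite ler_wpM2r ?sqr_ge0// (spectrum_le Bs)// ki ltn_ord.
Qed.

(* With u = phi w, this is the ground-state substitution: the off-diagonal
   entries contribute - A i j phi i phi j (w i - w j) ^ 2 / 2 <= 0. *)
Lemma qform_supersolution (R : realFieldType) n (A : 'M[R]_n) (phi : 'I_n -> R)
    (E : R) (u : 'rV[R]_n) :
  A^T = A -> (forall i j, i != j -> 0 <= A i j) -> (forall i, 0 < phi i) ->
  (forall i, u 0 i != 0 -> \sum_j A i j * phi j <= E * phi i) ->
  qform A u <= E * dotv u u.
Proof.
move=> At A0 phi0 hE.
pose F i j := A i j * (u 0 i ^+ 2 * (phi j / phi i)).
have -> : qform A u = \sum_i \sum_j u 0 i * A i j * u 0 j.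
  by rewrite exchange_big; apply: eq_bigr=> i _; rewrite mxE mulr_suml.
have step i j : u 0 i * A i j * u 0 j <= (F i j + F j i) / 2.
  have -> : F j i = A i j * (u 0 j ^+ 2 * (phi i / phi j)).
    by rewrite /F -{1}At mxE.
  rewrite /F; have [<-|ij] := eqVneq i j.
    by rewrite divff ?gt_eqF// mulr1 expr2; lra.
  have pi0 : phi i != 0 by rewrite gt_eqF.
  have pj0 : phi j != 0 by rewrite gt_eqF.
  have p0 : 0 < phi i * phi j by rewrite mulr_gt0.
  rewrite -subr_ge0.
  have -> : (A i j * (u 0 i ^+ 2 * (phi j / phi i)) +
      A i j * (u 0 j ^+ 2 * (phi i / phi j))) / 2 - u 0 i * A i j * u 0 j =
      A i j * (u 0 i * phi j - u 0 j * phi i) ^+ 2 / (2 * (phi i * phi j)).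
    by field; rewrite pi0 pj0.
  apply: divr_ge0; first by rewrite mulr_ge0 ?sqr_ge0 ?A0.
  by rewrite mulr_ge0 ?ltW.
apply: (@le_trans _ _ (\sum_i \sum_j F i j)).
  apply: (@le_trans _ _ (\sum_i \sum_j (F i j + F j i) / 2)).
    by apply: ler_sum=> i _; apply: ler_sum.
  under eq_bigr do rewrite -mulr_suml big_split /=.
  rewrite -mulr_suml big_split /= [X in _ + X]exchange_big /=; lra.
rewrite dotvv_sum mulr_sumr; apply: ler_sum => i _.
have [u0|u0] := eqVneq (u 0 i) 0.
  by rewrite u0 expr0n /= mulr0 big1// => j _; rewrite /F u0 expr0n/= mul0r mulr0.
rewrite (_ : \sum_j F i j = (\sum_j A i j * phi j) * (u 0 i ^+ 2 / phi i)).
  apply: (@le_trans _ _ (E * phi i * (u 0 i ^+ 2 / phi i))).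
    by rewrite ler_wpM2r ?hE// divr_ge0 ?sqr_ge0 ?ltW.
  rewrite le_eqVlt; apply/orP; left; apply/eqP; field.
  by rewrite gt_eqF.
by rewrite mulr_suml; apply: eq_bigr=> j _; rewrite /F; ring.
Qed.

(** The disjointness conditions make both the form and the scalar product diagonal on the span of
    the psi j. Each diagonal term then follows from the pointwise inequality, which may be
    multiplied by psi j because it is nonnegative. *)
Lemma spectrum_subsolutions (R : rcfType) n k (A : 'M[R]_n) s
    (psi : 'I_k.+1 -> 'rV[R]_n) (E : R) :
  A^T = A -> spectrum A s -> (k < n)%N ->
  (forall j i, 0 <= psi j 0 i) -> (forall j, psi j != 0) ->
  (forall j i, E * psi j 0 i <= (psi j *m A) 0 i) ->
  (forall j l i, j != l ->
     psi j 0 i * psi l 0 i = 0 /\ (psi j *m A) 0 i * psi l 0 i = 0) ->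
  E <= s`_k.
Proof.
move=> At As kn psi0 psin0 hE dis; pose B := \matrix_j psi j.
apply: (spectrum_lower (B := B) At As kn) => w w0.
have uE : w *m B = \sum_j w 0 j *: psi j.
  by rewrite mulmx_sum_row; apply: eq_bigr=> j _; rewrite rowK.
have bil (f : 'I_k.+1 -> 'rV[R]_n) :
    (forall j l i, j != l -> f j 0 i * psi l 0 i = 0) ->
    dotv (\sum_j w 0 j *: f j) (\sum_j w 0 j *: psi j) =
    \sum_j w 0 j ^+ 2 * dotv (f j) (psi j).
  move=> fd; rewrite /dotv.
  transitivity (\sum_i \sum_j w 0 j ^+ 2 * (f j 0 i * psi j 0 i)).
    apply: eq_bigr=> i _; rewrite !summxE mulr_suml; apply: eq_bigr=> j _.
    rewrite mulr_sumr (bigD1 j)//= big1 ?addr0 => [|l lj].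
      by rewrite !mxE; ring.
    have := fd j l i; rewrite eq_sym => /(_ lj) h.
    by rewrite !mxE mulrACA h mulr0.
  by rewrite exchange_big; apply: eq_bigr=> j _; rewrite mulr_sumr.
have uu : dotv (w *m B) (w *m B) = \sum_j w 0 j ^+ 2 * dotv (psi j) (psi j).
  by rewrite uE bil// => j l i /dis -/(_ i)[].
have [j wj] : exists j, w 0 j != 0.
  apply/existsP; apply: contraNT w0 => /existsPn h; apply/eqP/rowP=> j.
  by rewrite mxE; apply/eqP; have := h j; rewrite negbK.
have uu0 : 0 < dotv (w *m B) (w *m B).
  rewrite uu (bigD1 j)//=; apply: ltr_wpDr.
    by apply: sumr_ge0=> l _; rewrite mulr_ge0 ?sqr_ge0 ?dotvv_ge0.
  by apply: mulr_gt0; rewrite ?dotvv_gt0// exprn_even_gt0.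
split.
  apply: contraTneq uu0 => ->.
  by rewrite /dotv big1 ?ltxx// => i _; rewrite mxE mul0r.
rewrite uu /qform uE mulmx_suml.
under [X in dotv X _]eq_bigr do rewrite -scalemxAl.
rewrite bil; last by move=> l m i /dis -/(_ i)[].
rewrite mulr_sumr; apply: ler_sum=> l _.
rewrite mulrCA ler_wpM2l ?sqr_ge0// /dotv mulr_sumr; apply: ler_sum=> i _.
by rewrite mulrA ler_wpM2r.
Qed.

(** * Localised profiles for the discrete Laplacian with a potential *)

Lemma tridiag_sum (R : realType) N (i : 'I_N) (f : nat -> R) :
  \sum_j tridiag R N i j * f j =
  (if (0 < i)%N then f i.-1 else 0) + (if (i.+1 < N)%N then f i.+1 else 0).
Proof.
transitivity (\sum_(j < N) (i == j.+1 :> nat)%:R * f j +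
              \sum_(j < N) (j == i.+1 :> nat)%:R * f j).
  rewrite -big_split /=; apply: eq_bigr=> j _; rewrite mxE -mulrDl; congr (_ * _).
  case: eqP=> [e|_]; case: eqP=> [e'|_]; rewrite /= ?addr0 ?add0r//.
  exfalso; lia.
congr (_ + _).
  case: ifP=> [i0|i0].
    have h : (i.-1 < N)%N by have := ltn_ord i; lia.
    rewrite (bigD1 (Ordinal h))//= prednK// eqxx mul1r big1 ?addr0// => j.
    rewrite -(inj_eq val_inj) /= => jh; case: eqP=> [e|]; last by rewrite mul0r.
    by move: jh; rewrite e eqxx.
  by rewrite big1// => j _; case: eqP=> [e|]; [lia|rewrite mul0r].
case: ifP=> [iN|iN].
  rewrite (bigD1 (Ordinal iN))//= eqxx mul1r big1 ?addr0// => j.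
  rewrite -(inj_eq val_inj) /= => jh; case: eqP=> [e|]; last by rewrite mul0r.
  by move: jh; rewrite e eqxx.
rewrite big1// => j _; case: eqP=> [e|]; last by rewrite mul0r.
by have := ltn_ord j; lia.
Qed.

Lemma tridiag_sym (R : realType) N : (tridiag R N)^T = tridiag R N.
Proof. by apply/matrixP=> i j; rewrite !mxE orbC. Qed.

Definition site_dist (m n : nat) : nat := (m - n + (n - m))%N.

(* The two solutions of f (d - 1) + f (d + 1) = (r + 1 / r) f d that vanish
   (sgn = -1), resp. are stationary (sgn = 1), at distance L. *)
Definition profile (R : fieldType) (sgn r : R) (L d : nat) : R :=
  r ^+ minn d L + sgn * r ^+ (2 * L - minn d L).

Lemma profile_step (R : fieldType) (sgn r : R) L d : r != 0 -> (d.+1 < L)%N ->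
  profile sgn r L d + profile sgn r L d.+2 = (r + r^-1) * profile sgn r L d.+1.
Proof.
move=> r0 dL; rewrite /profile !(minn_idPl _); try lia.
have -> : (2 * L - d = (2 * L - d.+2).+2)%N by lia.
have -> : (2 * L - d.+1 = (2 * L - d.+2).+1)%N by lia.
by rewrite !exprS; field.
Qed.

Lemma profile_far (R : fieldType) (sgn r : R) L d : (L <= d)%N ->
  profile sgn r L d = (1 + sgn) * r ^+ L.
Proof.
move=> Ld; rewrite /profile (minn_idPr Ld) (_ : 2 * L - L = L)%N; last by lia.
by rewrite mulrDl mul1r.
Qed.

(** (1 - y ^ (L + 1)) / (1 - y) is a sum of L + 1 powers, each at least y ^ L. This yields the 1 /
    (L + 1) in the peak estimates, uniformly as y approaches 1. *)
Lemma bernoulli_pow (R : realFieldType) (y : R) L : 0 <= y <= 1 ->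
  L.+1%:R * y ^+ L * (1 - y) <= 1 - y ^+ L.+1.
Proof.
move=> /andP[y0 y1]; elim: L => [|L IH]; first by rewrite expr0 !mul1r expr1.
have yL : 0 <= y ^+ L.+1 by rewrite exprn_ge0.
have h : y * (L.+1%:R * y ^+ L * (1 - y)) <= y * (1 - y ^+ L.+1).
  by rewrite ler_wpM2l.
apply: (@le_trans _ _ (y * (1 - y ^+ L.+1) + (1 - y))); last first.
  by rewrite (exprS y L.+1); lra.
rewrite -natr1 (exprS y L); move: h; rewrite (exprS y L).
have : y * y ^+ L * (1 - y) <= 1 - y by rewrite -exprS ler_piMl ?subr_ge0// exprn_ile1.
by lra.
Qed.

Lemma profile_error (R : realFieldType) (r : R) L : 0 < r < 1 ->
  L.+1%:R * r ^+ (2 * L).+1 * (1 - r ^+ 2) <= 1 - r ^+ (2 * L).+2.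
Proof.
move=> /andP[r0 r1].
have y01 : 0 <= r ^+ 2 <= 1 by rewrite sqr_ge0 expr_le1// ltW.
have := bernoulli_pow L y01; rewrite -!exprM => h.
have -> : ((2 * L).+2 = 2 * L.+1)%N by lia.
apply: le_trans h; rewrite ler_wpM2r ?subr_ge0; try by case/andP: y01.
rewrite ler_wpM2l// exprS ler_piMl ?exprn_ge0 ?ltW//.
Qed.

(** With q = r ^ (2 L + 1), the eigenvalue equation at the peak fails by exactly 2 q (1 - r ^ 2),
    which [profile_error] bounds by 2 / (L + 1) times the peak value 1 - r q. *)
Lemma profile_peak_lower (R : realFieldType) (r : R) L : 0 < r < 1 ->
  (r + r^-1 - 2 / L.+1%:R) * profile (-1) r L.+1 0 <=
  2 * profile (-1) r L.+1 1 + (r^-1 - r) * profile (-1) r L.+1 0.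
Proof.
move=> r01; have /andP[r0 r1] := r01; have := profile_error L r01.
rewrite /profile min0n (minn_idPl _)// subn0 expr0 expr1.
have -> : (2 * L.+1 = (2 * L).+2)%N by lia.
have -> : ((2 * L).+2 - 1 = (2 * L).+1)%N by lia.
rewrite (exprS r (2 * L).+1); move: (r ^+ _) => q h.
rewrite -subr_ge0.
have -> : 2 * (r + -1 * q) + (r^-1 - r) * (1 + -1 * (r * q)) -
  (r + r^-1 - 2 / L.+1%:R) * (1 + -1 * (r * q)) =
  2 / L.+1%:R * (1 - r * q - L.+1%:R * q * (1 - r ^+ 2)).
  by field; rewrite nat1r pnatr_eq0 /= gt_eqF.
by rewrite mulr_ge0 ?divr_ge0// subr_ge0.
Qed.

(** The excess is again 2 q (1 - r ^ 2), and the peak value 1 + r q is at least 1 - r q. *)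
Lemma profile_peak_upper (R : realFieldType) (r : R) L : 0 < r < 1 ->
  2 * profile 1 r L.+1 1 + (r^-1 - r) * profile 1 r L.+1 0 <=
  (r + r^-1 + 2 / L.+1%:R) * profile 1 r L.+1 0.
Proof.
move=> r01; have /andP[r0 r1] := r01; have := profile_error L r01.
rewrite /profile min0n (minn_idPl _)// subn0 expr0 expr1.
have -> : (2 * L.+1 = (2 * L).+2)%N by lia.
have -> : ((2 * L).+2 - 1 = (2 * L).+1)%N by lia.
have q0 : 0 <= r ^+ (2 * L).+1 by rewrite exprn_ge0// ltW.
rewrite (exprS r (2 * L).+1); move: (r ^+ _) q0 => q q0 h.
rewrite -subr_ge0.
have -> : (r + r^-1 + 2 / L.+1%:R) * (1 + 1 * (r * q)) -
  (2 * (r + 1 * q) + (r^-1 - r) * (1 + 1 * (r * q))) =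
  2 / L.+1%:R * (1 + r * q - L.+1%:R * q * (1 - r ^+ 2)).
  by field; rewrite nat1r pnatr_eq0 /= gt_eqF.
have rq : 0 <= r * q by rewrite mulr_ge0// ltW.
by rewrite mulr_ge0 ?divr_ge0// subr_ge0; apply: le_trans h _; lra.
Qed.

Lemma two_le_addV (R : realFieldType) (r : R) : 0 < r -> 2 <= r + r^-1.
Proof.
move=> r0; rewrite -subr_ge0 (_ : r + r^-1 - 2 = (r - 1) ^+ 2 / r).
  by rewrite divr_ge0 ?sqr_ge0// ltW.
by field; rewrite gt_eqF.
Qed.

(** Arithmetic-geometric mean inequality: r ^ m and r ^ (2 L - m) have geometric mean r ^ L. The
    plateau is thus the minimum of the stationary profile. *)
Lemma profile_ge_far (R : realFieldType) (r : R) L d : 0 < r ->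
  2 * r ^+ L <= profile 1 r L d.
Proof.
move=> r0; rewrite /profile; set m := minn d L.
have mL : (m <= L)%N by rewrite geq_minr.
rewrite -subr_ge0.
have -> : r ^+ m + 1 * r ^+ (2 * L - m) - 2 * r ^+ L = r ^+ m * (1 - r ^+ (L - m)) ^+ 2.
  rewrite -[in r ^+ L](subnKC mL) (_ : 2 * L - m = m + ((L - m) + (L - m)))%N; last by lia.
  by rewrite !exprD; ring.
by rewrite mulr_ge0 ?sqr_ge0// exprn_ge0// ltW.
Qed.

Lemma profile_vanishing_ge0 (R : realFieldType) (r : R) L d : 0 < r < 1 ->
  0 <= profile (-1) r L d.
Proof.
move=> /andP[r0 r1]; rewrite /profile; set m := minn d L.
have mL : (m <= L)%N by rewrite geq_minr.
rewrite mulN1r subr_ge0 ler_wiXn2l ?ltW//; lia.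
Qed.

(** Before the cutoff this is an equality. Continued past L, the exact solution would grow again
    symmetrically; freezing it at its minimum only lowers the left side, and on the plateau the
    claim is 2 <= r + 1 / r. *)
Lemma profile_upper_step (R : realFieldType) (r : R) L d : 0 < r -> (0 < L)%N ->
  profile 1 r L d + profile 1 r L d.+2 <= (r + r^-1) * profile 1 r L d.+1.
Proof.
move=> r0 L0; have g2 := two_le_addV r0.
have [dL|Ld] := ltnP d.+1 L; first by rewrite profile_step// gt_eqF.
rewrite [profile _ _ _ d.+2]profile_far ?[profile _ _ _ d.+1]profile_far; try lia.
have p0 : 0 < r ^+ L by rewrite exprn_gt0.
have [Ld'|dL] := leqP L d.
  rewrite profile_far//.
  have := ler_wpM2r (ltW p0) g2; lra.
have -> : d = L.-1 by lia.
rewrite /profile (minn_idPl _); last by lia.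
have -> : (2 * L - L.-1 = L.+1)%N by lia.
have -> : r ^+ L.-1 = r^-1 * r ^+ L.
  by rewrite -{2}(prednK L0) exprS mulrA mulVf ?mul1r// gt_eqF.
rewrite exprS.
have := ler_wpM2r (ltW p0) g2; lra.
Qed.

Lemma jacobi_sum (R : realType) N (V : 'I_N -> R) (i : 'I_N) (f : nat -> R) :
  \sum_j (tridiag R N + diag_mx (\row_i V i)) i j * f j =
  (if (0 < i)%N then f i.-1 else 0) + (if (i.+1 < N)%N then f i.+1 else 0) +
  V i * f i.
Proof.
rewrite -tridiag_sum.
under eq_bigr do rewrite mxE mulrDl.
rewrite big_split; congr (_ + _); rewrite /= (bigD1 i)//= !mxE eqxx big1 ?addr0// => j ji.
by rewrite mxE eq_sym (negPf ji) mulr0n mul0r.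
Qed.

Lemma jacobi_sym (R : realType) N (V : 'rV[R]_N) :
  (tridiag R N + diag_mx V)^T = tridiag R N + diag_mx V.
Proof. by rewrite linearD /= tridiag_sym tr_diag_mx. Qed.

Lemma site_distC m n : site_dist m n = site_dist n m.
Proof. by rewrite /site_dist addnC. Qed.

Lemma site_dist_triangle k m n :
  (site_dist m n <= site_dist m k + site_dist k n)%N.
Proof. rewrite /site_dist; lia. Qed.

Lemma site_dist_pred i : (site_dist i.-1 i <= 1)%N.
Proof. by rewrite /site_dist; lia. Qed.

Lemma site_dist_succ i : site_dist i.+1 i = 1%N.
Proof. by rewrite /site_dist; lia. Qed.

Lemma site_distnn i : site_dist i i = 0%N.
Proof. by rewrite /site_dist subnn. Qed.

Lemma site_dist_lt i j : (i < j)%N ->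
  site_dist i.-1 j = (site_dist i j + (0 < i))%N /\
  site_dist i j = (site_dist i.+1 j).+1.
Proof. by rewrite /site_dist; lia. Qed.

Lemma site_dist_gt i j : (j < i)%N ->
  site_dist i j = (site_dist i.-1 j).+1 /\
  site_dist i.+1 j = (site_dist i j).+1.
Proof. by rewrite /site_dist; lia. Qed.

(* Deleting the sites of D, the sum of the stationary profiles around the sites
   of S is a supersolution. *)
Lemma jacobi_upper (R : realType) N (V : 'I_N -> R) s (S D : {set 'I_N})
    (r delta : R) (L : nat) :
  spectrum (tridiag R N + diag_mx (\row_i V i)) s -> 0 < r < 1 -> 0 <= delta ->
  (forall i j, i \in S -> j \in S -> i != j -> (2 * L.+1 < site_dist i j)%N) ->
  (forall i, i \in S -> i \notin D -> V i <= r^-1 - r) ->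
  (forall i, i \notin S -> V i <= delta) -> (#|D| < N)%N ->
  s`_(#|D|) <= r + r^-1 + delta + 2 / L.+1%:R.
Proof.
move=> As r01 d0 sep VS Vn DN; have /andP[r0 r1] := r01.
have e0 : 0 <= 2 / L.+1%:R :> R by rewrite divr_ge0.
pose p := profile 1 r L.+1; pose c := 2 * r ^+ L.+1.
have c0 : 0 < c by rewrite mulr_gt0 ?exprn_gt0.
have pc d : c <= p d by apply: profile_ge_far.
have pfar d : (L.+1 <= d)%N -> p d = c by move=> h; rewrite /p profile_far.
(* All profiles share the plateau value c. Adding only their excesses over c makes phi equal to the
   profile of a site wherever no other site is close, without choosing a nearest site. *)
pose phi (n : nat) := c + \sum_(i in S) (p (site_dist n i) - c).
have phic n : c <= phi n.
  by rewrite lerDl sumr_ge0// => i _; rewrite subr_ge0.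
have phi0 n : 0 < phi n by apply: lt_le_trans (phic n).
have phi1 n i : i \in S -> (forall j, j \in S -> j != i -> (L < site_dist n j)%N) ->
    phi n = p (site_dist n i).
  move=> iS h; rewrite /phi (bigD1 i)//= big1 ?addr0 => [|j /andP[jS ji]].
    by rewrite addrCA subrr addr0.
  by rewrite pfar ?subrr// h.
have phi2 n : (forall j, j \in S -> (L < site_dist n j)%N) -> phi n = c.
  by move=> h; rewrite /phi big1 ?addr0// => j jS; rewrite pfar ?subrr// h.
(* The conditions that u vanish on D: each deleted site costs one linear condition, hence one
   eigenvalue index. *)
pose B : 'M[R]_(N, #|D|) := \matrix_(i, j) (i == enum_val j)%:R.
apply: (spectrum_upper (B := B)) (jacobi_sym _) As DN _ => u uB.
apply: (qform_supersolution (phi := fun i : 'I_N => phi i)); rewrite ?jacobi_sym//.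
  by move=> i j ij; rewrite !mxE (negPf ij) mulr0n addr0.
move=> i ui; have iD : i \notin D.
  apply: contra ui => iD; have := congr1 (fun M : 'rV_ _ => M 0 (enum_rank_in iD i)) uB.
  rewrite !mxE (bigD1 i)//= mxE enum_rankK_in// eqxx mulr1 big1 ?addr0 => [->//|j ji].
  by rewrite mxE enum_rankK_in// (negPf ji) mulr0.
rewrite jacobi_sum.
(* Since phi is positive, a missing right neighbour may be added. On the left the guard stays,
   because the predecessor of 0 is 0 itself. *)
apply: (@le_trans _ _ (phi i.-1 * (0 < i)%N%:R + phi i.+1 + V i * phi i)).
  rewrite lerD2r; case: ifP => _; rewrite ?mulr1 ?mulr0 ?add0r ?lerD2l;
  by case: ifP => // _; exact: ltW.
have [iS|iS] := boolP (i \in S).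
  have near n : (site_dist n i <= 1)%N -> phi n = p (site_dist n i).
    move=> h; apply: phi1 => // j jS ji; have := sep j i jS iS ji.
    have := site_dist_triangle n j i; rewrite (site_distC j n); move: h.
    by move: (site_dist _ _) (site_dist _ _) (site_dist _ _); clear; lia.
  rewrite !near ?site_dist_pred ?site_dist_succ ?site_distnn//.
  have p0 d : 0 <= p d by apply: le_trans (pc d); exact: ltW.
  have := profile_peak_upper L r01; rewrite -/p => pk.
  have := ler_wpM2r (p0 0%N) (VS i iS iD).
  have : p (site_dist i.-1 i) * (0 < i)%N%:R <= p 1%N.
    case: (posnP i) => [->|i0]; first by rewrite mulr0.
    have := site_dist_succ i.-1; rewrite site_distC prednK// => ->.
    by rewrite mulr1.
  have := mulr_ge0 d0 (p0 0%N).
  move: pk; move: (2 / L.+1%:R) => e pk h1 h2 h3.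
  move: (p (site_dist i.-1 i) * _) (p 0%N) (p 1%N) (V i) h1 h2 h3 pk.
  by move: (r^-1) => r' a b c1 v h1 h2 h3 pk; rewrite !mulrDl; move: pk h3; rewrite !mulrDl; lra.
have Vphi : V i * phi i <= delta * phi i by rewrite ler_wpM2r ?Vn// ltW.
have ephi : 0 <= 2 / L.+1%:R * phi i by rewrite mulr_ge0// ltW.
suff : phi i.-1 * (0 < i)%N%:R + phi i.+1 <= (r + r^-1) * phi i.
  by move: (2 / _) ephi => e ephi; rewrite !mulrDl; lra.
(* Separation by more than 2 (L + 1) leaves at most one site whose profile is off its plateau at i
   or at a neighbour of i. *)
case: (boolP [exists j in S, site_dist i j <= L.+1]%N) => [/existsP[j /andP[jS ij]]|].
  have near n : (site_dist n i <= 1)%N -> phi n = p (site_dist n j).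
    move=> h; apply: phi1 => // k kS kj; have := sep k j kS jS kj.
    have := site_dist_triangle n k j; have := site_dist_triangle i n j.
    rewrite (site_distC k n); move: ij h.
    by move: (site_dist _ _) (site_dist _ _) (site_dist _ _) (site_dist _ _) (site_dist _ _); clear; lia.
  rewrite !near ?site_dist_pred ?site_dist_succ ?site_distnn//.
  case: (ltngtP i j) => [ij'|ij'|/val_inj e]; last by rewrite e jS in iS.
    have [-> e] := site_dist_lt ij'.
    have := profile_upper_step (L := L.+1) (site_dist i.+1 j) r0 isT.
    rewrite -/p -!e => h; apply: le_trans h; rewrite [leRHS]addrC lerD2r.
    case: (0 < i)%N; rewrite ?mulr1 ?mulr0 ?addn1//; exact: le_trans (ltW c0) (pc _).
  have [e ->] := site_dist_gt ij'.
  have := profile_upper_step (L := L.+1) (site_dist i.-1 j) r0 isT.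
  rewrite -/p -!e => h; apply: le_trans h.
  by rewrite (leq_ltn_trans (leq0n j) ij') mulr1.
move/existsPn => h; have h' j : j \in S -> (L.+1 < site_dist i j)%N.
  by move=> jS; have := h j; rewrite jS /= -ltnNge.
have near n : (site_dist n i <= 1)%N -> phi n = c.
  move=> hn; apply: phi2 => j jS; have := h' j jS; move: hn.
  have := site_dist_triangle n i j; rewrite (site_distC i n).
  by move: (site_dist _ _) (site_dist _ _) (site_dist _ _); clear; lia.
rewrite !near ?site_dist_pred ?site_dist_succ ?site_distnn//.
have := ler_wpM2r (ltW c0) (two_le_addV r0).
case: (0 < i)%N; rewrite ?mulr1 ?mulr0; lra.
Qed.

(* The profiles vanishing at distance L + 1 of the sites have disjoint supports
   and are subsolutions. *)
Lemma jacobi_lower (R : realType) N (V : 'I_N -> R) s k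
    (sigma : 'I_k.+1 -> 'I_N) (r delta : R) (L : nat) :
  spectrum (tridiag R N + diag_mx (\row_i V i)) s -> 0 < r < 1 -> 0 <= delta ->
  (forall i j, i != j -> (2 * L.+1 < site_dist (sigma i) (sigma j))%N) ->
  (forall j, r^-1 - r <= V (sigma j)) ->
  (forall j (i : 'I_N), (0 < site_dist i (sigma j) <= L)%N -> - delta <= V i) ->
  (forall j, L < sigma j /\ sigma j + L.+1 < N)%N -> (k < N)%N ->
  r + r^-1 - delta - 2 / L.+1%:R <= s`_k.
Proof.
move=> As r01 d0 sep VS Vn bd kN; have /andP[r0 r1] := r01.
have e0 : 0 <= 2 / L.+1%:R :> R by rewrite divr_ge0.
pose p := profile (-1) r L.+1.
have p0 d : 0 <= p d by apply: profile_vanishing_ge0.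
have pfar d : (L < d)%N -> p d = 0 by move=> h; rewrite /p profile_far// subrr mul0r.
have Js := jacobi_sym (\row_i V i).
pose psi j : 'rV[R]_N := \row_(n < N) p (site_dist n (sigma j)).
have psiE j i : (psi j *m (tridiag R N + diag_mx (\row_i V i))) 0 i =
    (if (0 < i)%N then p (site_dist i.-1 (sigma j)) else 0) +
    (if (i.+1 < N)%N then p (site_dist i.+1 (sigma j)) else 0) +
    V i * p (site_dist i (sigma j)).
  rewrite -(jacobi_sum V i (fun n => p (site_dist n (sigma j)))) mxE.
  apply: eq_bigr=> l _; rewrite [psi _ _ _]mxE mulrC; congr (_ * _).
  by rewrite -{1}Js mxE.
have farE j (i : 'I_N) : (L.+1 < site_dist i (sigma j))%N ->
    (psi j *m (tridiag R N + diag_mx (\row_i V i))) 0 i = 0.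
  move=> h; rewrite psiE (pfar (site_dist i _)) ?mulr0 ?addr0; last exact: ltnW.
  rewrite pfar; last first.
    have := site_dist_triangle i.-1 i (sigma j); have := site_dist_pred i.
    rewrite (site_distC i i.-1); move: h.
    by move: (site_dist _ _) (site_dist _ _) (site_dist _ _); clear; lia.
  rewrite pfar ?if_same ?addr0//.
  have := site_dist_triangle i.+1 i (sigma j); have := site_dist_succ i.
  rewrite (site_distC i i.+1); move: h.
  by move: (site_dist _ _) (site_dist _ _) (site_dist _ _); clear; lia.
apply: (@spectrum_subsolutions _ _ _ _ _ psi) Js As kN _ _ _ _.
- by move=> j i; rewrite mxE.
- move=> j; apply/eqP => /rowP/(_ (sigma j)); rewrite !mxE site_distnn.
  rewrite /p /profile min0n expr0 subn0 mulN1r => /eqP; apply/negP.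
  by rewrite subr_eq0 eq_sym lt_eqF// exprn_ilt1// ltW.
- move=> j i; rewrite psiE mxE.
  have [bl br] := bd j.
  have [il|il] := ltnP L (site_dist i (sigma j)).
    rewrite (pfar _ il) !mulr0 addr0 addr_ge0//; by case: ifP.
  have [e|ij] := posnP (site_dist i (sigma j)).
    have ei : i = sigma j by apply/val_inj; move: e; rewrite /site_dist /=; clear; lia.
    rewrite ei site_distnn.
    have -> : (0 < sigma j)%N by move: bl; clear; lia.
    have -> : ((sigma j).+1 < N)%N by move: br; clear; lia.
    rewrite site_dist_succ.
    have -> : site_dist (sigma j).-1 (sigma j) = 1%N.
      by move: bl; rewrite /site_dist; clear; lia.
    have := profile_peak_lower L r01; rewrite -/p.
    have := ler_wpM2r (p0 0%N) (VS j); have := mulr_ge0 d0 (p0 0%N).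
    move: (2 / _) (p _) (p _) (V _) => e1 p1 q v.
    by move: (r^-1) => r' h1 h2 h3; rewrite !mulrDl in h2 h3 *; lra.
  have Vi := ler_wpM2r (p0 (site_dist i (sigma j))) (Vn j i _).
  have {Vi} := Vi (introT andP (conj ij il)).
  have := mulr_ge0 e0 (p0 (site_dist i (sigma j))).
  have -> : (0 < i)%N by move: bl il; rewrite /site_dist; clear; lia.
  have -> : (i.+1 < N)%N by move: br il; rewrite /site_dist; clear; lia.
  suff -> : p (site_dist i.-1 (sigma j)) + p (site_dist i.+1 (sigma j)) =
      (r + r^-1) * p (site_dist i (sigma j)).
    move: (2 / _) (p _) (V _) => e1 q v.
    by move: (r^-1) => r' h1 h2; rewrite !mulrDl mulNr in h1 h2 *; lra.
  case: (ltngtP i (sigma j)) => [ij'|ij'|e']; last by rewrite e' site_distnn in ij.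
    have [-> e] := site_dist_lt ij'.
    have -> : (0 < i)%N by move: bl il; rewrite /site_dist; clear; lia.
    rewrite addn1 addrC e /p profile_step ?gt_eqF//.
    by move: il; rewrite e ltnS.
  have [e ->] := site_dist_gt ij'.
  rewrite e /p profile_step ?gt_eqF//.
  by move: il; rewrite e ltnS.
move=> j l i jl; rewrite [psi l _ _]mxE [psi j _ _]mxE.
have [h|h] := ltnP L (site_dist i (sigma l)); first by rewrite (pfar _ h) !mulr0.
(* Applying the matrix enlarges the support of psi j by one site; the separation still keeps it away
   from the support of psi l. *)
have h' : (L.+1 < site_dist i (sigma j))%N.
  have := sep _ _ jl; have := site_dist_triangle i (sigma j) (sigma l).
  rewrite (site_distC (sigma j) i); move: h.
  by move: (site_dist _ _) (site_dist _ _) (site_dist _ _); clear; lia.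
by rewrite pfar ?farE ?mul0r//; exact: ltnW.
Qed.

(** * Order statistics of the potential and their comparison with the eigenvalues *)

Definition order_stats (R : realDomainType) N (V : 'I_N -> R) : seq R :=
  sort >=%R [seq V i | i : 'I_N].

Lemma ge_trans_rel (R : realDomainType) : transitive (>=%R : rel R).
Proof. by move=> x y z /= h1 h2; exact: le_trans h2 h1. Qed.

Lemma ge_total_rel (R : realDomainType) : total (>=%R : rel R).
Proof. by move=> x y; exact: le_total. Qed.

Lemma size_order_stats (R : realDomainType) N (V : 'I_N -> R) :
  size (order_stats V) = N.
Proof. by rewrite size_sort size_image card_ord. Qed.

Lemma sorted_ge_nth (R : realDomainType) (s : seq R) i j :
  sorted >=%R s -> (i <= j < size s)%N -> s`_j <= s`_i.
Proof.
move=> ss /andP[ij jN]; apply: (sorted_leq_nth (@ge_trans_rel R) _ 0 ss) => //.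
- by move=> x; exact: lexx.
- by rewrite inE (leq_ltn_trans ij).
Qed.

Lemma sorted_order_stats (R : realDomainType) N (V : 'I_N -> R) :
  sorted >=%R (order_stats V).
Proof. by apply: sort_sorted; exact: ge_total_rel. Qed.

Lemma order_stats_le (R : realDomainType) N (V : 'I_N -> R) i j :
  (i <= j < N)%N -> (order_stats V)`_j <= (order_stats V)`_i.
Proof.
move=> ij; apply: sorted_ge_nth; first exact: sorted_order_stats.
by rewrite size_order_stats.
Qed.

Lemma order_stats_sites (R : realDomainType) N (V : 'I_N -> R) :
  exists e : seq 'I_N, [/\ uniq e, size e = N & order_stats V = [seq V i | i <- e]].
Proof.
exists (sort (relpre V >=%R) (enum 'I_N)); split.
- by rewrite sort_uniq enum_uniq.
- by rewrite size_sort size_enum_ord.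
- by rewrite /order_stats /image_mem sort_map.
Qed.

Lemma mem_sites N (e : seq 'I_N) : uniq e -> size e = N -> e =i 'I_N.
Proof.
move=> ue se; apply/subset_cardP; last exact: subset_predT.
by rewrite (card_uniqP ue) se card_ord.
Qed.

(** Duality between ranks and counts, through which order statistics are read off from cell
    counts. *)
Lemma sorted_count_gt (R : realDomainType) (s : seq R) (t : R) j :
  sorted >=%R s -> (j < count (> t) s)%N = (j < size s)%N && (t < s`_j).
Proof.
move=> so; have [jN|jN] := ltnP j (size s); last first.
  by apply/negbTE; rewrite -leqNgt (leq_trans _ jN)// count_size.
apply/idP/idP => h.
  rewrite ltNge; apply: contraL h => h; rewrite -leqNgt.
  rewrite -(cat_take_drop j s) count_cat.
  have -> : count (> t) (drop j s) = 0%N.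
    apply/eqP; rewrite -leqn0 leqNgt -has_count; apply/hasPn => x /(nthP 0)[m].
    rewrite size_drop => mj <-; rewrite nth_drop -leNgt.
    apply: le_trans h.
    by apply: sorted_ge_nth => //; rewrite leq_addr/= -ltn_subRL.
  by rewrite addn0 (leq_trans (count_size _ _))// size_take jN.
rewrite -(cat_take_drop j.+1 s) count_cat.
apply: leq_trans (leq_addr _ _).
have -> : count (> t) (take j.+1 s) = size (take j.+1 s).
  apply/eqP; rewrite -all_count; apply/(all_nthP 0) => m.
  rewrite size_take; case: ifP => [_ mj|jN' mN].
    by rewrite nth_take// (lt_le_trans h)// sorted_ge_nth// jN -ltnS mj.
  rewrite nth_take; last by lia.
  by rewrite (lt_le_trans h)// sorted_ge_nth// jN andbT; lia.
by rewrite size_take; case: ifP => //; lia.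
Qed.

Lemma spectrum_diag (R : rcfType) N (V : 'I_N -> R) :
  spectrum (diag_mx (\row_i V i)) (order_stats V).
Proof.
split; first by apply: sort_sorted; exact: ge_total_rel.
rewrite char_poly_diag_mx; apply/perm_big; rewrite perm_sym perm_sort.
by under [X in perm_eq _ X]eq_map do rewrite mxE.
Qed.

(** The upper bound deletes the k sites of largest potential and treats every site with |V| > delta
    as a peak; the lower bound uses the k + 1 largest sites. Large negative entries also count as
    large: they have to stay away from the profiles of the lower bound. *)
Lemma jacobi_eigenvalue (R : realType) N (V : 'I_N -> R) s k (delta : R) L :
  spectrum (tridiag R N + diag_mx (\row_i V i)) s -> 0 <= delta -> (k < N)%N ->
  (forall i j : 'I_N, delta < `|V i| -> delta < `|V j| -> i != j ->
     (2 * L.+1 < site_dist i j)%N) ->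
  (forall i : 'I_N, delta < `|V i| -> (L < i /\ i + L.+1 < N)%N) ->
  delta < (order_stats V)`_k ->
  `|s`_k - Num.sqrt ((order_stats V)`_k ^+ 2 + 4)| <= delta + 2 / L.+1%:R.
Proof.
move=> As d0 kN sep bd; have := @order_stats_le _ N V.
have [e [ue se ->]] := order_stats_sites V => yle.
have yE (j : nat) (jN : (j < N)%N) i0 : [seq V i | i <- e]`_j = V (nth i0 e j).
  by rewrite (nth_map i0)// se.
set x := _`_k => dx; have x0 : 0 < x by apply: le_lt_trans dx.
(* r is the root in ]0, 1[ of 1 / r - r = x, and its inverse is (g + x) / 2. *)
pose g := Num.sqrt (x ^+ 2 + 4); pose r := (g - x) / 2.
have g2 : g ^+ 2 = x ^+ 2 + 4 by rewrite sqr_sqrtr// addr_ge0// sqr_ge0.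
have g0 : 0 <= g by rewrite sqrtr_ge0.
have xg : x < g by rewrite -(ltr_pXn2r (n := 2))// ?nnegrE ?ltW// g2 ltrDl.
have gx : g < x + 2.
  rewrite -(ltr_pXn2r (n := 2))// ?nnegrE ?addr_ge0 ?ltW// g2; nra.
have r01 : 0 < r < 1 by rewrite /r; lra.
have rV : r^-1 = (g + x) / 2.
  have r_neq0 : r != 0 by case/andP: r01 => h _; rewrite gt_eqF.
  apply: (mulIf r_neq0); rewrite mulVf// /r.
  have -> : (g + x) / 2 * ((g - x) / 2) = (g ^+ 2 - x ^+ 2) / 4 by field.
  by rewrite g2; field.
have rx : r^-1 - r = x by rewrite rV /r; field.
have rg : r + r^-1 = g by rewrite rV /r; field.
have i0 : 'I_N by exact: Ordinal kN.
pose sigma (j : 'I_k.+1) := nth i0 e j.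
have jN (j : 'I_k.+1) : (j < N)%N by apply: leq_trans kN; rewrite ltn_ord.
have sx j : x <= V (sigma j).
  by rewrite -yE// yle// kN andbT -ltnS ltn_ord.
have sd j : delta < `|V (sigma j)|.
  apply: lt_le_trans dx _; apply: le_trans (sx j) _; exact: ler_norm.
rewrite -/g ler_distl; apply/andP; split.
  rewrite -rg; apply: le_trans (_ : r + r^-1 - delta - 2 / L.+1%:R <= _).
    by rewrite opprD addrA.
  apply: (jacobi_lower (sigma := sigma)) As r01 d0 _ _ _ _ kN.
  - move=> i j ij; apply: sep => //; rewrite nth_uniq ?se//.
  - by move=> j; rewrite rx.
  - move=> j i /andP[d1 dL]; rewrite leNgt; apply/negP => Vi.
    have Vi' : delta < `|V i| by rewrite ltrNr in Vi; apply: lt_le_trans Vi _; rewrite -normrN ler_norm.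
    have ij : i != sigma j by apply: contraTneq d1 => ->; rewrite site_distnn.
    by have := sep _ _ Vi' (sd j) ij; lia.
  - by move=> j; apply: bd.
pose D := [set i in take k e].
have cD : #|D| = k.
  by rewrite cardsE (card_uniqP _) ?take_uniq// size_take se kN.
rewrite -rg addrA -cD.
apply: (jacobi_upper (S := [set i | delta < `|V i|]) (D := D)) As r01 d0 _ _ _ _.
- by move=> i j; rewrite !inE => hi hj ij; exact: sep.
- move=> i _; rewrite inE rx => iD.
  have ie : i \in e by rewrite mem_sites.
  have iN : (index i e < N)%N by rewrite -[X in (_ < X)%N]se index_mem.
  rewrite -(nth_index i0 ie) -yE//; apply: yle; rewrite iN andbT leqNgt.
  by apply: contra iD => h; rewrite in_take.
- by move=> i; rewrite inE -leNgt; apply: le_trans; exact: ler_norm.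
- by rewrite cD.
Qed.

(** * Multinomial counts *)

Definition ffun_cons T N (x : T) (f : {ffun 'I_N -> T}) : {ffun 'I_N.+1 -> T} :=
  [ffun i => oapp f x (unlift ord0 i)].

Lemma ffun_cons0 T N (x : T) (f : {ffun 'I_N -> T}) : ffun_cons x f ord0 = x.
Proof. by rewrite ffunE unlift_none. Qed.

Lemma ffun_cons_lift T N (x : T) (f : {ffun 'I_N -> T}) i :
  ffun_cons x f (lift ord0 i) = f i.
Proof. by rewrite ffunE liftK. Qed.

Lemma big_ffun_recl (R : comNzSemiRingType) (T : finType) N
    (F : {ffun 'I_N.+1 -> T} -> R) :
  \sum_f F f =
  \sum_(x : T) \sum_(f : {ffun 'I_N -> T})
    F (ffun_cons x f).
Proof.
rewrite pair_big /=.
rewrite (reindex (fun xf : T * {ffun 'I_N -> T} =>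
  ffun_cons xf.1 xf.2)) //=.
exists (fun f => (f ord0, [ffun i => f (lift ord0 i)])) => [[x f] _|f _] /=.
  by rewrite ffun_cons0; congr pair; apply/ffunP=> i; rewrite ffunE ffun_cons_lift.
apply/ffunP=> i; rewrite ffunE; case: unliftP => [j ->|->] //=.
by rewrite ffunE.
Qed.

(** The value [None] stands for a draw that falls in none of the m cells; it is not counted. *)
Definition bin_count m N (f : {ffun 'I_N -> option 'I_m}) (b : 'I_m) : nat :=
  \sum_i (f i == Some b).

Lemma bin_count_recl m N x (f : {ffun 'I_N -> option 'I_m}) b :
  bin_count (ffun_cons x f) b =
  ((x == Some b) + bin_count f b)%N.
Proof.
rewrite /bin_count big_ord_recl ffun_cons0; congr (_ + _)%N.
by apply: eq_bigr=> i _; rewrite ffun_cons_lift.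
Qed.

Definition multinomial_sum (R : comNzRingType) m (w : option 'I_m -> R) N
    (n : {ffun 'I_m -> nat}) : R :=
  \sum_(f : {ffun 'I_N -> option 'I_m} | [forall b, bin_count f b == n b])
    \prod_i w (f i).

(** Closed form of the multinomial law. The falling factorial vanishes when more than N points are
    prescribed, which makes the truncated exponent harmless. *)
Definition multinomial_mass (R : fieldType) m (p : 'I_m -> R) (q : R) N
    (n : {ffun 'I_m -> nat}) : R :=
  (N ^_ (\sum_b n b))%:R * (\prod_b (p b ^+ n b / (n b)`!%:R)) *
  q ^+ (N - \sum_b n b).

Definition decr m (n : {ffun 'I_m -> nat}) (b : 'I_m) : {ffun 'I_m -> nat} :=
  [ffun c => if c == b then (n b).-1 else n c].

(** Conditioning on the first draw, which falls outside all cells or in a cell b whose prescribed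
    count is positive. *)
Lemma multinomial_sumS (R : comNzRingType) m (w : option 'I_m -> R) N n :
  multinomial_sum w N.+1 n = w None * multinomial_sum w N n +
  \sum_(b | (0 < n b)%N) w (Some b) * multinomial_sum w N (decr n b).
Proof.
rewrite /multinomial_sum big_mkcond big_ffun_recl /=.
have step x (P : pred {ffun 'I_N -> option 'I_m}) :
   (forall f, [forall b, bin_count (ffun_cons x f) b == n b] = P f) ->
   \sum_(f : {ffun 'I_N -> option 'I_m})
     (if [forall b, bin_count (ffun_cons x f) b == n b]
      then \prod_i w ((ffun_cons x f) i) else 0) =
   w x * \sum_(f : {ffun 'I_N -> option 'I_m} | P f) \prod_i w (f i).
  move=> hP; rewrite big_distrr /= [RHS]big_mkcond; apply: eq_bigr=> f _.
  rewrite hP; case: ifP => // _; rewrite big_ord_recl ffun_cons0.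
  by congr (_ * _); apply: eq_bigr=> i _; rewrite ffun_cons_lift.
rewrite (bigD1 None)//= (step None (fun f => [forall b, bin_count f b == n b])); last first.
  by move=> f; apply: eq_forallb => b; rewrite bin_count_recl.
congr (_ + _); rewrite [RHS]big_mkcond /=.
rewrite (reindex_omap Some id); last by case.
apply: eq_big => [b|b _]; first by rewrite eqxx.
have [nb|nb] := posnP (n b).
  rewrite big1// => f _; case: ifP => // /forallP/(_ b).
  by rewrite bin_count_recl eqxx nb.
rewrite (step (Some b) (fun f => [forall c, bin_count f c == decr n b c])) // => f; apply: eq_forallb => c.
rewrite bin_count_recl ffunE (inj_eq Some_inj) (eq_sym b c).
case: (c =P b) => [->|_]; last by rewrite add0n.
by rewrite add1n -(prednK nb) eqSS.
Qed.

Lemma sum_decr m (n : {ffun 'I_m -> nat}) b : (0 < n b)%N ->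
  (\sum_c n c = (\sum_c decr n b c).+1)%N.
Proof.
move=> nb; rewrite (bigD1 b)//= [in RHS](bigD1 b)//= ffunE eqxx.
rewrite -{1}(prednK nb) addSn; congr (_ + _).+1.
by apply: eq_bigr=> c cb; rewrite ffunE (negPf cb).
Qed.

Lemma ffactSn_pascal N s : (N.+1 ^_ s.+1 = N ^_ s.+1 + s.+1 * N ^_ s)%N.
Proof.
by rewrite -!bin_ffact binS mulnDl (factS s) (mulnCA 'C(N, s)).
Qed.

(** Induction on the number of draws. In the recursion the cell b contributes n b times a common
    factor; summing over b gives s, and what remains is the Pascal rule for falling factorials. *)
Lemma multinomial_massE (R : numFieldType) m (p : 'I_m -> R) (q : R) N n :
  multinomial_sum (oapp p q) N n = multinomial_mass p q N n.
Proof.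
elim: N n => [|N IH] n.
  rewrite /multinomial_sum /multinomial_mass sub0n expr0 mulr1.
  have e (f : {ffun 'I_0 -> option 'I_m}) b : bin_count f b = 0%N.
    by rewrite /bin_count big_ord0.
  have [/eqP s0|s0] := boolP (\sum_b n b == 0)%N.
    have n0 b : n b = 0%N.
      by apply/eqP; move/eqP: s0; rewrite sum_nat_eq0 => /forallP/(_ b).
    rewrite s0 ffactn0 mul1r [RHS]big1 => [|b _]; last first.
      by rewrite n0 expr0 fact0 divr1.
    under eq_bigr do rewrite big_ord0.
    rewrite sumr_const (_ : #|_| = 1%N)//.
    rewrite (eq_card (B := {: {ffun 'I_0 -> option 'I_m}})).
      by rewrite card_ffun card_ord expn0.
    by move=> f; rewrite !inE; apply/forallP=> b; rewrite e n0.
  rewrite ffact0n (negPf s0) mul0r big1// => f /forallP h; exfalso.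
  by move: s0; rewrite sum_nat_eq0 => /negP; apply; apply/forallP=> b; rewrite -(eqP (h b)) e.
rewrite multinomial_sumS IH /= /multinomial_mass.
set s := (\sum_b n b)%N; set Q := \prod_b _.
have [s0|spos] := posnP s.
  rewrite s0 !ffactn0 !subn0 big_pred0 ?addr0 => [|b]; first by rewrite exprS; ring.
  move/eqP: s0; rewrite sum_nat_eq0 => /forallP/(_ b)/eqP ->.
  by rewrite ltnn.
have -> : \sum_(b | (0 < n b)%N) p b * multinomial_sum (oapp p q) N (decr n b) =
    \sum_(b | (0 < n b)%N) (n b)%:R * ((N ^_ s.-1)%:R * Q * q ^+ (N.+1 - s)).
  apply: eq_bigr => b nb; rewrite IH /multinomial_mass.
  have -> : (\sum_c decr n b c = s.-1)%N by rewrite /s (sum_decr nb).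
  have -> : (N - s.-1 = N.+1 - s)%N by lia.
  have -> : Q = p b * (n b)%:R^-1 * \prod_c (p c ^+ decr n b c / (decr n b c)`!%:R).
    rewrite /Q (bigD1 b)//= [in RHS](bigD1 b)//= ffunE eqxx.
    rewrite (eq_bigr (fun c => p c ^+ decr n b c / (decr n b c)`!%:R)); last first.
      by move=> c cb; rewrite ffunE (negPf cb).
    rewrite -{1 2}(prednK nb) exprS factS natrM prednK//.
    have n0 : (n b)%:R != 0 :> R by rewrite pnatr_eq0 -lt0n.
    have f0 : (n b).-1`!%:R != 0 :> R by rewrite pnatr_eq0 -lt0n fact_gt0.
    by field; rewrite n0 f0.
  have n0 : (n b)%:R != 0 :> R by rewrite pnatr_eq0 -lt0n.
  by field.
have -> : \sum_(b | (0 < n b)%N) (n b)%:R * ((N ^_ s.-1)%:R * Q * q ^+ (N.+1 - s)) =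
   s%:R * ((N ^_ s.-1)%:R * Q * q ^+ (N.+1 - s)).
  rewrite -mulr_suml; congr (_ * _); rewrite /s natr_sum [LHS]big_mkcond.
  by apply: eq_bigr=> b _; case: posnP => // ->.
have -> : q * ((N ^_ s)%:R * Q * q ^+ (N - s)) = (N ^_ s)%:R * Q * q ^+ (N.+1 - s).
  have [sN|Ns] := leqP s N; first by rewrite subSn// exprS; ring.
  by rewrite ffact_small// !mul0r mulr0.
have -> : (N.+1 ^_ s = N ^_ s + s * N ^_ s.-1)%N.
  by case: s spos => // s' _; exact: ffactSn_pascal.
by rewrite natrD natrM; ring.
Qed.

(** * Convergence of laws of random vectors *)

Section mean.
Context {R : realType} {d : measure_display} {T : measurableType d}.
Variable P : probability T R.
Implicit Types f g : T -> R.

(** Real-valued expectation: the integrands below are bounded, and [expectation_mean] returns to the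
    extended reals. *)
Definition mean f : R := \int[P]_w f w.

Lemma bounded_integrable f M : measurable_fun setT f ->
  (forall w, `|f w| <= M) -> P.-integrable setT (EFin \o f).
Proof.
move=> mf fM; apply: measurable_bounded_integrable => //.
  exact: (le_lt_trans (probability_le1 P measurableT) (ltry _)).
exists M; split; first exact: num_real.
by move=> y My w _; apply: le_trans (fM w) (ltW My).
Qed.

Lemma expectation_mean f M : measurable_fun setT f ->
  (forall w, `|f w| <= M) -> ('E_P[f])%E = (mean f)%:E.
Proof.
move=> mf fM; rewrite unlock /mean /Rintegral fineK//.
exact: (integrable_fin_num measurableT (bounded_integrable mf fM)).
Qed.

Lemma mean_indic A : measurable A -> mean (\1_A) = fine (P A).
Proof. by move=> mA; rewrite /mean /Rintegral integral_indic// setIT. Qed.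

Lemma fine_prob_le A B : measurable A -> measurable B -> A `<=` B ->
  fine (P A) <= fine (P B).
Proof.
by move=> mA mB AB; rewrite fine_le ?fin_num_measure// le_measure ?inE.
Qed.

(** The integrand |f - g| is at most e + 2 M times the indicator of A. This is the only estimate
    used to discard bad events. *)
Lemma mean_close f g M e A : measurable_fun setT f -> measurable_fun setT g ->
  (forall w, `|f w| <= M) -> (forall w, `|g w| <= M) -> measurable A ->
  0 <= e -> (forall w, ~ A w -> `|f w - g w| <= e) ->
  `|mean f - mean g| <= e + 2 * M * fine (P A).
Proof.
move=> mf mg fM gM mA e0 fg.
have [[w]|T0] := pselect (exists w : T, True); last first.
  have := @probability_setT _ _ _ P; rewrite (_ : setT = set0) ?measure0.
    by move=> [] /eqP; rewrite eq_sym oner_eq0.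
  by apply/seteqP; split=> // w _; apply: T0; exists w.
move=> _; have M0 : 0 <= M by apply: le_trans (fM w).
have ifg : P.-integrable setT (EFin \o (fun x => f x - g x)).
  apply: (@bounded_integrable _ (M + M)); first exact: measurable_funB.
  by move=> x; apply: le_trans (ler_normB _ _) _; rewrite lerD.
rewrite /mean -RintegralB//; last 2 first.
- exact: bounded_integrable mf fM.
- exact: bounded_integrable mg gM.
apply: le_trans (le_normr_Rintegral _ _) _ => //.
have mA1 : measurable_fun setT (\1_A : T -> R) by exact: measurable_indic.
have i1 : P.-integrable setT (EFin \o (fun=> e)).
  by apply: (@bounded_integrable _ `|e|).
have i2 : P.-integrable setT (EFin \o (fun w => 2 * M * \1_A w)).
  apply: (@bounded_integrable _ (2 * M)).
    by apply: measurable_funM => //; exact: measurable_cst.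
  move=> x; rewrite indicE; case: (_ \in _); rewrite ?mulr1 ?mulr0 ?normr0.
    by rewrite ger0_norm// mulr_ge0.
  by rewrite mulr_ge0.
apply: (@le_trans _ _ (\int[P]_x (e + 2 * M * \1_A x))).
  apply: le_Rintegral => //.
  - apply: (@bounded_integrable _ (M + M)).
      by apply: measurableT_comp => //; exact: measurable_funB.
    by move=> x; rewrite normr_id; apply: le_trans (ler_normB _ _) _; rewrite lerD.
  - apply: (@bounded_integrable _ (`|e| + 2 * M)).
      by apply: measurable_funD => //; apply: measurable_funM => //; exact: measurable_cst.
    move=> x; apply: le_trans (ler_normD _ _) _; rewrite lerD2l indicE.
    case: (_ \in _); rewrite ?mulr1 ?mulr0 ?normr0 ?mulr_ge0//.
    by rewrite ger0_norm// mulr_ge0.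
  - move=> x _; rewrite indicE; have [xA|xA] := boolP (x \in A).
      rewrite mulr1 ler_wpDl// (le_trans (ler_normB _ _))// mulr_natl mulr2n.
      by rewrite lerD.
    by rewrite mulr0 addr0 fg// => xA'; move/negP: xA; apply; exact/mem_set.
rewrite (RintegralD measurableT i1 i2) Rintegral_cst//.
have PT : fine (P setT) = 1 by rewrite probability_setT.
rewrite PT mulr1 lerD2l.
have -> : \int[P]_x (2 * M * \1_A x) = 2 * M * mean (\1_A).
  rewrite RintegralZl//; apply: (@bounded_integrable _ 1) => // x.
  by rewrite indicE; case: (_ \in _); rewrite ?normr1 ?normr0.
by rewrite mean_indic.
Qed.

End mean.

(** By continuity the set where F exceeds x is the union of the rational boxes it contains. There
    are countably many, and the preimage of each is a finite intersection of conditions on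
    coordinates. *)
Lemma measurable_fun_row {R : realType} {d : measure_display}
    {T : measurableType d} k (Z : T -> 'rV[R]_k) (F : 'rV[R]_k -> R) :
  (forall i, measurable_fun setT (fun w => Z w 0 i)) -> continuous F ->
  measurable_fun setT (F \o Z).
Proof.
move=> mZ cF; apply: (measurability _ (RGenOInfty.measurableE R)) => //.
move=> _ [_ [x ->] <-]; rewrite setTI.
pose box (c : 'rV[rat]_k * rat) : set 'rV[R]_k :=
  [set v | forall i, `|v 0 i - ratr (c.1 0 i)| < ratr c.2].
pose good (c : 'rV[rat]_k * rat) := box c `<=` F @^-1` `]x, +oo[.
have -> : (F \o Z) @^-1` `]x, +oo[ =
    \bigcup_c (if `[<good c>] then Z @^-1` box c else set0).
  apply/seteqP; split=> [w /= Fw|w [c _]]; last first.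
    by case: asboolP => // gc; exact: gc.
  have /(cF (Z w)) : nbhs (F (Z w)) [set y | x < y].
    by apply: lt_nbhsr; rewrite in_itv /= andbT in Fw.
  move/nbhs_ballP => [e /= e0 be].
  have [q /andP[q0 qe]] : exists q : rat, (0 < (ratr q : R) < e / 2).
    have [q] := rat_in_itvoo (divr_gt0 e0 (ltr0Sn R 1)).
    by rewrite in_itv /=; exists q.
  have hr i : exists r : rat, `|Z w 0 i - ratr r| < ratr q.
    have /rat_in_itvoo[r] : Z w 0 i - ratr q < Z w 0 i + ratr q by move: q0; lra.
    by rewrite in_itv /= => h; exists r; rewrite distrC ltr_distl.
  pose c := (\row_i xchoose (hr i), q).
  have cb : box c (Z w) by move=> i; rewrite mxE; exact: (xchooseP (hr i)).
  exists c => //; case: asboolP => [//|]; case => v vb; rewrite /= in_itv /= andbT.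
  suff /be : ball (Z w) e v by [].
  split=> // i j; rewrite !ord1 -ball_normE /ball_ /=.
  apply: le_lt_trans (ler_distD (ratr (c.1 0 j)) _ _) _.
  rewrite [ltRHS]splitr ltrD//; first by apply: lt_trans qe; exact: cb.
  by rewrite distrC; apply: lt_trans qe; exact: vb.
apply: countable_bigcupT_measurable => [|c]; first exact: countableP.
case: ifP => // _.
have -> : Z @^-1` box c = \bigcap_i [set w | `|Z w 0 i - ratr (c.1 0 i)| < ratr c.2].
  by apply/seteqP; split=> w /= h i; [move=> _|]; exact: h.
apply: fin_bigcap_measurable => // i _.
rewrite -[X in measurable X]setTI.
have mf : measurable_fun setT (fun w => `|Z w 0 i - ratr (c.1 0 i)|).
  by apply: measurableT_comp => //; exact: measurable_funB.
have := mf measurableT [set` `]-oo, ratr c.2[] (measurable_itv _).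
by congr measurable; apply/seteqP; split=> w; rewrite /= in_itv.
Qed.

Lemma cvg_approx (R : realType) (u : nat -> R) (l : R) :
  (forall e, 0 < e -> exists v l', [/\ v n @[n --> \oo] --> l', `|l - l'| <= e &
     \forall n \near \oo, `|u n - v n| <= e]) ->
  u n @[n --> \oo] --> l.
Proof.
move=> h; apply/cvgrPdist_le => e e0.
have e3 : 0 < e / 3 by rewrite divr_gt0.
have [v [l' [/cvgrPdist_le/(_ _ e3) vl ll' uv]]] := h _ e3.
near=> n.
have h1 : `|l' - v n| <= e / 3 by near: n.
have h2 : `|u n - v n| <= e / 3 by near: n.
rewrite (_ : l - u n = (l - l') + (l' - v n) - (u n - v n)); last by ring.
apply: le_trans (ler_normB _ _) _; have := ler_normD (l - l') (l' - v n); lra.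
Unshelve. all: by end_near. Qed.

(** Heine's theorem in a one-sided form: only x lies in the compact set, so the approximating vector
    y may leave it. *)
Lemma compact_uniform (R : realType) k (K : set 'rV[R]_k) (F : 'rV[R]_k -> R) (e : R) :
  compact K -> continuous F -> 0 < e ->
  exists2 del : R, 0 < del & forall x y : 'rV[R]_k, K x ->
    (forall i, `|x 0 i - y 0 i| < del) -> `|F x - F y| < e.
Proof.
move=> /compact_near_coveringP cK cF e0.
have := cK R (0^'+) (fun del x => forall y : 'rV[R]_k,
  (forall i, `|x 0 i - y 0 i| < del) -> `|F x - F y| < e) _.
move=> /(_ _)[].
  move=> x Kx.
  have e2 : 0 < e / 2 by rewrite divr_gt0.
  have /cvgrPdist_lt/(_ _ e2) /nbhs_ballP[r /= r0 hr] := cF x.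
  have r2 : 0 < r / 2 by rewrite divr_gt0.
  near=> x' del => y xy.
  have dr : del < r / 2 by near: del; exact: nbhs_right_lt.
  have xx' : ball x (r / 2) x' by near: x'; exact: nbhsx_ballx.
  have xy' : ball x r y.
    split=> // i j; rewrite ord1 -ball_normE /ball_ /=.
    apply: le_lt_trans (ler_distD (x' 0 j) _ _) _.
    rewrite [ltRHS]splitr ltrD//; first by case: xx' => _ /(_ 0 j); rewrite -ball_normE.
    exact: lt_trans (xy j) dr.
  have xx'' : ball x r x' by apply: le_ball xx'; lra.
  apply: le_lt_trans (ler_distD (F x) _ _) _.
  rewrite [ltRHS]splitr ltrD//; first by rewrite distrC; exact: hr.
  exact: hr.
move=> del /= del0 h; exists (del / 2); first by rewrite divr_gt0.
move=> x y Kx; apply: (h (del / 2)) => //=.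
  by rewrite sub0r normrN gtr0_norm ?divr_gt0// gtr_pMr// invf_lt1// ltr1n.
by rewrite divr_gt0.
Unshelve. all: by end_near. Qed.

Section laws.
Context {R : realType} {d : measure_display} {T : measurableType d}.
Variable P : probability T R.

Lemma mean_indic_sum (M : nat) (a : nat -> R) (A : nat -> set T) :
  (forall c, measurable (A c)) ->
  mean P (fun w => \sum_(c < M) a c * \1_(A c) w) =
  \sum_(c < M) a c * fine (P (A c)).
Proof.
move=> mA.
have int1 (c : nat) : P.-integrable setT (EFin \o (\1_(A c) : T -> R)).
  apply: (@bounded_integrable _ _ _ _ _ 1) => // x.
  by rewrite indicE; case: (_ \in _); rewrite ?normr1 ?normr0.
have mS m : measurable_fun setT (fun w => \sum_(c < m) a c * \1_(A c) w).
  by apply: measurable_sum => c; apply: measurable_funM => //; exact: measurable_cst.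
have intS m : P.-integrable setT (EFin \o (fun w => \sum_(c < m) a c * \1_(A c) w)).
  apply: (@bounded_integrable _ _ _ _ _ (\sum_(c < m) `|a c|)) => // w.
  apply: le_trans (ler_norm_sum _ _ _) _; apply: ler_sum => c _.
  rewrite normrM ler_piMr// indicE; case: (_ \in _); rewrite ?normr1 ?normr0//.
elim: M => [|M IH].
  rewrite big_ord0 /mean; under eq_Rintegral do rewrite big_ord0.
  by rewrite Rintegral_cst// mul0r.
rewrite big_ord_recr /= -IH /mean; under eq_Rintegral do rewrite big_ord_recr /=.
have i1 : P.-integrable setT (EFin \o (fun w => a M * \1_(A M) w)).
  apply: (@bounded_integrable _ _ _ _ _ `|a M|).
    by apply: measurable_funM => //; exact: measurable_cst.
  by move=> x; rewrite normrM ler_piMr// indicE; case: (_ \in _); rewrite ?normr1 ?normr0.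
rewrite (RintegralD measurableT (intS M) i1); congr (_ + _).
by rewrite RintegralZl// -mean_indic.
Qed.

Lemma decreasing_prob_near (A : nat -> set T) (e : R) : 0 < e ->
  (forall n, measurable (A n)) -> (forall n, A n.+1 `<=` A n) ->
  exists n, fine (P (A n)) <= fine (P (\bigcap_n A n)) + e.
Proof.
move=> e0 mA decA.
have ninc : nonincreasing_seq A by apply/nonincreasing_seqP => n; exact/subsetPset/decA.
have fin0 : (P (A 0%N) < +oo)%E by rewrite ltey_eq fin_num_measure.
have mI : measurable (\bigcap_n A n) by apply: bigcap_measurable => //; exists 0%N.
have := @nonincreasing_cvg_mu _ _ R P A fin0 mA mI ninc.
rewrite -[X in _ --> X]fineK ?fin_num_measure// => /fine_cvgP[_].
move=> /cvgrPdist_le/(_ _ e0)[N _ /(_ N (leqnn N))] /=.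
by rewrite ler_norml => /andP[h1 h2]; exists N; lra.
Qed.

Lemma decreasing_prob_small (A : nat -> set T) (e : R) : 0 < e ->
  (forall n, measurable (A n)) -> (forall n, A n.+1 `<=` A n) ->
  \bigcap_n A n = set0 -> exists n, fine (P (A n)) <= e.
Proof.
move=> e0 mA decA capA; have [n] := decreasing_prob_near e0 mA decA.
by rewrite capA measure0 add0r; exists n.
Qed.

End laws.

Lemma cvg_sumr (R : realType) (I : Type) (r : seq I) (f : I -> nat -> R) (l : I -> R) :
  (forall i, f i n @[n --> \oo] --> l i) ->
  \sum_(i <- r) f i n @[n --> \oo] --> \sum_(i <- r) l i.
Proof.
move=> h; elim: r => [|i r IH].
  by rewrite big_nil; under eq_fun do rewrite big_nil; exact: cvg_cst.
by rewrite big_cons; under eq_fun do rewrite big_cons; exact: cvgD.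
Qed.

Section sequences_of_laws.
Context {R : realType} {d : nat -> measure_display}
  {Omega : forall n, measurableType (d n)}.
Variable P : forall n, probability (Omega n) R.
Context {d' : measure_display} {Omega' : measurableType d'}.
Variable Q : probability Omega' R.

Lemma fine_probC (d0 : measure_display) (T : measurableType d0)
    (P0 : probability T R) (A : set T) : measurable A ->
  fine (P0 (~` A)) = 1 - fine (P0 A).
Proof. by move=> mA; rewrite probability_setC// fineB ?fin_num_measure. Qed.

(* Scheffe: the limits of the point masses add up to 1, so no mass escapes. *)
Lemma mass_cvg_nat (Y : forall n, Omega n -> nat) (Y' : Omega' -> nat)
    (Psi : nat -> R) (B : R) :
  (forall n c, measurable [set w | Y n w = c]) ->
  (forall c, measurable [set w | Y' w = c]) ->
  (forall c, fine (P n [set w | Y n w = c]) @[n --> \oo] -->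
             fine (Q [set w | Y' w = c])) ->
  (forall c, `|Psi c| <= B) ->
  mean (P n) (Psi \o Y n) @[n --> \oo] --> mean Q (Psi \o Y').
Proof.
move=> mY mY' cY hB.
have B0 : 0 <= B by apply: le_trans (hB 0%N).
(* Used under each P n and under Q. The tail probability is 1 minus finitely many point masses, so
   its convergence comes from theirs. *)
have trunc (d0 : measure_display) (T : measurableType d0) (y : T -> nat) M :
    (forall c, measurable [set w | y w = c]) ->
    measurable_fun setT (Psi \o y) /\
    measurable [set w | (M <= y w)%N] /\
    (forall P0 : probability T R,
    fine (P0 [set w | (M <= y w)%N]) = 1 - \sum_(c < M) fine (P0 [set w | y w = c]) /\
    `|mean P0 (Psi \o y) - \sum_(c < M) Psi c * fine (P0 [set w | y w = c])| <=
    2 * B * fine (P0 [set w | (M <= y w)%N])).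
  move=> my.
  have my' (S : set nat) : measurable (y @^-1` S).
    rewrite (_ : y @^-1` S = \bigcup_(c in S) [set w | y w = c]).
      by apply: bigcup_measurable => c _.
    by apply/seteqP; split=> [w Sw|w [c Sc /= e]]; [exists (y w)|rewrite /preimage /= e].
  have mPsi : measurable_fun setT (Psi \o y).
    by move=> _ S mS; rewrite setTI comp_preimage; exact: my'.
  have mM : measurable [set w | (M <= y w)%N] by exact: my' [set c | (M <= c)%N].
  split=> //; split=> // P0; split.
    have -> : [set w | (M <= y w)%N] = ~` [set w | (y w < M)%N].
      by apply/seteqP; split=> w /= => [h|/negP]; [apply/negP|]; rewrite -leqNgt.
    rewrite fine_probC; last exact: my' [set c | (c < M)%N].
    congr (_ - _); rewrite -mean_indic; last exact: my' [set c | (c < M)%N].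
    under [RHS]eq_bigr do rewrite -[fine _]mul1r.
    rewrite -(mean_indic_sum P0 M (fun=> 1) my); congr mean; apply/funext => w.
    rewrite indicE; under eq_bigr do rewrite mul1r indicE.
    have [yM|yM] := ltnP (y w) M.
      rewrite mem_set// (bigD1 (Ordinal yM))//= mem_set// big1 ?addr0// => c cy.
      rewrite memNset// => e; move: cy; rewrite -(inj_eq val_inj) /= e eqxx //.
    rewrite memNset /= ?big1 => [//|c _|]; last by apply/negP; rewrite -leqNgt.
    by rewrite memNset// => e; move: yM; rewrite e leqNgt ltn_ord.
  rewrite -(mean_indic_sum P0 M Psi my).
  rewrite -[leRHS]add0r.
  have indicS w : \sum_(c < M) Psi c * \1_[set w | y w = c] w =
                 if (y w < M)%N then Psi (y w) else 0.
    under eq_bigr do rewrite indicE.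
    have [yM|yM] := ltnP (y w) M.
      rewrite (bigD1 (Ordinal yM))//= mem_set// big1 ?addr0 ?mulr1// => c cy.
      rewrite memNset ?mulr0// => e; move: cy; rewrite -(inj_eq val_inj) /= e eqxx //.
    rewrite big1// => c _.
    by rewrite memNset ?mulr0// => e; move: yM; rewrite e leqNgt ltn_ord.
  apply: mean_close => //.
  - by apply: measurable_sum => c; apply: measurable_funM.
  - by move=> w; exact: hB.
  - by move=> w; rewrite indicS; case: ifP => //; rewrite normr0.
  - move=> w /= /negP; rewrite -ltnNge indicS => ->.
    by rewrite subrr normr0.
apply: cvg_approx => e e0.
(* A tail of probability e' costs at most 2 B e' <= e. Half of e' is for the tail under Q, half for
   the discrepancy of the masses. *)
pose e' := e / (2 * B + 1).
have B1 : 0 < 2 * B + 1 by rewrite ltr_wpDl ?mulr_ge0.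
have e'0 : 0 < e' by rewrite divr_gt0.
have e'2 : 0 < e' / 2 by rewrite divr_gt0.
have eB : 2 * B * e' <= e.
  by rewrite /e' mulrCA ler_piMr ?(ltW e0)// ler_pdivrMr// mul1r lerDl.
have [M hM] : exists M, fine (Q [set w | (M <= Y' w)%N]) <= e' / 2.
  apply: decreasing_prob_small => //.
  - by move=> M; have [_ []] := trunc _ _ _ M mY'.
  - by move=> M w /=; exact: ltnW.
  - by apply/seteqP; split=> // w /(_ (Y' w).+1 I) /=; rewrite ltnn.
have cS (a : nat -> R) : (\sum_(c < M) a c * fine (P n [set w | Y n w = c]))
    @[n --> \oo] --> \sum_(c < M) a c * fine (Q [set w | Y' w = c]).
  by apply: cvg_sumr => c; apply: cvgM; [exact: cvg_cst|exact: cY].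
exists (fun n => \sum_(c < M) Psi c * fine (P n [set w | Y n w = c])).
exists (\sum_(c < M) Psi c * fine (Q [set w | Y' w = c])); split => //.
  have [_ [_ /(_ Q)[_ h]]] := trunc _ _ _ M mY'.
  apply: le_trans h _; apply: le_trans eB; rewrite ler_wpM2l ?mulr_ge0//.
  by apply: le_trans hM _; rewrite ler_pdivrMr// ler_pMr// ler1n.
have /cvgrPdist_le/(_ _ e'2) hn := cS (fun=> 1).
near=> n.
have [_ [_ /(_ (P n))[hP h]]] := trunc _ _ _ M (mY n).
apply: le_trans h _; apply: le_trans eB; rewrite ler_wpM2l ?mulr_ge0//.
have [_ [_ /(_ Q)[hQ _]]] := trunc _ _ _ M mY'.
have : `|\sum_(c < M) 1 * fine (Q [set w | Y' w = c]) -
         \sum_(c < M) 1 * fine (P n [set w | Y n w = c])| <= e' / 2 by near: n.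
under eq_bigr do rewrite mul1r.
under [X in _ - X]eq_bigr do rewrite mul1r.
move: hM; rewrite hP hQ; move: (\sum_(c < M) _) (\sum_(c < M) _) => a b h1.
by rewrite ler_norml => /andP[h2 h3]; lra.
Unshelve. all: by end_near. Qed.

(** Transport along the encoding of a countable type by integers; integers that encode nothing
    correspond to empty events. *)
Lemma mass_cvg (S : countType) (Y : forall n, Omega n -> S) (Y' : Omega' -> S)
    (Psi : S -> R) (B : R) :
  (forall n c, measurable [set w | Y n w = c]) ->
  (forall c, measurable [set w | Y' w = c]) ->
  (forall c, fine (P n [set w | Y n w = c]) @[n --> \oo] -->
             fine (Q [set w | Y' w = c])) ->
  (forall c, `|Psi c| <= B) ->
  mean (P n) (Psi \o Y n) @[n --> \oo] --> mean Q (Psi \o Y').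
Proof.
move=> mY mY' cY hB.
have [[w0]|T0] := pselect (exists w : Omega' , True); last first.
  have := @probability_setT _ _ _ Q; rewrite (_ : setT = set0) ?measure0.
    by move=> [] /eqP; rewrite eq_sym oner_eq0.
  by apply/seteqP; split=> // w _; apply: T0; exists w.
move=> _; have B0 : 0 <= B by apply: le_trans (hB (Y' w0)).
have pE (T : Type) (y : T -> S) (c : nat) : [set w | pickle (y w) = c] =
    if (pickle_inv c : option S) is Some t then [set w | y w = t] else set0.
  apply/seteqP; split => w /=.
    by move=> <-; rewrite pickleK_inv.
  case E : ((pickle_inv c : option S)) => [t|//] /= ->.
  by have := @pickle_invK S c; rewrite E.
pose Psi' (c : nat) := if (pickle_inv c : option S) is Some t then Psi t else 0.
have PsiE t : Psi' (pickle t) = Psi t by rewrite /Psi' pickleK_inv.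
have -> : Psi \o Y' = Psi' \o (pickle \o Y') by apply/funext => w; rewrite /= PsiE.
have -> : (fun n => mean (P n) (Psi \o Y n)) =
          (fun n => mean (P n) (Psi' \o (pickle \o Y n))).
  by apply/funext => n; congr mean; apply/funext => w; rewrite /= PsiE.
apply: (@mass_cvg_nat (fun n => pickle \o Y n) _ _ B).
- by move=> n c; rewrite pE; case: ((pickle_inv c : option S)).
- by move=> c; rewrite pE; case: ((pickle_inv c : option S)).
- move=> c; rewrite pE; under eq_fun do rewrite pE.
  case: ((pickle_inv c : option S)) => [t|]; first exact: cY.
  by rewrite measure0; under eq_fun do rewrite measure0; exact: cvg_cst.
- by move=> c; rewrite /Psi'; case: ((pickle_inv c : option S)) => [t|]; rewrite ?normr0.
Qed.

End sequences_of_laws.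

Lemma mean_le (R : realType) (d : measure_display) (T : measurableType d)
    (P : probability T R) (f g : T -> R) (M : R) :
  measurable_fun setT f -> measurable_fun setT g ->
  (forall w, `|f w| <= M) -> (forall w, `|g w| <= M) ->
  (forall w, f w <= g w) -> mean P f <= mean P g.
Proof.
move=> mf mg fM gM fg; apply: le_Rintegral => //.
- exact: bounded_integrable mf fM.
- exact: bounded_integrable mg gM.
Qed.

Lemma measurable_ge (R : realType) (d : measure_display) (T : measurableType d)
    (f : T -> R) (t : R) : measurable_fun setT f -> measurable [set w | t <= f w].
Proof.
move=> mf; have := mf measurableT [set` `[t, +oo[] (measurable_itv _).
rewrite setTI; congr measurable; apply/seteqP; split=> w /=; by rewrite in_itv /= andbT.
Qed.

Lemma measurable_gt (R : realType) (d : measure_display) (T : measurableType d)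
    (f : T -> R) (t : R) : measurable_fun setT f -> measurable [set w | t < f w].
Proof.
move=> mf; have := mf measurableT [set` `]t, +oo[] (measurable_itv _).
rewrite setTI; congr measurable; apply/seteqP; split=> w /=; by rewrite in_itv /= andbT.
Qed.

(** Truncation to [0, 1], used to build continuous substitutes for indicators of half-lines. *)
Definition clamp (R : realDomainType) (x : R) : R := Num.min 1 (Num.max 0 x).

Lemma clamp_ge0 (R : realDomainType) (x : R) : 0 <= clamp x.
Proof. by rewrite /clamp le_min ler01 le_max lexx. Qed.

Lemma clamp_le1 (R : realDomainType) (x : R) : clamp x <= 1.
Proof. by rewrite /clamp ge_min lexx. Qed.

Lemma clamp1 (R : realDomainType) (x : R) : 1 <= x -> clamp x = 1.
Proof. by move=> x1; rewrite /clamp; apply/min_idPl; rewrite le_max x1 orbT. Qed.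

Lemma clamp0 (R : realDomainType) (x : R) : x <= 0 -> clamp x = 0.
Proof. by move=> x0; rewrite /clamp (max_idPl x0); apply/min_idPr. Qed.

Lemma continuous_clamp (R : realType) : continuous (@clamp R).
Proof.
move=> x; apply: continuous_min; first exact: cvg_cst.
by apply: continuous_max; [exact: cvg_cst|exact: cvg_id].
Qed.

Section sequences_of_laws.
Context {R : realType} {d : nat -> measure_display}
  {Omega : forall n, measurableType (d n)}.
Variable P : forall n, probability (Omega n) R.
Context {d' : measure_display} {Omega' : measurableType d'}.
Variable Q : probability Omega' R.

(** The analytic core of convergence in law of vectors; [cvg_vec_in_law] adds the measurability
    clauses of [cvg_in_law]. *)
Definition cvg_vec k (Z : forall n, Omega n -> 'rV[R]_k) (Z' : Omega' -> 'rV[R]_k) :=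
  forall F : 'rV[R]_k -> R, continuous F -> (exists M, forall x, `|F x| <= M) ->
  mean (P n) (F \o Z n) @[n --> \oo] --> mean Q (F \o Z').

(** One half of the portmanteau theorem: f (Z n) dominates the indicator of A n, while f (Z') is
    dominated by that of A'. *)
Lemma cvg_vec_event k (Z : forall n, Omega n -> 'rV[R]_k) (Z' : Omega' -> 'rV[R]_k)
    (f : 'rV[R]_k -> R) (A : forall n, set (Omega n)) (A' : set Omega') e :
  cvg_vec Z Z' ->
  (forall n i, measurable_fun setT (fun w => Z n w 0 i)) ->
  (forall i, measurable_fun setT (fun w => Z' w 0 i)) ->
  continuous f -> (forall x, 0 <= f x <= 1) ->
  (forall n, measurable (A n)) -> measurable A' ->
  (forall n w, A n w -> f (Z n w) = 1) -> (forall w, ~ A' w -> f (Z' w) = 0) ->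
  0 < e -> \forall n \near \oo, fine (P n (A n)) <= fine (Q A') + e.
Proof.
move=> ZZ mZ mZ' cf f01 mA mA' fA fA' e0.
have f1 x : `|f x| <= 1 by have /andP[h h'] := f01 x; rewrite ger0_norm.
have ind1 (d0 : measure_display) (T : measurableType d0) (B : set T) w :
    `|\1_B w : R| <= 1.
  by rewrite indicE; case: (_ \in _); rewrite ?normr1 ?normr0.
have mf n : measurable_fun setT (f \o Z n) by exact: measurable_fun_row.
have mf' : measurable_fun setT (f \o Z') by exact: measurable_fun_row.
have hQ : mean Q (f \o Z') <= fine (Q A').
  rewrite -mean_indic//; apply: (@mean_le _ _ _ _ _ _ 1) => //.
  - by move=> w; exact: f1.
  - by move=> w; exact: ind1.
  move=> w; rewrite indicE /=; have [wA|wA] := boolP (w \in A').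
    by case/andP: (f01 (Z' w)).
  by rewrite fA'// => h; move/negP: wA; apply; exact/mem_set.
have hP n : fine (P n (A n)) <= mean (P n) (f \o Z n).
  rewrite -mean_indic//; apply: (@mean_le _ _ _ _ _ _ 1) => //.
  - by move=> w; exact: ind1.
  - by move=> w; exact: f1.
  move=> w; rewrite indicE /=; have [/set_mem wA|wA] := boolP (w \in A n).
    by rewrite fA.
  by case/andP: (f01 (Z n w)).
have /cvgrPdist_le/(_ _ e0) h := ZZ f cf (ex_intro _ 1 f1).
near=> n; have : `|mean Q (f \o Z') - mean (P n) (f \o Z n)| <= e by near: n.
by rewrite ler_norml => /andP[h1 h2]; have := hP n; lra.
Unshelve. all: by end_near. Qed.

(** F is merely continuous, so closeness of X and Z is turned into closeness of F X and F Z on a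
    ball. Tightness of Z' gives the ball, [cvg_vec_event] transfers it to Z n, and only Z n has to
    lie in it. *)
Lemma slutsky k (X Z : forall n, Omega n -> 'rV[R]_k) (Z' : Omega' -> 'rV[R]_k) :
  (forall n i, measurable_fun setT (fun w => X n w 0 i)) ->
  (forall n i, measurable_fun setT (fun w => Z n w 0 i)) ->
  (forall i, measurable_fun setT (fun w => Z' w 0 i)) ->
  cvg_vec Z Z' ->
  (forall e p, 0 < e -> 0 < p -> exists2 B : forall n, set (Omega n),
     forall n, measurable (B n) & \forall n \near \oo, fine (P n (B n)) <= p /\
     forall w, ~ B n w -> forall i, `|X n w 0 i - Z n w 0 i| <= e) ->
  cvg_vec X Z'.
Proof.
move=> mX mZ mZ' ZZ XZ F cF [M FM]; apply: cvg_approx => e e0.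
have M0 : 0 <= M by apply: le_trans (FM 0).
exists (fun n => mean (P n) (F \o Z n)), (mean Q (F \o Z')).
split; [|by rewrite subrr normr0 ltW|]; first by apply: ZZ => //; exists M.
(* The bad event will have probability at most 3 p: p for B n, p for the tail of Z', p for its
   transfer to Z n. Then 2 M (3 p) <= e / 2; the added 12 keeps the denominator positive when M =
   0. *)
pose p := e / (12 * M + 12).
have M8 : 0 < 12 * M + 12 by rewrite ltr_wpDl// mulr_ge0.
have p0 : 0 < p by rewrite divr_gt0.
have cn : continuous (fun v : 'rV[R]_k => `|v|) by move=> v; exact: norm_continuous.
have mn n : measurable_fun setT (fun w => `|Z n w|) by exact: measurable_fun_row.
have mn' : measurable_fun setT (fun w => `|Z' w|) by exact: measurable_fun_row.
have [T0 hT0] : exists T0 : nat, fine (Q [set w | T0%:R < `|Z' w|]) <= p.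
  apply: decreasing_prob_small => //.
  - by move=> n; exact: measurable_gt.
  - by move=> n w /=; apply: le_lt_trans; rewrite ler_nat.
  - apply/seteqP; split=> // w h; have := h (Num.bound `|Z' w|) I => /=.
    by rewrite ltNge ltW// archi_boundP.
pose f (v : 'rV[R]_k) := clamp (`|v| - T0%:R).
have cf : continuous f.
  move=> v; apply: (@continuous_comp _ _ _ (fun v : 'rV[R]_k => `|v| - T0%:R) (@clamp R)); last exact: continuous_clamp.
  by apply: continuousB; [exact: cn|exact: cst_continuous].
have ev := @cvg_vec_event k Z Z' f (fun n => [set w | T0%:R + 1 <= `|Z n w|])
   [set w | T0%:R < `|Z' w|] p ZZ mZ mZ' cf _ _ _ _ _ p0.
have {}ev : \forall n \near \oo,
   fine (P n [set w | T0%:R + 1 <= `|Z n w|]) <= fine (Q [set w | T0%:R < `|Z' w|]) + p.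
  apply: ev.
  - by move=> x; rewrite clamp_ge0 clamp_le1.
  - by move=> n; exact: measurable_ge.
  - exact: measurable_gt.
  - by move=> n w /= h; rewrite /f clamp1// lerBrDl.
  - by move=> w /= /negP; rewrite -leNgt => h; rewrite /f clamp0// subr_le0.
have cK : compact [set v : 'rV[R]_k | `|v| <= T0%:R + 1].
  apply: bounded_closed_compact.
    exists (T0%:R + 1); split; first exact: num_real.
    by move=> y hy v /= hv; apply: le_trans hv (ltW hy).
  have -> : [set v : 'rV[R]_k | `|v| <= T0%:R + 1] =
     (fun v : 'rV[R]_k => `|v|) @^-1` [set y | y <= T0%:R + 1] by [].
  by apply: preimage_closed => //; exact: closed_le.
have e2 : 0 < e / 2 by rewrite divr_gt0.
have [del del0 hdel] := compact_uniform cK cF e2.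
have del2 : 0 < del / 2 by rewrite divr_gt0.
have [B mB hB] := XZ _ p del2 p0.
near=> n.
have [hB1 hB2] : fine (P n (B n)) <= p /\
     forall w, ~ B n w -> forall i, `|X n w 0 i - Z n w 0 i| <= del / 2 by near: n.
have hev : fine (P n [set w | T0%:R + 1 <= `|Z n w|]) <=
   fine (Q [set w | T0%:R < `|Z' w|]) + p by near: n.
have mBn : measurable (B n `|` [set w | T0%:R + 1 <= `|Z n w|]).
  by apply: measurableU => //; exact: measurable_ge.
apply: le_trans (mean_close (M := M) (e := e / 2) (P n) _ _ _ _ mBn _ _) _.
- exact: measurable_fun_row.
- exact: measurable_fun_row.
- by move=> w; exact: FM.
- by move=> w; exact: FM.
- exact: ltW.
- move=> w nBw; apply: ltW; rewrite distrC; apply: hdel => /=.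
    by rewrite leNgt; apply/negP => h; apply: nBw; right; exact: ltW.
  move=> i; rewrite distrC; apply: le_lt_trans (hB2 w _ i) _.
    by move=> h; apply: nBw; left.
  by rewrite gtr_pMr// invf_lt1// ltr1n.
have PU : fine (P n (B n `|` [set w | T0%:R + 1 <= `|Z n w|])) <= 3 * p.
  have mge : measurable [set w | T0%:R + 1 <= `|Z n w|] by exact: measurable_ge.
  have : fine (P n (B n `|` [set w | T0%:R + 1 <= `|Z n w|])) <=
     fine (P n (B n)) + fine (P n [set w | T0%:R + 1 <= `|Z n w|]).
    rewrite -fineD ?fin_num_measure// fine_le ?fin_numD ?fin_num_measure//.
    exact: measureU2.
  by move: hT0 hB1 hev; move: (fine _) (fine _) (fine _) (fine _) => *; lra.
apply: (@le_trans _ _ (e / 2 + 2 * M * (3 * p))).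
  by rewrite lerD2l ler_wpM2l ?mulr_ge0.
suff : 2 * M * (3 * p) <= e / 2 by lra.
rewrite /p -subr_ge0.
have -> : e / 2 - 2 * M * (3 * (e / (12 * M + 12))) = e * 6 / (12 * M + 12).
  by field; rewrite gt_eqF.
by rewrite divr_ge0 ?mulr_ge0// ltW.
Unshelve. all: by end_near. Qed.

End sequences_of_laws.

(** * Poisson limit of multinomial counts *)

Lemma cvg_const_over_nat (R : realType) (c : R) : c / n%:R @[n --> \oo] --> 0.
Proof.
rewrite -(mulr0 c); apply: cvgM; first exact: cvg_cst.
apply/gtr0_cvgV0; last exact: cvgr_idn.
by exists 1%N => // n /= n0; rewrite ltr0n.
Qed.

Lemma near_gt_nat (R : realType) (c : R) : \forall n \near \oo, c < n%:R.
Proof.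
exists (Num.bound `|c|) => // n /= hn.
apply: le_lt_trans (ler_norm c) _; apply: lt_le_trans (archi_boundP _) _ => //.
by rewrite ler_nat.
Qed.

(** Lower half of the squeeze for (1 - c / n) ^ n. With y = c / n, the inverse of 1 - y is 1 + y /
    (1 - y), at most exp (y / (1 - y)). *)
Lemma expR_le_pow (R : realType) (c : R) (n : nat) : 0 <= c -> c < n%:R ->
  expR (- (c / (1 - c / n%:R))) <= (1 - c / n%:R) ^+ n.
Proof.
move=> c0 cn; have n0 : 0 < n%:R :> R by apply: le_lt_trans cn.
have y1 : c / n%:R < 1 by rewrite ltr_pdivrMr// mul1r.
have z0 : 0 < 1 - c / n%:R by rewrite subr_gt0.
have -> : - (c / (1 - c / n%:R)) = n%:R * - ((c / n%:R) / (1 - c / n%:R)).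
  field; rewrite (gt_eqF n0)/= ?andbT; apply/eqP => h.
  by move: cn; rewrite (_ : c = n%:R) ?ltxx//; lra.
rewrite mulrC expRM_natr; apply: lerXn2r; [exact: expR_ge0|exact: ltW|].
rewrite expRN -[leRHS]invrK lef_pV2 ?posrE ?expR_gt0 ?invr_gt0//.
apply: le_trans (expR_ge1Dx _); rewrite le_eqVlt; apply/orP; left; apply/eqP.
field; rewrite (gt_eqF n0)/= ?andbT; apply/eqP => h.
by move: cn; rewrite (_ : c = n%:R) ?ltxx//; lra.
Qed.

Lemma cvg_pow_expR (R : realType) (c : R) : 0 <= c ->
  (1 - c / n%:R) ^+ n @[n --> \oo] --> expR (- c).
Proof.
move=> c0; apply: (@squeeze_cvgr _ _ _ R (fun n => expR (- (c / (1 - c / n%:R))))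
  (fun=> expR (- c))); [|apply: continuous_cvg|exact: cvg_cst].
- near=> n; have cn : c < n%:R by near: n; exact: near_gt_nat.
  have n0 : 0 < n%:R :> R by apply: le_lt_trans cn.
  rewrite expR_le_pow//=.
  have -> : - c = n%:R * - (c / n%:R) by field; rewrite gt_eqF.
  rewrite (mulrC n%:R) expRM_natr; apply: lerXn2r; [|exact: expR_ge0|].
    by rewrite nnegrE subr_ge0 ler_pdivrMr// mul1r ltW.
  exact: expR_ge1Dx.
- exact: continuous_expR.
- apply: cvgN; rewrite -[X in _ --> X]divr1; apply: cvgM; first exact: cvg_cst.
  apply: cvgV; first exact: oner_neq0.
  rewrite -[X in _ --> X]subr0; apply: cvgB; first exact: cvg_cst.
  exact: cvg_const_over_nat.
Unshelve. all: by end_near. Qed.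

Lemma cvg_ffact (R : realType) s :
  (n ^_ s)%:R / n%:R ^+ s @[n --> \oo] --> (1 : R).
Proof.
elim: s => [|s IH].
  by under eq_fun do rewrite ffactn0 expr0 divr1; exact: cvg_cst.
have h : (n - s)%:R / n%:R @[n --> \oo] --> (1 : R).
  have h0 : (1 - s%:R / n%:R : R) @[n --> \oo] --> (1 : R).
    rewrite -[X in _ --> X]subr0; apply: cvgB; first exact: cvg_cst.
    exact: cvg_const_over_nat.
  apply: cvg_trans h0; apply: near_eq_cvg; near=> n.
  have sn : s%:R < n%:R :> R by near: n; exact: near_gt_nat.
  have n0 : n%:R != 0 :> R by rewrite gt_eqF// (le_lt_trans _ sn).
  by rewrite natrB 1?ltnW -?(ltr_nat R)// mulrBl divff.
rewrite -[X in _ --> X]mul1r.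
under eq_fun do rewrite ffactnSr natrM exprSr invfM mulrACA.
exact: cvgM.
Unshelve. all: by end_near. Qed.

(** The prescribed total s stays fixed, so the falling factorial is equivalent to N ^ s and the
    exponent N - s may be replaced by N. The limit exp (- c) factors over the cells because c is the
    sum of the nu b. *)
Lemma multinomial_mass_cvg (R : realType) m (nu : 'I_m -> R)
    (n : {ffun 'I_m -> nat}) : (forall b, 0 <= nu b) ->
  multinomial_mass (fun b => nu b / N%:R) (1 - (\sum_b nu b) / N%:R) N n
    @[N --> \oo] --> \prod_b poisson_mass (nu b) (n b).
Proof.
move=> nu0; set c := \sum_b nu b; set s := (\sum_b n b)%N.
have c0 : 0 <= c by apply: sumr_ge0.
pose K := \prod_b (nu b ^+ n b / (n b)`!%:R).
have -> : \prod_b poisson_mass (nu b) (n b) = 1 * K * (expR (- c) / 1 ^+ s).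
  rewrite expr1n divr1 mul1r mulrC /c -sumrN expR_sum -big_split /=.
  by apply: eq_bigr => b _; rewrite /poisson_mass mulrA.
have h0 : (N ^_ s)%:R / N%:R ^+ s * K *
    ((1 - c / N%:R) ^+ N / (1 - c / N%:R) ^+ s) @[N --> \oo] -->
    1 * K * (expR (- c) / 1 ^+ s).
  apply: cvgM; first by apply: cvgM; [exact: cvg_ffact|exact: cvg_cst].
  apply: cvgM; first exact: cvg_pow_expR.
  apply: cvgV; first by rewrite expr1n oner_neq0.
  have h1 : 1 - c / N%:R @[N --> \oo] --> (1 : R).
    rewrite -[X in _ --> X]subr0; apply: cvgB; first exact: cvg_cst.
    exact: cvg_const_over_nat.
  exact: (cvg_comp _ _ h1 (@exprn_continuous R s 1)).
apply: cvg_trans h0; apply: near_eq_cvg; near=> N.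
have sN : s%:R < N%:R :> R by near: N; exact: near_gt_nat.
have cN : c < N%:R :> R by near: N; exact: near_gt_nat.
have N0 : 0 < N%:R :> R by rewrite (le_lt_trans _ sN).
have q0 : 1 - c / N%:R != 0 by rewrite gt_eqF// subr_gt0 ltr_pdivrMr// mul1r.
have sN' : (s <= N)%N by rewrite ltnW// -(ltr_nat R).
rewrite /multinomial_mass -/s -/c.
have -> : (1 - c / N%:R) ^+ N = (1 - c / N%:R) ^+ (N - s) * (1 - c / N%:R) ^+ s.
  by rewrite -exprD subnK.
rewrite mulfK ?expf_neq0//; congr (_ * _).
rewrite -!mulrA; congr (_ * _).
rewrite /K -exprVn -prodrXr -big_split /=; apply: eq_bigr => b _.
by rewrite exprMn; ring.
Unshelve. all: by end_near. Qed.

(** * Discretisation on a grid *)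

(** Index 0 collects everything up to h, negative values included, where the limiting intensity has
    infinite mass. Index m is the unbounded cell above h m. *)
Definition grid_index (R : realDomainType) (h : R) (m : nat) (x : R) : nat :=
  \sum_(b < m) (h * b.+1%:R < x)%R.

Section grid.
Variables (R : realDomainType) (h : R) (m : nat).
Hypothesis h0 : 0 < h.

Lemma grid_index_le x : (grid_index h m x <= m)%N.
Proof.
apply: (@leq_trans (\sum_(b < m) 1)); first by apply: leq_sum => b _; exact: leq_b1.
by rewrite sum_nat_const card_ord muln1.
Qed.

Lemma grid_index_gt b x : (b < m)%N ->
  (b < grid_index h m x)%N = (h * b.+1%:R < x)%R.
Proof.
move=> bm; apply/idP/idP => hb.
  rewrite ltNge; apply: contraL hb => hb; rewrite -leqNgt.
  apply: (@leq_trans (\sum_(c < m) (c < b))%N).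
    apply: leq_sum => c _; have [_|bc] := ltnP c b; first exact: leq_b1.
    rewrite leqn0 eqb0 -leNgt (le_trans hb)// ler_pM2l// ler_nat ltnS.
    exact: bc.
  rewrite -(big_mkord xpredT (fun c => (c < b) : nat)) (big_cat_nat (n := b))//=; last exact: ltnW.
  rewrite [X in (_ + X)%N]big_nat_cond [X in (_ + X)%N]big1 ?addn0.
    rewrite (eq_big_nat _ _ (F2 := fun=> 1%N)) ?sum_nat_const_nat ?subn0 ?muln1//.
    by move=> c /andP[_ ->].
  by move=> c /andP[/andP[bc _] _]; rewrite ltnNge bc.
apply: (@leq_trans (\sum_(c < m) (c < b.+1))%N); last first.
  apply: leq_sum => c _; have [cb|//] := ltnP c b.+1.
  by rewrite (le_lt_trans _ hb)// ler_pM2l// ler_nat.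
rewrite -(big_mkord xpredT (fun c => (c < b.+1) : nat)) (big_cat_nat (n := b.+1))//=.
rewrite (eq_big_nat _ _ (F2 := fun=> 1%N)) ?sum_nat_const_nat ?subn0 ?muln1 ?leq_addr//.
by move=> c /andP[_ ->].
Qed.

Lemma grid_index0 x : x <= h -> grid_index h m x = 0%N.
Proof.
move=> xh; rewrite /grid_index big1// => b _; apply/eqP; rewrite eqb0 -leNgt.
by rewrite (le_trans xh)// ler_peMr ?ler1n// ltW.
Qed.

Lemma grid_index_approx x : x <= h * m%:R ->
  `|h * (grid_index h m x)%:R - Num.max x 0| <= h.
Proof.
move=> xm; set n := grid_index h m x.
have nm : (n <= m)%N by exact: grid_index_le.
have up : x <= h * n.+1%:R.
  have [nm'|mn] := ltnP n m.
    by rewrite leNgt -grid_index_gt// ltnn.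
  rewrite (le_trans xm)// ler_pM2l// ler_nat; exact: leq_trans mn _.
have [n0|n0] := posnP n.
  rewrite n0 mulr0 sub0r normrN ger0_norm ?le_max ?lexx ?orbT// ge_max.
  by move: up; rewrite n0 mulr1 => ->; exact: ltW.
have lo : h * n%:R < x.
  by have := @grid_index_gt n.-1 x; rewrite prednK// leqnn => <-//; rewrite prednK.
have hn : 0 <= h * n%:R by rewrite mulr_ge0// ltW.
rewrite (max_idPl _); last exact: ltW (le_lt_trans hn lo).
move: up; rewrite -natr1 mulrDr mulr1 ler_norml => up; apply/andP; split; lra.
Qed.

(* Recovers the grid indices of a decreasing list from its counts y b in the
   cells of index b + 1. *)
Definition rank_index (y : {ffun 'I_m -> nat}) (j : nat) : nat :=
  \sum_(b < m) (j < \sum_(c < m | (b <= c)%N) y c)%N.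

Definition cell_counts (s : seq R) : {ffun 'I_m -> nat} :=
  [ffun b : 'I_m => count (fun x => grid_index h m x == b.+1) s].

(** The counts of the cells from b on add up to the number of entries above h (b + 1), and this
    number exceeds j exactly when the entry of rank j is above that level. *)
Lemma rank_index_cell_counts s j : sorted >=%R s ->
  rank_index (cell_counts s) j = grid_index h m s`_j.
Proof.
move=> ss; apply: eq_bigr => b _; congr nat_of_bool.
have -> : (\sum_(c < m | (b <= c)%N) cell_counts s c)%N = count (> (h * b.+1%:R)) s.
  elim: s {ss} => [|x s IH] /=.
    by rewrite big1// => c _; rewrite ffunE.
  rewrite -IH.
  under eq_bigr do rewrite ffunE /=.
  rewrite big_split /=; congr (_ + _)%N; last by apply: eq_bigr => c _; rewrite ffunE.
  transitivity (nat_of_bool (b < grid_index h m x)%N); last by rewrite grid_index_gt.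
  have [lt|ge] := ltnP b (grid_index h m x).
    have gm : ((grid_index h m x).-1 < m)%N by have := grid_index_le x; lia.
    rewrite (bigD1 (Ordinal gm)) /=; last by lia.
    rewrite prednK ?eqxx ?big1//; [|by lia].
    move=> c /andP[_]; rewrite -(inj_eq val_inj) /= => cn; apply/eqP; rewrite eqb0.
    by apply: contra cn => /eqP ->.
  by rewrite big1// => c bc; apply/eqP; rewrite eqb0; lia.
(* Past the end of s, [nth] returns 0, which lies above no grid point, in agreement with the
   count. *)
rewrite sorted_count_gt//; have [//|js] := ltnP j (size s).
rewrite nth_default//=; apply/esym/negbTE; rewrite -leNgt mulr_ge0// ltW//.
Qed.

End grid.

Lemma fine_prob_bigcup (R : realType) (d : measure_display) (T : measurableType d)
    (P : probability T R) (I : finType) (C : pred I) (E : I -> set T) :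
  (forall i, measurable (E i)) -> trivIset setT E ->
  fine (P (\bigcup_(i in [set` C]) E i)) = \sum_(i | C i) fine (P (E i)).
Proof.
move=> mE tE; rewrite measure_fin_bigcup//; last first.
  by move=> i j _ _; apply: tE.
rewrite -(bigfs _ (r := index_enum I)) ?index_enum_uniq//; last first.
  by move=> i; rewrite mem_index_enum.
have -> : (\sum_(i <- index_enum I | C i) P (E i) =
          (\sum_(i <- index_enum I | C i) fine (P (E i)))%:E)%E.
  rewrite -sumEFin; apply: eq_bigr => i _.
  by rewrite fineK// fin_num_measure.
by [].
Qed.

(** The event is the disjoint union, over the assignments of draws to cells with the prescribed
    counts, of product events; independence evaluates each of them. *)
Lemma prob_bin_count (R : realType) (d : measure_display) (T : measurableType d)
    (P : probability T R) N m (X : 'I_N -> T -> R) (bin : R -> option 'I_m)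
    (w : option 'I_m -> R) (n : {ffun 'I_m -> nat}) :
  (forall i, measurable_fun setT (X i)) ->
  mutually_independent P X ->
  (forall o, measurable (bin @^-1` [set o])) ->
  (forall i o, fine (P (X i @^-1` (bin @^-1` [set o]))) = w o) ->
  let A := [set x | forall b, bin_count [ffun i => bin (X i x)] b = n b] in
  measurable A /\ fine (P A) = multinomial_sum w N n.
Proof.
move=> mX iX mbin hw A.
pose E (f : {ffun 'I_N -> option 'I_m}) := \bigcap_i (X i @^-1` (bin @^-1` [set f i])).
have mXi i o : measurable (X i @^-1` (bin @^-1` [set o])).
  by rewrite -[X in measurable X]setTI; apply: mX.
have mE f : measurable (E f) by apply: fin_bigcap_measurable.
have EE f x : E f x <-> [ffun i => bin (X i x)] = f.
  split=> [h|<- i _ /=]; last by rewrite ffunE.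
  by apply/ffunP => i; rewrite ffunE; apply: h.
have tE : trivIset setT E.
  by move=> f g _ _ [x [/EE <- /EE <-]].
have AE : A = \bigcup_(f in [set` [pred f | [forall b, bin_count f b == n b]]]) E f.
  apply/seteqP; split=> x.
    move=> h; exists [ffun i => bin (X i x)]; last exact/EE.
    by apply/forallP => b; apply/eqP; exact: h.
  move=> [f /= /forallP fn /EE xf] b; rewrite /= xf; exact/eqP.
split.
  by rewrite AE; apply: fin_bigcup_measurable => //; exact: finite_finset.
rewrite AE fine_prob_bigcup//; apply: eq_bigr => f _.
rewrite /E iX//.
have -> : (\prod_i P (X i @^-1` (bin @^-1` [set f i])) = (\prod_i w (f i))%:E)%E.
  rewrite (big_morph EFin (@EFinM R) (erefl _)); apply: eq_bigr => i _.
  by rewrite -(hw i) fineK// fin_num_measure.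
by [].
Qed.

Lemma point_measure_count (R : realType) (u : nat -> R) (B : set R) (p : pred R) K :
  (forall x, B x <-> p x) -> (forall j, (K <= j)%N -> ~~ p (u j)) ->
  point_measure u B = (count p (mkseq u K))%:R%:E.
Proof.
move=> Bp uK; transitivity (\sum_(0 <= j <oo) (\d_(u j) B : \bar R))%E; first by [].
rewrite (nneseries_split 0%N K)//.
rewrite [X in (_ + X)%E]eseries0 => [|i Ki _]; last first.
  rewrite /dirac /= indicE memNset// => /Bp; apply/negP; exact: uK.
rewrite adde0 add0n; elim: K {uK} => [|K IH]; first by rewrite big_nil.
rewrite big_nat_recr// IH mkseqS -cats1 count_cat natrD EFinD; congr (_ + _)%E.
rewrite diracE /= addn0; have [h|h] := boolP (p (u K)).
  by rewrite mem_set//; exact/Bp.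
by rewrite memNset// => /Bp; exact/negP.
Qed.

(** * The power-law intensity and its masses on the cells of the grid *)

Section pareto_intensity.
Variables (R : realType) (beta C : R).
Hypotheses (beta0 : 0 < beta) (C0 : 0 < C).

(** The common form of both intensities: that of (a) is the case beta = 1 / alpha. *)
Definition pareto_density (x : R) : R := C * beta / x `^ (beta + 1).

Lemma pareto_densityE x : pareto_density x = C * beta * x `^ (- beta - 1).
Proof. by rewrite /pareto_density -powRN opprD. Qed.

Lemma pareto_density_ge0 x : 0 <= pareto_density x.
Proof. by rewrite /pareto_density divr_ge0 ?powR_ge0// mulr_ge0// ltW. Qed.

Lemma measurable_pareto_density D : measurable_fun D pareto_density.
Proof.
apply: (@measurable_funS _ _ _ _ setT) => //.
rewrite (_ : pareto_density = fun x => C * beta * x `^ (- beta - 1)); last first.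
  by apply/funext => x; exact: pareto_densityE.
by apply: measurable_funM => //; exact: measurable_powR.
Qed.

Lemma powR_cvgy0 : x `^ (- beta) @[x --> +oo] --> (0 : R).
Proof.
apply/cvgrPdist_lt => e e0; near=> x.
have x0 : 0 < x by near: x; exact: nbhs_pinfty_gt.
have xe : e^-1 `^ beta^-1 < x by near: x; apply: nbhs_pinfty_gt; exact: num_real.
rewrite sub0r normrN ger0_norm ?powR_ge0// powRN.
rewrite -[ltRHS]invrK ltf_pV2 ?posrE ?invr_gt0 ?powR_gt0//.
have -> : e^-1 = (e^-1 `^ beta^-1) `^ beta.
  by rewrite -powRrM mulVf ?gt_eqF// powRr1// invr_ge0 ltW.
by apply: gt0_ltr_powR => //; rewrite ?nnegrE ?powR_ge0 ?ltW.
Unshelve. all: by end_near. Qed.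

(** A primitive of the density is - C x ^ (- beta), which vanishes at infinity. The value is N times
    the tail probability computed in [near_sample_tail]. *)
Lemma intensity_tail s : 0 < s ->
  intensity pareto_density [set x | s < x] = (C * s `^ (- beta))%:E.
Proof.
move=> s0; rewrite /intensity.
have -> : `]0%R, +oo[ `&` [set x | s < x] = `]s, +oo[%classic :> set R.
  apply/seteqP; split=> x /=; rewrite !in_itv /= !andbT; first by case.
  by move=> sx; split=> //; exact: lt_trans sx.
rewrite integral_itv_obnd_cbnd; last first.
  by apply/measurable_EFinP; exact: measurable_pareto_density.
have dp (a x : R) : 0 < x -> derivable (fun y => y `^ a) x 1.
  by move=> x0; case: (is_derive1_powR a x0).
have cp (a x : R) : 0 < x -> {for x, continuous (fun y => y `^ a)}.
  by move=> x0; apply/differentiable_continuous/derivable1_diffP; exact: dp.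
have dF (x : R) : 0 < x -> is_derive x 1 (fun x => - (C * x `^ (- beta))) (pareto_density x).
  move=> x0; have h := is_derive1_powR (- beta) x0.
  have hZ := is_deriveZ C h.
  have hN := is_deriveN hZ.
  rewrite (_ : (fun x => - (C * x `^ (- beta))) = - (C \*: (@powR R ^~ (- beta)))); last first.
    by apply/funext.
  apply: is_derive_eq.
  rewrite pareto_densityE /GRing.scale /=; ring.
have cF (x : R) : 0 < x -> {for x, continuous (fun x => - (C * x `^ (- beta)))}.
  by move=> x0; apply/differentiable_continuous/derivable1_diffP; case: (dF x x0).
rewrite (@ge0_continuous_FTC2y _ _ (fun x => - (C * x `^ (- beta))) _ 0).
- by rewrite EFinN oppeK add0e.
- by move=> x _; exact: pareto_density_ge0.
- apply: continuous_in_subspaceT => x; rewrite inE /= in_itv /= andbT => sx.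
  have -> : pareto_density = fun x => C * beta * x `^ (- beta - 1).
    by apply/funext => y; exact: pareto_densityE.
  by apply: cvgM; [exact: cvg_cst|apply: cp; exact: lt_le_trans sx].
- rewrite -oppr0 -(mulr0 C); apply: cvgN; apply: cvgM; first exact: cvg_cst.
  exact: powR_cvgy0.
- by move=> x sx; case: (dF x (lt_trans s0 sx)).
- by apply: cvg_at_right_filter; exact: cF.
- move=> x; rewrite in_itv /= andbT => sx; rewrite derive1E.
  by case: (dF x (lt_trans s0 sx)) => _ ->.
Qed.

End pareto_intensity.

Section cells.
Variables (R : realType) (beta C h : R) (m : nat).
Hypotheses (beta0 : 0 < beta) (C0 : 0 < C) (h0 : 0 < h).

(** Set to 0 from b = m on, so that the difference defining [cell_mass] gives the unbounded top cell
    its whole tail. *)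
Definition tail_mass (b : nat) : R :=
  if (b < m)%N then C * (h * b.+1%:R) `^ (- beta) else 0.

Definition cell_mass (b : nat) : R := tail_mass b - tail_mass b.+1.

Lemma cell_mass_ge0 b : 0 <= cell_mass b.
Proof.
rewrite subr_ge0 /tail_mass; case: ifPn => [bm|_]; last first.
  by case: ifP => // _; rewrite mulr_ge0 ?powR_ge0// ltW.
rewrite (ltn_trans _ bm)// ler_pM2l// !powRN lef_pV2 ?posrE ?powR_gt0 ?mulr_gt0//.
have hp k : 0 <= h * k%:R :> R by rewrite mulr_ge0 ?(ltW h0).
apply: ge0_ler_powR; rewrite ?nnegrE ?(ltW beta0) ?hp ?ler_pM2l ?ler_nat//.
Qed.

Lemma sum_cell_mass : \sum_(b < m) cell_mass b = tail_mass 0.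
Proof.
rewrite -(big_mkord xpredT cell_mass) /cell_mass.
under eq_bigr do rewrite -opprB.
rewrite sumrN telescope_sumr// opprB.
by rewrite [tail_mass m]/tail_mass ltnn subr0.
Qed.

Definition above b : set R := [set x | (b < grid_index h m x)%N].

Definition cell b : set R := [set x | grid_index h m x = b.+1].

Lemma aboveE b : (b < m)%N -> above b = [set x | h * b.+1%:R < x].
Proof. by move=> bm; apply/seteqP; split=> x; rewrite /above /= grid_index_gt. Qed.

Lemma above_top : above m = set0.
Proof.
apply/seteqP; split=> x //; rewrite /above /= => hx.
by have := grid_index_le h m x; rewrite leqNgt hx.
Qed.

Lemma cellE b : cell b = above b `\` above b.+1.
Proof.
apply/seteqP; split=> x; rewrite /cell /above /=; first by move=> ->; rewrite ltnSn ltnn.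
by move=> [h1 /negP]; rewrite -leqNgt => h2; apply/eqP; rewrite eqn_leq h1 h2.
Qed.

Lemma measurable_above b : (b <= m)%N -> measurable (above b).
Proof.
rewrite leq_eqVlt => /orP[/eqP ->|bm]; first by rewrite above_top.
rewrite aboveE//; exact: measurable_gt.
Qed.

Lemma measurable_cell b : (b < m)%N -> measurable (cell b).
Proof. by move=> bm; rewrite cellE; apply: measurableD; apply: measurable_above => //; exact: ltnW. Qed.

Lemma above_split b : above b = cell b `|` above b.+1.
Proof.
apply/seteqP; split=> x; rewrite /above /cell /=.
  by rewrite leq_eqVlt => /orP[/eqP <-|]; [left|right].
by move=> [->//|]; exact: ltnW.
Qed.

Lemma cell_above_disj b : cell b `&` above b.+1 = set0.
Proof. by apply/seteqP; split=> x //= []; rewrite /cell /above /= => ->; rewrite ltnn. Qed.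

Lemma intensity_above b : (b <= m)%N ->
  intensity (pareto_density beta C) (above b) = (tail_mass b)%:E.
Proof.
rewrite leq_eqVlt /tail_mass => /orP[/eqP ->|bm].
  by rewrite above_top ltnn /intensity setI0 integral_set0.
by rewrite aboveE// bm intensity_tail// mulr_gt0.
Qed.

Lemma intensity_cell b : (b < m)%N ->
  intensity (pareto_density beta C) (cell b) = (cell_mass b)%:E.
Proof.
move=> bm; have := intensity_above (ltnW bm); rewrite /intensity above_split setIUr.
have mI : measurable (`]0%R, +oo[%classic : set R) by exact: measurable_itv.
have mc := measurable_cell bm; have ma := measurable_above bm.
rewrite ge0_integral_setU; first last.
- apply/eqP; rewrite setIACA setIid -subset0 => x [_].
  by rewrite -[_ x]/((cell b `&` above b.+1) x) cell_above_disj.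
- by move=> x _; rewrite lee_fin pareto_density_ge0.
- by apply/measurable_EFinP; exact: measurable_pareto_density.
- exact: measurableI.
- exact: measurableI.
rewrite -/(intensity _ (above b.+1)) intensity_above// => e.
have : (intensity (pareto_density beta C) (cell b) =
        (tail_mass b)%:E - (tail_mass b.+1)%:E)%E.
  by rewrite -e addeK.
by rewrite /intensity => ->.
Qed.

End cells.

Section poisson_cells.
Variables (R : realType) (beta C : R) (d : measure_display)
  (Omega : measurableType d) (Q : probability Omega R).
Variable eta : nat -> {RV Q >-> R}.
Hypotheses (beta0 : 0 < beta) (C0 : 0 < C).
Hypothesis pp : poisson_process (pareto_density beta C) eta.

Lemma measurable_count (B : set R) : measurable B ->
  measurable_fun setT (fun w => point_measure (fun j => eta j w) B).
Proof.
move=> mB; have md j : measurable_fun setT (fun w => (\d_(eta j w) B : \bar R)).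
  rewrite (_ : (fun w => _) = EFin \o (\1_B \o eta j)).
    by apply/measurable_EFinP; apply: measurableT_comp.
  by apply/funext => w; rewrite diracE /= indicE.
by apply: (@ge0_emeasurable_sum _ _ R setT (fun j w => (\d_(eta j w) B : \bar R)) xpredT).
Qed.

Lemma eventually_le (h : R) w : 0 < h -> exists K, eta K w <= h.
Proof.
move=> h0; have [/(_ w)[_ _ lim] _ _] := pp.
have /cvgrPdist_lt/(_ _ h0)[K _ /(_ K (leqnn K))] := lim.
rewrite /= sub0r normrN => eK; exists K.
exact: le_trans (ler_norm _) (ltW eK).
Qed.

Lemma eta_le w i j : (i <= j)%N -> eta j w <= eta i w.
Proof.
have [/(_ w)[_ dec _] _ _] := pp.
move=> /subnK <-; elim: (j - i)%N => [//|k IH]; rewrite addSn.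
exact: le_trans (dec _) IH.
Qed.

(** The points before the first one at or below h: a finite decreasing list that carries all the
    cell counts, to which the lemmas on lists apply. *)
Definition top_points (h : R) (h0 : 0 < h) w : seq R :=
  mkseq (fun j => eta j w) (ex_minn (eventually_le w h0)).

Lemma sorted_top_points h (h0 : 0 < h) w : sorted >=%R (top_points h0 w).
Proof.
rewrite /top_points; case: ex_minnP => K _ _.
apply/(sortedP 0) => i; rewrite size_mkseq => iK.
by rewrite !nth_mkseq ?(ltnW iK)//; exact: eta_le.
Qed.

Lemma top_points_index h m (h0 : 0 < h) w j :
  grid_index h m (top_points h0 w)`_j = grid_index h m (eta j w).
Proof.
rewrite /top_points; case: ex_minnP => K eK _.
have [jK|Kj] := ltnP j K; first by rewrite nth_mkseq.
rewrite nth_default ?size_mkseq// !grid_index0//; last exact: ltW.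
by apply: le_trans eK; exact: eta_le.
Qed.

Lemma point_measure_cell h m (h0 : 0 < h) w (b : 'I_m) :
  point_measure (fun j => eta j w) (cell h m b) =
  (cell_counts h m (top_points h0 w) b)%:R%:E.
Proof.
rewrite ffunE /top_points; case: ex_minnP => K eK _.
apply: point_measure_count => [x|j Kj].
  by rewrite /cell /=; split => [->|/eqP].
rewrite grid_index0//; apply: le_trans eK; exact: eta_le.
Qed.

(** The cells are disjoint and stay above h, so their intensities are finite and the defining
    properties of the Poisson process apply to them. *)
Lemma poisson_cell_counts h m (h0 : 0 < h) (n : {ffun 'I_m -> nat}) :
  let A := [set w | cell_counts h m (top_points h0 w) = n] in
  measurable A /\ fine (Q A) = \prod_(b < m) poisson_mass (cell_mass beta C h m b) (n b).
Proof.
move=> A.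
have AE : A = \bigcap_(b : 'I_m) ((fun w => point_measure (fun j => eta j w) (cell h m b))
      @^-1` [set (n b)%:R%:E]).
  apply/seteqP; split=> w; rewrite /A /=.
    by move=> <- b _ /=; rewrite (point_measure_cell h0).
  move=> hw; apply/ffunP => b; have := hw b I.
  rewrite /= (point_measure_cell h0) => -[] /eqP; rewrite eqr_nat => /eqP.
  by [].
have mc (b : 'I_m) : measurable (cell h m b) by exact: measurable_cell.
split.
  rewrite AE; apply: fin_bigcap_measurable => // b _.
  by rewrite -[X in measurable X]setTI; apply: measurable_count.
rewrite AE; have [_ law ind] := pp.
have := ind m (fun b => cell h m b) mc _.
move=> /(_ _)/(_ (fun b => [set (n b)%:R%:E])) ->; first last.
- by move=> b; exact: emeasurable_set1.
- move=> i j ij; apply/seteqP; split=> x //= []; rewrite /cell /= => -> [] /val_inj e.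
  by rewrite e eqxx in ij.
have -> : (\prod_(b < m) Q ((fun w => point_measure (fun j => eta j w) (cell h m b))
      @^-1` [set (n b)%:R%:E]) =
    (\prod_(b < m) poisson_mass (cell_mass beta C h m b) (n b))%:E)%E.
  rewrite (big_morph EFin (@EFinM R) (erefl _)); apply: eq_bigr => b _.
  have := law _ (mc b); rewrite intensity_cell// ltry => /(_ isT (n b)) <-.
  by congr (Q _); apply/seteqP; split.
by [].
Qed.

End poisson_cells.

(** * Order statistics of the heavy-tailed sample *)

(** Indices are shifted by one: index k + 1 is cell k and index 0 is [None]. The index never exceeds
    m, so [insub] always succeeds. *)
Definition cell_of (R : realDomainType) (h : R) m (x : R) : option 'I_m :=
  if grid_index h m x is k.+1 then insub k else None.

Lemma cell_of_some (R : realDomainType) (h : R) m (x : R) (b : 'I_m) :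
  (cell_of h m x == Some b) = (grid_index h m x == b.+1).
Proof.
rewrite /cell_of; have := grid_index_le h m x.
case: grid_index => // k km; rewrite insubT /= eqSS.
by apply/eqP/eqP => [[<-]//|kb]; congr Some; apply/val_inj.
Qed.

Lemma cell_of_none (R : realDomainType) (h : R) m (x : R) :
  (cell_of h m x == None) = (grid_index h m x == 0%N).
Proof.
rewrite /cell_of; have := grid_index_le h m x.
by case: grid_index => // k km; rewrite insubT.
Qed.

Lemma cell_counts_order_stats (R : realDomainType) (h : R) m N (V : 'I_N -> R) b :
  cell_counts h m (order_stats V) b = bin_count [ffun i => cell_of h m (V i)] b.
Proof.
rewrite ffunE /order_stats (seq.permP (permEl (perm_sort _ _))) /image_mem.
rewrite count_map -sum1_count big_mkcond /= /bin_count -big_enum /=.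
rewrite enumT; apply: eq_bigr => i _; rewrite ffunE cell_of_some.
by case: eqP.
Qed.

Section sample.
Variables (R : realType) (beta C : R) (d0 : measure_display)
  (Omega0 : measurableType d0) (P0 : probability Omega0 R) (afrak : {RV P0 >-> R})
  (d : nat -> measure_display) (Omega : forall N, measurableType (d N))
  (P : forall N, probability (Omega N) R)
  (a : forall N, 'I_N -> {RV (P N) >-> R}).
Hypothesis a_law : forall N (i : 'I_N) (B : set R), measurable B ->
  distribution (P N) (@a N i) B = distribution P0 afrak B.
Hypothesis a_indep :
  forall N, mutually_independent (P N) (fun i => @a N i : Omega N -> R).
Hypotheses (beta0 : 0 < beta) (C0 : 0 < C).
Hypothesis tail : forall t : R, 1 < t ->
  P0 [set w | afrak w > t] = (C * t `^ (- beta))%:E.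

(** Normalised so that about a constant number of entries exceed a given level. When beta = 1 /
    alpha this is the diagonal of [Hmx]. *)
Definition sample N (w : Omega N) (i : 'I_N) : R := N%:R `^ (- beta^-1) * @a N i w.

Lemma measurable_sample N i : measurable_fun setT (fun w => @sample N w i).
Proof. by apply: measurable_funM => //; exact: measurable_cst. Qed.

Lemma sample_law N (i : 'I_N) (B : set R) : measurable B ->
  P N [set w | B (sample w i)] =
  P0 [set w | B (N%:R `^ (- beta^-1) * afrak w)].
Proof.
move=> mB; pose f (x : R) := N%:R `^ (- beta^-1) * x.
have mf : measurable_fun setT f by apply: measurable_funM => //; exact: measurable_cst.
have mfB : measurable (f @^-1` B) by rewrite -[X in measurable X]setTI; exact: mf.
have := a_law i mfB; rewrite /distribution /pushforward /=.
by [].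
Qed.

(** Once N > t ^ (- beta), the threshold N ^ (1 / beta) t exceeds 1 and the tail hypothesis gives an
    exact equality, not just an equivalent. *)
Lemma near_sample_tail (t : R) : 0 < t -> \forall N \near \oo,
  P0 [set w | t < N%:R `^ (- beta^-1) * afrak w] = (C * t `^ (- beta) / N%:R)%:E.
Proof.
move=> t0; near=> N.
have tN : t `^ (- beta) < N%:R by near: N; exact: near_gt_nat.
have N0 : 0 < N%:R :> R by rewrite (le_lt_trans (powR_ge0 _ _) tN).
have s0 : 0 < N%:R `^ beta^-1 :> R by rewrite powR_gt0.
have -> : [set w | t < N%:R `^ (- beta^-1) * afrak w] =
          [set w | N%:R `^ beta^-1 * t < afrak w].
  apply/seteqP; split=> w /=; rewrite powRN (mulrC _^-1) ltr_pdivlMr// mulrC//.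
rewrite tail.
  rewrite powRM ?ltW// -powRrM mulrN mulVf ?gt_eqF// powR_inv1 ?ltW//.
  by rewrite (mulrC N%:R^-1) mulrA.
have : t^-1 < N%:R `^ beta^-1.
  have -> : t^-1 = (t `^ (- beta)) `^ beta^-1.
    by rewrite -powRrM mulNr mulfV ?gt_eqF// powR_inv1// ltW.
  by apply: gt0_ltr_powR; rewrite ?invr_gt0 ?nnegrE ?powR_ge0// ltW.
by rewrite -ltr_pdivrMr// div1r.
Unshelve. all: by end_near. Qed.

Lemma measurable_cell_of (h : R) m (o : option 'I_m) : 0 < h ->
  measurable (cell_of h m @^-1` [set o]).
Proof.
move=> h0; case: o => [b|].
  rewrite (_ : _ @^-1` _ = cell h m b); first exact: measurable_cell.
  apply/seteqP; split=> x; rewrite /cell /=.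
    by move/eqP; rewrite cell_of_some => /eqP.
  by move=> e; apply/eqP; rewrite cell_of_some e.
rewrite (_ : _ @^-1` _ = ~` above h m 0); first by apply: measurableC; exact: measurable_above.
apply/seteqP; split=> x; rewrite /above /=.
  by move/eqP; rewrite cell_of_none => /eqP ->.
by move/negP; rewrite -leqNgt leqn0 => e; apply/eqP; rewrite cell_of_none.
Qed.

(** Eventually a draw falls in cell b with probability exactly [cell_mass] of b divided by N, so the
    counts are multinomial in the regime of [multinomial_mass_cvg]. *)
Lemma sample_cell_counts (h : R) m (h0 : 0 < h) (n : {ffun 'I_m -> nat}) :
  let A N := [set w : Omega N | cell_counts h m (order_stats (sample w)) = n] in
  (forall N, measurable (A N)) /\
  fine (P N (A N)) @[N --> \oo] --> \prod_(b < m) poisson_mass (cell_mass beta C h m b) (n b).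
Proof.
move=> A.
have AE N : A N = [set w | forall b, bin_count [ffun i => cell_of h m (sample w i)] b = n b].
  apply/seteqP; split=> w; rewrite /A /=.
    by move=> <- b; rewrite cell_counts_order_stats.
  by move=> hw; apply/ffunP => b; rewrite cell_counts_order_stats.
have indV N : mutually_independent (P N) (fun i w => @sample N w i).
  move=> B mB; pose f (x : R) := N%:R `^ (- beta^-1) * x.
  have mf : measurable_fun setT f by apply: measurable_funM => //; exact: measurable_cst.
  have mfB i : measurable (f @^-1` B i) by rewrite -[X in measurable X]setTI; exact: mf.
  exact: (a_indep mfB).
pose w N (o : option 'I_m) := fine (P0 [set w | (cell_of h m @^-1` [set o]) (N%:R `^ (- beta^-1) * afrak w)]).
have bc N := @prob_bin_count R _ _ (P N) N m (fun i w => @sample N w i) (cell_of h m) (w N) n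
   (@measurable_sample N) (indV N) (fun o => measurable_cell_of o h0) _.
have hw N (i : 'I_N) o : fine (P N ((fun w => @sample N w i) @^-1` (cell_of h m @^-1` [set o]))) = w N o.
  rewrite /w -(sample_law i)//; exact: measurable_cell_of.
have {}bc := bc hw; split; first by move=> N; rewrite AE; exact: (bc N).1.
have h1 := @multinomial_mass_cvg R m _ n (fun b : 'I_m => cell_mass_ge0 m beta0 C0 h0 b).
(* The grid is fixed while N grows, so finitely many thresholds are involved and one rank N serves
   all of them. *)
have tails : \forall N \near \oo, forall b : 'I_m,
    P0 [set w | h * b.+1%:R < N%:R `^ (- beta^-1) * afrak w] =
    (C * (h * b.+1%:R) `^ (- beta) / N%:R)%:E.
  apply: filter_forall => b; apply: near_sample_tail.
  by rewrite mulr_gt0.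
apply: cvg_trans h1; apply: near_eq_cvg; near=> N.
rewrite AE (bc N).2 sum_cell_mass -multinomial_massE.
rewrite /multinomial_sum; apply: eq_bigr => f _; apply: eq_bigr => i _.
have Sb b : (b <= m)%N -> fine (P0 [set w | above h m b (N%:R `^ (- beta^-1) * afrak w)]) =
                        tail_mass beta C h m b / N%:R.
  rewrite /tail_mass leq_eqVlt => /orP[/eqP ->|bm].
    by rewrite ltnn mul0r above_top (_ : [set w | _] = set0) ?measure0.
  rewrite bm aboveE//.
  have tN : forall b : 'I_m, P0 [set w | h * b.+1%:R < N%:R `^ (- beta^-1) * afrak w] =
    (C * (h * b.+1%:R) `^ (- beta) / N%:R)%:E by near: N.
  by rewrite (tN (Ordinal bm)).
have msc : measurable_fun setT (fun w => N%:R `^ (- beta^-1) * afrak w).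
  by apply: measurable_funM => //; exact: measurable_cst.
have mS b : (b <= m)%N ->
    measurable [set w | above h m b (N%:R `^ (- beta^-1) * afrak w)].
  move=> bm; rewrite -[X in measurable X]setTI.
  by apply: (msc measurableT); exact: measurable_above.
case: (f i) => [b|] /=; rewrite /w; apply/esym.
  have -> : [set w | (cell_of h m @^-1` [set Some b]) (N%:R `^ (- beta^-1) * afrak w)] =
     [set w | above h m b (N%:R `^ (- beta^-1) * afrak w)] `\`
     [set w | above h m b.+1 (N%:R `^ (- beta^-1) * afrak w)].
    apply/seteqP; split=> x /=; rewrite /above /=.
      by move=> /eqP; rewrite cell_of_some => /eqP ->; rewrite ltnSn ltnn.
    move=> [h3 /negP]; rewrite -leqNgt => h4; apply/eqP; rewrite cell_of_some.
    by rewrite eqn_leq h3 h4.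
  have m1 := mS b (ltnW (ltn_ord b)); have m2 := mS b.+1 (ltn_ord b).
  rewrite (measureD m1 m2) ?ltey_eq ?fin_num_measure// setIidr; last first.
    by move=> x /=; rewrite /above /=; exact: ltnW.
  by rewrite fineB ?fin_num_measure// !Sb// ?(ltnW (ltn_ord b))// mulrBl.
have -> : [set w | (cell_of h m @^-1` [set None]) (N%:R `^ (- beta^-1) * afrak w)] =
     ~` [set w | above h m 0 (N%:R `^ (- beta^-1) * afrak w)].
  apply/seteqP; split=> x /=; rewrite /above /=.
    by move=> /eqP; rewrite cell_of_none => /eqP ->.
  by move=> /negP; rewrite -leqNgt leqn0 => h4; apply/eqP; rewrite cell_of_none.
by rewrite fine_probC; [rewrite Sb|exact: mS].
Unshelve. all: by end_near. Qed.

End sample.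

(** * Continuity and measurability of eigenvalues and order statistics *)

Lemma eigenvalues_spectrum (R : realType) N (A : 'M[R]_N) : A^T = A ->
  spectrum A (eigenvalues A).
Proof. by move=> /spectrum_exists[s As]; exact: (@xgetPex _ [::] [set s | _] (ex_intro _ s As)). Qed.

Lemma qformD (R : comPzRingType) n (A B : 'M[R]_n) u :
  qform (A + B) u = qform A u + qform B u.
Proof.
rewrite /qform mulmxDr /dotv -big_split; apply: eq_bigr => i _.
by rewrite mxE mulrDl.
Qed.

Lemma spectrum_diag_perturb (R : rcfType) N (M : 'M[R]_N) (u v : 'rV[R]_N) s t j e :
  M^T = M -> spectrum (M + diag_mx u) s -> spectrum (M + diag_mx v) t ->
  (j < N)%N -> (forall i, u 0 i <= v 0 i + e) -> s`_j <= t`_j + e.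
Proof.
move=> Mt As At jN uv.
have sym x : (M + diag_mx x)^T = M + diag_mx x by rewrite linearD /= Mt tr_diag_mx.
apply: (spectrum_perturb (sym u) (sym v) As At jN) => x.
rewrite !qformD -addrA lerD2l !qform_diag dotvv_sum mulr_sumr -big_split /=.
by apply: ler_sum => i _; rewrite -mulrDl ler_wpM2r ?sqr_ge0.
Qed.

(** By Weyl's inequality in both directions, each eigenvalue is 1-Lipschitz in the diagonal for the
    sup norm. *)
Lemma continuous_eigenvalue (R : realType) N (M : 'M[R]_N) j : M^T = M ->
  continuous (fun v : 'rV[R]_N => (eigenvalues (M + diag_mx v))`_j).
Proof.
move=> Mt v.
have sp x : spectrum (M + diag_mx x) (eigenvalues (M + diag_mx x)).
  by apply: eigenvalues_spectrum; rewrite linearD /= Mt tr_diag_mx.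
have [jN|Nj] := ltnP j N; last first.
  (* Beyond the N eigenvalues, [nth] returns the constant 0. *)
  rewrite [X in continuous_at _ X](_ : _ = fun=> 0); first exact: cst_continuous.
  by apply/funext => x; rewrite nth_default// (spectrum_size (sp x)).
apply/(@cvgrPdist_le R R _ (nbhs v) _) => e e0; near=> v'.
have vv' : ball v e v' by near: v'; exact: nbhsx_ballx.
have {}vv' i : `|v 0 i - v' 0 i| <= e.
  by case: vv' => _ /(_ 0 i); rewrite -ball_normE => /ltW.
have h i : v 0 i <= v' 0 i + e /\ v' 0 i <= v 0 i + e.
  by have := vv' i; rewrite ler_norml => /andP[h1 h2]; lra.
have := spectrum_diag_perturb Mt (sp v) (sp v') jN (fun i => (h i).1).
have := spectrum_diag_perturb Mt (sp v') (sp v) jN (fun i => (h i).2).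
by rewrite ler_norml => h1 h2; lra.
Unshelve. all: by end_near. Qed.

Lemma measurable_eigenvalue (R : realType) N (M : 'M[R]_N) j
    (d : measure_display) (T : measurableType d) (X : T -> 'I_N -> R) :
  M^T = M -> (forall i, measurable_fun setT (fun w => X w i)) ->
  measurable_fun setT (fun w => (eigenvalues (M + diag_mx (\row_i X w i)))`_j).
Proof.
move=> Mt mX; apply: (@measurable_fun_row _ _ _ _ (fun w => \row_i X w i)
  (fun v => (eigenvalues (M + diag_mx v))`_j)).
  move=> i; rewrite [X in measurable_fun _ X](_ : _ = fun w => X w i)//.
  by apply/funext => w; rewrite mxE.
exact: continuous_eigenvalue.
Qed.

(** Makes measurability of order statistics the case M = 0 of measurability of eigenvalues. *)
Lemma order_stats_eigenvalues (R : realType) N (V : 'I_N -> R) :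
  order_stats V = eigenvalues (diag_mx (\row_i V i)).
Proof.
apply: (spectrum_inj (spectrum_diag V)); apply: eigenvalues_spectrum.
by rewrite tr_diag_mx.
Qed.

Lemma measurable_order_stats (R : realType) N j
    (d : measure_display) (T : measurableType d) (X : T -> 'I_N -> R) :
  (forall i, measurable_fun setT (fun w => X w i)) ->
  measurable_fun setT (fun w => (order_stats (X w))`_j).
Proof.
move=> mX; under eq_fun do rewrite order_stats_eigenvalues -[diag_mx _]add0r.
by apply: measurable_eigenvalue; rewrite ?trmx0.
Qed.

Lemma measurable_countable (R : realType) (S : countType)
    (d : measure_display) (T : measurableType d) (y : T -> S) (Psi : S -> R) :
  (forall c, measurable [set w | y w = c]) -> measurable_fun setT (Psi \o y).
Proof.
move=> my _ B mB; rewrite setTI.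
rewrite (_ : _ @^-1` _ = \bigcup_c (if `[< B (Psi c) >] then [set w | y w = c] else set0)).
  by apply: countable_bigcupT_measurable => [|c]; [exact: countableP|case: ifP].
apply/seteqP; split=> w /=.
  by move=> Bw; exists (y w) => //; case: asboolP.
by move=> [c _]; case: asboolP => // Bc e; rewrite e.
Qed.

Lemma row_norm_le (R : realType) k (v : 'rV[R]_k) (T : R) : 0 <= T ->
  (forall i, `|v 0 i| <= T) -> `|v| <= T.
Proof.
move=> T0 h; rewrite /Num.norm /= mx_normrE; apply: bigmax_le => // -[i j] _ /=.
by rewrite ord1.
Qed.

Lemma compact_norm_ball (R : realType) k (T : R) :
  compact [set v : 'rV[R]_k | `|v| <= T].
Proof.
have cn : continuous (fun v : 'rV[R]_k => `|v|) by move=> v; exact: norm_continuous.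
apply: bounded_closed_compact.
  exists T; split; first exact: num_real.
  by move=> y hy v /= hv; apply: le_trans hv (ltW hy).
have -> : [set v : 'rV[R]_k | `|v| <= T] =
   (fun v : 'rV[R]_k => `|v|) @^-1` [set y | y <= T] by [].
by apply: preimage_closed => //; exact: closed_le.
Qed.

Section order_stats_law.
Variables (R : realType) (beta C : R) (d0 : measure_display)
  (Omega0 : measurableType d0) (P0 : probability Omega0 R) (afrak : {RV P0 >-> R})
  (d : nat -> measure_display) (Omega : forall N, measurableType (d N))
  (P : forall N, probability (Omega N) R)
  (a : forall N, 'I_N -> {RV (P N) >-> R})
  (d' : measure_display) (Omega' : measurableType d')
  (Q : probability Omega' R) (eta : nat -> {RV Q >-> R}).
Hypothesis a_law : forall N (i : 'I_N) (B : set R), measurable B ->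
  distribution (P N) (@a N i) B = distribution P0 afrak B.
Hypothesis a_indep :
  forall N, mutually_independent (P N) (fun i => @a N i : Omega N -> R).
Hypotheses (beta0 : 0 < beta) (C0 : 0 < C).
Hypothesis tail : forall t : R, 1 < t ->
  P0 [set w | afrak w > t] = (C * t `^ (- beta))%:E.
Hypothesis pp : poisson_process (pareto_density beta C) eta.

Definition sample_stats N (w : Omega N) (j : nat) : R :=
  (order_stats (sample beta a w))`_j.

Lemma measurable_sample_stats N j :
  measurable_fun setT (fun w => @sample_stats N w j).
Proof.
by apply: measurable_order_stats => i; exact: measurable_sample.
Qed.

Lemma eta_prob_gt_small (e : R) : 0 < e ->
  exists T : nat, fine (Q [set w | T.+1%:R < eta 0%N w]) <= e.
Proof.
move=> e0; apply: decreasing_prob_small => //.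
- by move=> n; apply: measurable_gt.
- by move=> n w /=; apply: le_lt_trans; rewrite ler_nat.
- apply/seteqP; split=> // w h; have := h (Num.bound `|eta 0%N w|) I => /=.
  rewrite ltNge => /negP; apply; apply: le_trans (ler_norm _) _.
  apply: le_trans (ltW (archi_boundP _)) _ => //.
  by rewrite ler_nat.
Qed.

(* Up to the mesh h, the vectors are functions of the numbers of points in the
   cells of a grid; these counts are multinomial, resp. independent Poisson. *)
Lemma order_stats_cvg k : cvg_vec P Q
  (fun N w => \row_(j < k) Num.max (@sample_stats N w j) 0)
  (fun w => \row_(j < k) eta j w).
Proof.
move=> F cF [M FM]; have M0 : 0 <= M by apply: le_trans (FM 0).
apply: cvg_approx => e e0.
(* The largest point exceeds T + 1 with probability at most p under Q, hence at most 2 p under P N;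
   this costs 2 M (2 p) <= e / 2. *)
pose p := e / (8 * M + 8).
have M8 : 0 < 8 * M + 8 by rewrite ltr_wpDl// mulr_ge0.
have p0 : 0 < p by rewrite divr_gt0.
have Mp : e / 2 + 2 * M * (2 * p) <= e.
  suff : 2 * M * (2 * p) <= e / 2 by lra.
  rewrite /p -subr_ge0.
  have -> : e / 2 - 2 * M * (2 * (e / (8 * M + 8))) = e * 4 / (8 * M + 8).
    by field; rewrite gt_eqF.
  by rewrite divr_ge0 ?mulr_ge0// ltW.
have [T hT] := eta_prob_gt_small p0.
have e2 : 0 < e / 2 by rewrite divr_gt0.
have [del del0 hdel] := compact_uniform (@compact_norm_ball R k T.+1%:R) cF e2.
have [q hq] : exists q : nat, q.+1%:R^-1 < del.
  exists (Num.bound del^-1); rewrite -[ltRHS]invrK ltf_pV2 ?posrE ?invr_gt0//.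
  apply: lt_trans (archi_boundP _) _; first by rewrite invr_ge0 ltW.
  by rewrite ltr_nat.
(* The mesh is below the modulus of continuity, and h m = T + 1 exactly, so that index m means
   exceeding T + 1. *)
pose h : R := q.+1%:R^-1; pose m := (T.+1 * q.+1)%N.
have h0 : 0 < h by rewrite invr_gt0.
have hm : h * m%:R = T.+1%:R by rewrite /h /m natrM mulrCA mulVf ?mulr1.
have m0 : (0 < m)%N by rewrite muln_gt0.
pose Psi (y : {ffun 'I_m -> nat}) := F (\row_(j < k) (h * (rank_index y j)%:R)).
pose Y N (w : Omega N) := cell_counts h m (order_stats (sample beta a w)).
pose Y' (w : Omega') := cell_counts h m (top_points pp h0 w).
have mY N c : measurable [set w | Y N w = c].
  by have [h1 _] := sample_cell_counts a_law a_indep beta0 C0 tail h0 c; exact: h1.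
have mY' c : measurable [set w | Y' w = c].
  by have [h1 _] := poisson_cell_counts beta0 C0 pp h0 c; exact: h1.
have cY c : fine (P N [set w | Y N w = c]) @[N --> \oo] --> fine (Q [set w | Y' w = c]).
  have [_ ->] := poisson_cell_counts beta0 C0 pp h0 c.
  by have [_] := sample_cell_counts a_law a_indep beta0 C0 tail h0 c.
have rankY N w j : rank_index (Y N w) j = grid_index h m (sample_stats w j).
  by rewrite /Y rank_index_cell_counts// sorted_order_stats.
have rankY' w j : rank_index (Y' w) j = grid_index h m (eta j w).
  by rewrite /Y' rank_index_cell_counts ?sorted_top_points// top_points_index.
(* Applied both to the sample and to the Poisson points. The positive part agrees with index 0 being
   rounded to 0. *)
have close (z : nat -> R) : (forall j, (j < k)%N -> z j <= T.+1%:R) ->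
    `|F (\row_(j < k) Num.max (z j) 0) -
      F (\row_(j < k) (h * (grid_index h m (z j))%:R))| <= e / 2.
  move=> zT; apply/ltW/hdel => [/=|i].
    apply: row_norm_le => // i; rewrite mxE ger0_norm ?le_max ?lexx ?orbT//.
    by rewrite ge_max zT/=.
  rewrite !mxE distrC; apply: le_lt_trans hq.
  by apply: grid_index_approx => //; rewrite hm zT.
have gridm x : (grid_index h m x == m) = (T.+1%:R < x).
  have mm : (m.-1 < m)%N by rewrite prednK.
  have := grid_index_gt h0 x mm; rewrite prednK// hm => <-.
  by rewrite eqn_leq grid_index_le.
exists (fun N => mean (P N) (Psi \o Y N)), (mean Q (Psi \o Y')); split.
- apply: (mass_cvg mY mY' cY (B := M)) => c; exact: FM.
- apply: le_trans (mean_close (M := M) (e := e / 2) Q _ _ _ _ _ _ _) _;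
    last first.
  + apply: le_trans Mp; rewrite lerD2l ler_wpM2l ?mulr_ge0//.
    apply: le_trans hT _; lra.
  + move=> w /= /negP; rewrite -leNgt => hw; rewrite /Psi.
    have -> : \row_(j < k) (h * (rank_index (Y' w) j)%:R) =
              \row_(j < k) (h * (grid_index h m (eta j w))%:R).
      by apply/rowP => j; rewrite !mxE rankY'.
    have := close (fun j => eta j w).
    have -> : \row_(j < k) Num.max (eta j w) 0 = \row_(j < k) eta j w.
      apply/rowP => j; rewrite !mxE; apply/max_idPl.
      by have [/(_ w)[h1 _ _] _ _] := pp; exact: ltW.
    apply=> j _; apply: le_trans hw; exact: (eta_le pp).
  + exact: ltW.
  + by apply: measurable_gt.
  + by move=> w; exact: FM.
  + by move=> w; exact: FM.
  + exact: measurable_countable.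
  + apply: measurable_fun_row => // i.
    rewrite [X in measurable_fun _ X](_ : _ = (eta i : Omega' -> R))//.
    by apply/funext => w; rewrite mxE.
(* Exceeding T + 1 is itself a function of the cell counts, so the tightness of the sample also
   follows from the convergence of their masses. *)
have big : fine (P N [set w | T.+1%:R < sample_stats w 0%N]) @[N --> \oo] -->
           fine (Q [set w | T.+1%:R < eta 0%N w]).
  pose Psi2 (y : {ffun 'I_m -> nat}) : R := (rank_index y 0%N == m)%:R.
  have -> : fine (Q [set w | T.+1%:R < eta 0%N w]) = mean Q (Psi2 \o Y').
    rewrite -mean_indic; last exact: measurable_gt.
    congr mean; apply/funext => w; rewrite /Psi2 /= rankY' gridm indicE.
    by congr (nat_of_bool _)%:R; apply/idP/idP; [move/set_mem|move=> ?; exact/mem_set].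
  have -> : (fun N => fine (P N [set w | T.+1%:R < sample_stats w 0%N])) =
            (fun N => mean (P N) (Psi2 \o Y N)).
    apply/funext => N.
    rewrite -mean_indic; last by apply: measurable_gt; exact: measurable_sample_stats.
    congr mean; apply/funext => w; rewrite /Psi2 /= rankY gridm indicE.
    by congr (nat_of_bool _)%:R; apply/idP/idP; [move/set_mem|move=> ?; exact/mem_set].
  apply: (mass_cvg mY mY' cY (B := 1)) => c.
  by rewrite /Psi2; case: eqP; rewrite ?normr1 ?normr0.
move/cvgrPdist_le/(_ _ p0) : big => big.
near=> N.
have bigN : `|fine (Q [set w | T.+1%:R < eta 0%N w]) -
   fine (P N [set w | T.+1%:R < sample_stats w 0%N])| <= p by near: N.
apply: le_trans (mean_close (M := M) (e := e / 2)
   (A := [set w | T.+1%:R < sample_stats w 0%N]) (P N) _ _ _ _ _ _ _) _;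
    last first.
- apply: le_trans Mp; rewrite lerD2l ler_wpM2l ?mulr_ge0//.
  by move: bigN; rewrite ler_norml => /andP[h1 h2]; lra.
- move=> w /= /negP; rewrite -leNgt => hw; rewrite /Psi.
  have -> : \row_(j < k) (h * (rank_index (Y N w) j)%:R) =
            \row_(j < k) (h * (grid_index h m (sample_stats w j))%:R).
    by apply/rowP => j; rewrite !mxE rankY.
  apply: close => j _; have [jN|Nj] := ltnP j N.
    by apply: le_trans hw; exact: order_stats_le.
  by rewrite /sample_stats nth_default// size_order_stats.
- exact: ltW.
- by apply: measurable_gt; exact: measurable_sample_stats.
- by move=> w; exact: FM.
- by move=> w; exact: FM.
- exact: measurable_countable.
- apply: measurable_fun_row => // i.
  rewrite [X in measurable_fun _ X](_ : _ = fun w => Num.max (sample_stats w i) 0)//.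
    by apply: measurable_maxr => //; exact: measurable_sample_stats.
  by apply/funext => w; rewrite mxE.
Unshelve. all: by end_near. Qed.

End order_stats_law.

(** * Eigenvalues dominated by the diagonal *)

Lemma tridiag_row_sum (R : realType) N (i : 'I_N) : \sum_j tridiag R N i j <= 2.
Proof.
have := @tridiag_sum R N i (fun=> 1); under eq_bigr do rewrite mulr1.
by move=> ->; case: ifP => _; case: ifP => _; lra.
Qed.

Lemma tridiag_ge0 (R : realType) N (i j : 'I_N) : 0 <= tridiag R N i j.
Proof. by rewrite mxE. Qed.

Lemma qform_tridiag_le (R : realType) N (u : 'rV[R]_N) :
  qform (tridiag R N) u <= 2 * dotv u u.
Proof.
apply: (qform_supersolution (phi := fun=> 1)) => //; first exact: tridiag_sym.
- by move=> i j _; exact: tridiag_ge0.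
- by move=> i _; rewrite mulr1; under eq_bigr do rewrite mulr1; exact: tridiag_row_sum.
Qed.

(** The entries are nonnegative, so minus the form at u is at most the form at |u|, which has the
    same norm. *)
Lemma qform_tridiag_ge (R : realType) N (u : 'rV[R]_N) :
  - (2 * dotv u u) <= qform (tridiag R N) u.
Proof.
pose v : 'rV[R]_N := \row_i `|u 0 i|.
have -> : dotv u u = dotv v v.
  by apply: eq_bigr => i _; rewrite !mxE -normrM ger0_norm// -expr2 sqr_ge0.
rewrite lerNl; apply: le_trans (qform_tridiag_le v).
rewrite -sumrN; apply: ler_sum => i _.
rewrite ![(_ *m _) _ _]mxE !mulr_suml -sumrN; apply: ler_sum => j _.
rewrite /v ![(\row_i _) _ _]mxE; have T0 := tridiag_ge0 R j i.
have h : 0 <= `|u 0 j| * `|u 0 i| + u 0 j * u 0 i.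
  by rewrite -normrM; have := ler_norm (- (u 0 j * u 0 i)); rewrite normrN; lra.
by have := mulr_ge0 T0 h; lra.
Qed.

Lemma jacobi_diag_close (R : realType) N (V : 'I_N -> R) s j :
  spectrum (tridiag R N + diag_mx (\row_i V i)) s -> (j < N)%N ->
  `|s`_j - (order_stats V)`_j| <= 2.
Proof.
move=> As jN; have Ds := spectrum_diag V.
have symD : (diag_mx (\row_i V i))^T = diag_mx (\row_i V i) by rewrite tr_diag_mx.
have symH := jacobi_sym (\row_i V i).
have h1 := spectrum_perturb symH symD As Ds jN (e := 2) _.
have h2 := spectrum_perturb symD symH Ds As jN (e := 2) _.
rewrite ler_norml; apply/andP; split.
  rewrite lerBrDr addrC -lerBrDr opprK; apply: h2 => u; rewrite qformD.
  by have := qform_tridiag_ge u; lra.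
rewrite lerBlDr addrC; apply: h1 => u; rewrite qformD.
by have := qform_tridiag_le u; lra.
Qed.

Lemma order_stats_scale (R : realDomainType) N (V : 'I_N -> R) (c : R) j :
  0 < c -> (order_stats (fun i => c * V i))`_j = c * (order_stats V)`_j.
Proof.
move=> c0; have -> : order_stats (fun i => c * V i) = [seq c * x | x <- order_stats V].
  apply: (sorted_eq (@ge_trans_rel R)).
  - by move=> x y /=; rewrite andbC => /le_anti.
  - exact: sorted_order_stats.
  - rewrite sorted_map; apply: sub_sorted (sorted_order_stats V) => x y /=.
    by rewrite /= ler_pM2l.
  - rewrite perm_sort /order_stats perm_sym; apply: (perm_trans (perm_map _ (permEl (perm_sort _ _)))).
    by rewrite /image_mem -map_comp.
have [jN|Nj] := ltnP j N; first by rewrite (nth_map 0)// size_order_stats.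
by rewrite !nth_default ?mulr0// ?size_map size_order_stats.
Qed.

Section part_b.
Variables (R : realType) (beta C : R) (d0 : measure_display)
  (Omega0 : measurableType d0) (P0 : probability Omega0 R) (afrak : {RV P0 >-> R})
  (d : nat -> measure_display) (Omega : forall N, measurableType (d N))
  (P : forall N, probability (Omega N) R)
  (a : forall N, 'I_N -> {RV (P N) >-> R})
  (d' : measure_display) (Omega' : measurableType d')
  (Q : probability Omega' R) (eta : nat -> {RV Q >-> R}).
Hypothesis a_law : forall N (i : 'I_N) (B : set R), measurable B ->
  distribution (P N) (@a N i) B = distribution P0 afrak B.
Hypothesis a_indep :
  forall N, mutually_independent (P N) (fun i => @a N i : Omega N -> R).
Hypotheses (beta0 : 0 < beta) (C0 : 0 < C).
Hypothesis tail : forall t : R, 1 < t ->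
  P0 [set w | afrak w > t] = (C * t `^ (- beta))%:E.
Hypothesis pp : poisson_process (pareto_density beta C) eta.

Lemma measurable_row_coord (d1 : measure_display) (T : measurableType d1) k
    (f : 'I_k -> T -> R) i : (forall i, measurable_fun setT (f i)) ->
  measurable_fun setT (fun w => (\row_j f j w) 0 i).
Proof.
by move=> mf; rewrite [X in measurable_fun _ X](_ : _ = f i)//; apply/funext => w; rewrite mxE.
Qed.

(** The limit [eta k] is positive everywhere, hence above some level with high probability. Index k
    is the last coordinate of a vector of length k + 1. *)
Lemma sample_stats_small k (p : R) : 0 < p -> exists2 del : R, 0 < del &
  \forall N \near \oo, fine (P N [set w | sample_stats beta a w k <= del]) <= p.
Proof.
move=> p0; have p2 : 0 < p / 2 by rewrite divr_gt0.
have mle (d1 : measure_display) (T : measurableType d1) (f : T -> R) t :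
    measurable_fun setT f -> measurable [set w | f w <= t].
  move=> mf; rewrite (_ : [set w | f w <= t] = ~` [set w | t < f w]).
    by apply: measurableC; exact: measurable_gt.
  by apply/seteqP; split=> w /=; rewrite leNgt => /negP.
have [n hn] : exists n : nat, fine (Q [set w | eta k w <= n.+1%:R^-1]) <= p / 2.
  apply: decreasing_prob_small => //.
  - by move=> n; apply: mle.
  - move=> n w /= h; apply: le_trans h _.
    by rewrite lef_pV2 ?posrE// ler_nat.
  - apply/seteqP; split=> // w h.
    have [/(_ w)[/(_ k) ek _ _] _ _] := pp.
    have := h (Num.bound (eta k w)^-1) I => /=.
    rewrite leNgt => /negP; apply; rewrite -[ltRHS]invrK ltf_pV2 ?posrE ?invr_gt0//.
    apply: lt_trans (archi_boundP _) _; first by rewrite invr_ge0 ltW.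
    by rewrite ltr_nat.
pose del : R := n.+1%:R^-1; have del0 : 0 < del by rewrite invr_gt0.
exists (del / 2); first by rewrite divr_gt0.
(* Equal to 1 when the last coordinate is at most del / 2, and to 0 when it is at least del. *)
pose f (v : 'rV[R]_k.+1) : R := clamp (2 - 2 / del * v 0 ord_max).
have cf : continuous f.
  move=> v; apply: (@continuous_comp _ _ _ (fun v : 'rV[R]_k.+1 => 2 - 2 / del * v 0 ord_max) (@clamp R)); last exact: continuous_clamp.
  apply: continuousB; first exact: cst_continuous.
  apply: continuousM; first exact: cst_continuous.
  exact: coord_continuous.
have := @cvg_vec_event _ _ _ P _ _ Q k.+1 _ _ f
  (fun N => [set w | sample_stats beta a w k <= del / 2]) [set w | eta k w <= del] (p / 2)
  (order_stats_cvg a_law a_indep beta0 C0 tail pp (k := k.+1)).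
move=> ev; have {ev} : \forall N \near \oo,
   fine (P N [set w | sample_stats beta a w k <= del / 2]) <=
   fine (Q [set w | eta k w <= del]) + p / 2.
  apply: ev => //.
  - move=> N i; apply: measurable_row_coord => j.
    by apply: measurable_maxr => //; exact: measurable_sample_stats.
  - by move=> i; apply: measurable_row_coord.
  - by move=> x; rewrite clamp_ge0 clamp_le1.
  - by move=> N; apply: mle; exact: measurable_sample_stats.
  - by apply: mle.
  - move=> N w /= h; rewrite /f mxE /= clamp1//.
    have : 2 / del * Num.max (sample_stats beta a w k) 0 <= 2 / del * (del / 2).
      by rewrite ler_wpM2l ?divr_ge0 ?(ltW del0)// ge_max h divr_ge0// ltW.
    have -> : 2 / del * (del / 2) = 1 by field; rewrite gt_eqF.
    lra.
  - move=> w /= /negP; rewrite -ltNge => h; rewrite /f mxE /= clamp0//.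
    have : 2 / del * del <= 2 / del * eta k w.
      by rewrite ler_wpM2l ?divr_ge0 ?(ltW del0)// ltW.
    have -> : 2 / del * del = 2 by field; rewrite gt_eqF.
    lra.
move=> ev; near=> N; apply: le_trans (_ : fine (Q [set w | eta k w <= del]) + p / 2 <= _).
  by near: N.
by rewrite /del; lra.
Unshelve. all: by end_near. Qed.

End part_b.

Lemma HmxE (R : realType) N (alpha : R) (V : 'I_N -> R) :
  Hmx alpha V = tridiag R N + diag_mx (\row_i (N%:R `^ (- alpha) * V i)).
Proof. by []. Qed.

Lemma measurable_Hmx_eigenvalue (R : realType) N (alpha : R) j
    (d : measure_display) (T : measurableType d) (X : 'I_N -> T -> R) :
  (forall i, measurable_fun setT (X i)) ->
  measurable_fun setT (fun w => (eigenvalues (Hmx alpha (X ^~ w)))`_j).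
Proof.
move=> mX; apply: (@measurable_eigenvalue R N (tridiag R N) j d T
  (fun w i => N%:R `^ (- alpha) * X i w)); first exact: tridiag_sym.
by move=> i; apply: measurable_funM => //; exact: measurable_cst.
Qed.

Lemma Hmx_spectrum (R : realType) N (alpha : R) (V : 'I_N -> R) :
  spectrum (tridiag R N + diag_mx (\row_i (N%:R `^ (- alpha) * V i)))
    (eigenvalues (Hmx alpha V)).
Proof. by apply: eigenvalues_spectrum; rewrite -HmxE; exact: jacobi_sym. Qed.

Lemma cvg_expectation (R : realType) (d : nat -> measure_display)
    (Omega : forall n, measurableType (d n)) (P : forall n, probability (Omega n) R)
    (d' : measure_display) (Omega' : measurableType d') (Q : probability Omega' R)
    (f : forall n, Omega n -> R) (g : Omega' -> R) :
  (forall n, measurable_fun setT (f n)) -> measurable_fun setT g ->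
  (forall n, exists M, forall w, `|f n w| <= M) -> (exists M, forall w, `|g w| <= M) ->
  mean (P n) (f n) @[n --> \oo] --> mean Q g ->
  ('E_(P n)[f n])%E @[n --> \oo] --> ('E_Q[g])%E.
Proof.
move=> mf mg fM [M gM] fg; rewrite (expectation_mean Q mg gM).
rewrite (_ : (fun n => _) = EFin \o (fun n => mean (P n) (f n))).
  by apply: cvg_EFin => //; apply: nearW.
by apply/funext => n; have [M' fM'] := fM n; rewrite (expectation_mean _ (mf n) fM').
Qed.

Lemma cvg_vec_in_law (R : realType) k (d : nat -> measure_display)
    (Omega : forall n, measurableType (d n)) (P : forall n, probability (Omega n) R)
    (d' : measure_display) (Omega' : measurableType d') (Q : probability Omega' R)
    (X : forall n, Omega n -> 'rV[R]_k) (Y : Omega' -> 'rV[R]_k) :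
  (forall n i, measurable_fun setT (fun w => X n w 0 i)) ->
  (forall i, measurable_fun setT (fun w => Y w 0 i)) ->
  cvg_vec P Q X Y -> cvg_in_law [set: 'rV[R]_k] P X Q Y.
Proof.
move=> mX mY XY F cF [M FM].
have {}cF : continuous F.
  by move=> x; have := cF x; rewrite /continuous_at nbhs_subspaceT.
have {}FM x : `|F x| <= M by exact: FM.
have mFX n : measurable_fun setT (F \o X n) by exact: measurable_fun_row.
have mFY : measurable_fun setT (F \o Y) by exact: measurable_fun_row.
split=> //; apply: cvg_expectation => //.
- by move=> n; exists M => w; exact: FM.
- by exists M => w; exact: FM.
- by apply: XY => //; exists M.
Qed.

Section part_b.
Variables (R : realType) (alpha beta C : R) (d0 : measure_display)
  (Omega0 : measurableType d0) (P0 : probability Omega0 R) (afrak : {RV P0 >-> R})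
  (d : nat -> measure_display) (Omega : forall N, measurableType (d N))
  (P : forall N, probability (Omega N) R)
  (a : forall N, 'I_N -> {RV (P N) >-> R})
  (d' : measure_display) (Omega' : measurableType d')
  (Q : probability Omega' R) (eta : nat -> {RV Q >-> R}).
Hypothesis a_law : forall N (i : 'I_N) (B : set R), measurable B ->
  distribution (P N) (@a N i) B = distribution P0 afrak B.
Hypothesis a_indep :
  forall N, mutually_independent (P N) (fun i => @a N i : Omega N -> R).
Hypotheses (beta0 : 0 < beta) (C0 : 0 < C).
Hypothesis tail : forall t : R, 1 < t ->
  P0 [set w | afrak w > t] = (C * t `^ (- beta))%:E.
Hypothesis pp : poisson_process (pareto_density beta C) eta.

Lemma sample_stats_scale N (w : Omega N) (c : R) j : (0 < N)%N ->
  sample_stats beta a w j =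
  N%:R `^ (alpha - beta^-1) *
    (order_stats (fun i => N%:R `^ (- alpha) * @a N i w))`_j.
Proof.
move=> N0; rewrite -order_stats_scale ?powR_gt0 ?ltr0n//.
rewrite /sample_stats; congr (nth _ (order_stats _) _); apply/funext => i.
rewrite /sample mulrA -powRD ?pnatr_eq0 -?lt0n ?N0 ?implybT//.
by congr (_ `^ _ * _); ring.
Qed.

Lemma measurable_le_set (d1 : measure_display) (T : measurableType d1)
    (f : T -> R) t : measurable_fun setT f -> measurable [set w | f w <= t].
Proof.
move=> mf; rewrite (_ : [set w | f w <= t] = ~` [set w | t < f w]).
  by apply: measurableC; exact: measurable_gt.
by apply/seteqP; split=> w /=; rewrite leNgt => /negP.
Qed.

Lemma sample_stats_le N (w : Omega N) i k : (i <= k)%N ->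
  0 < sample_stats beta a w k ->
  (k < N)%N /\ sample_stats beta a w k <= sample_stats beta a w i.
Proof.
move=> ik; rewrite /sample_stats; have [kN|Nk] := ltnP k N.
  by move=> _; split=> //; apply: order_stats_le; rewrite ik.
by rewrite nth_default ?size_order_stats// ltxx.
Qed.

Lemma scaled_eigenvalues_cvg k : 0 < alpha -> beta < alpha^-1 ->
  cvg_vec P Q
    (fun N w => \row_(i < k) (N%:R `^ (alpha - beta^-1) *
       (eigenvalues (Hmx alpha (fun i => @a N i w)))`_i))
    (fun w => \row_(i < k) eta i w).
Proof.
move=> alpha0 ba.
have mlam N j : measurable_fun setT (fun w => (eigenvalues (Hmx alpha (fun i => @a N i w)))`_j).
  exact: (measurable_Hmx_eigenvalue alpha j (fun i => measurable_funPT (@a N i))).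
apply: (slutsky _ _ _ (order_stats_cvg a_law a_indep beta0 C0 tail pp (k := k))).
- move=> N i; apply: measurable_row_coord => j.
  by apply: measurable_funM => //; exact: measurable_cst.
- move=> N i; apply: measurable_row_coord => j.
  by apply: measurable_maxr => //; exact: measurable_sample_stats.
- by move=> i; apply: measurable_row_coord.
move=> e p e0 p0.
have [del del0 hdel] := sample_stats_small a_law a_indep beta0 C0 tail pp k p0.
exists (fun N => [set w | sample_stats beta a w k <= del]).
  by move=> N; apply: measurable_le_set; exact: measurable_sample_stats.
have c0 : (N%:R `^ (alpha - beta^-1) : R) @[N --> \oo] --> (0 : R).
  have b0 : 0 < beta^-1 - alpha.
    by rewrite subr_gt0 -[ltLHS]invrK ltf_pV2 ?posrE ?invr_gt0.
  have := cvg_comp _ _ (@cvgr_idn R) (powR_cvgy0 b0).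
  by rewrite opprB.
have e2 : 0 < e / 2 by rewrite divr_gt0.
move/cvgrPdist_le/(_ _ e2) : c0 => c0.
near=> N; split; first by near: N.
move=> w /= /negP; rewrite -ltNge => zk i; rewrite !mxE.
(* A positive value at index k is not the default 0, so k < N; the smaller indices then have
   positive values too, and their positive parts are themselves. *)
have [kN zki] := sample_stats_le (ltnW (ltn_ord i)) (lt_trans del0 zk).
have zi0 : 0 < sample_stats beta a w i by apply: lt_le_trans zki; exact: lt_trans zk.
rewrite (max_idPl (ltW zi0)) sample_stats_scale// ?(leq_ltn_trans _ kN)// -mulrBr normrM.
have iN : (i < N)%N by apply: ltn_trans kN.
have h1 := jacobi_diag_close (Hmx_spectrum alpha (fun i => @a N i w)) iN.
have h2 : `|0 - N%:R `^ (alpha - beta^-1)| <= e / 2 by near: N.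
rewrite sub0r normrN in h2.
by apply: le_trans (ler_pM _ _ h2 h1) _ => //; rewrite divfK.
Unshelve. all: by end_near. Qed.

End part_b.

(** * Isolated large sites *)

Lemma union_bound (R : realType) (d : measure_display) (T : measurableType d)
    (P : probability T R) (n : nat) (A : nat -> set T) (q : R) :
  (forall i, measurable (A i)) -> (forall i, (i < n)%N -> fine (P (A i)) <= q) ->
  fine (P (\bigcup_(i < n) A i)) <= n%:R * q.
Proof.
move=> mA; elim: n => [|n IH] hq.
  by rewrite bigcup_mkord big_ord0 measure0 mul0r.
have mU : measurable (\bigcup_(i < n) A i) by apply: bigcup_measurable.
have -> : \bigcup_(i < n.+1) A i = (\bigcup_(i < n) A i) `|` A n.
  by rewrite !bigcup_mkord big_ord_recr.
apply: (@le_trans _ _ (fine (P (\bigcup_(i < n) A i)) + fine (P (A n)))).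
  rewrite -fineD ?fin_num_measure// fine_le ?fin_numD ?fin_num_measure//.
    exact: measurableU.
  exact: measureU2.
rewrite -natr1 mulrDl mul1r lerD ?hq//; apply: IH => i ni; apply: hq.
exact: ltnW.
Qed.

Lemma fine_prob_setU_le (R : realType) (d : measure_display) (T : measurableType d)
    (P : probability T R) (A B : set T) : measurable A -> measurable B ->
  fine (P (A `|` B)) <= fine (P A) + fine (P B).
Proof.
move=> mA mB; rewrite -fineD ?fin_num_measure// fine_le ?fin_numD ?fin_num_measure//.
  exact: measurableU.
exact: measureU2.
Qed.

Section separation.
Variables (R : realType) (beta C C1 : R) (d0 : measure_display)
  (Omega0 : measurableType d0) (P0 : probability Omega0 R) (afrak : {RV P0 >-> R})
  (d : nat -> measure_display) (Omega : forall N, measurableType (d N))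
  (P : forall N, probability (Omega N) R)
  (a : forall N, 'I_N -> {RV (P N) >-> R}).
Hypothesis a_law : forall N (i : 'I_N) (B : set R), measurable B ->
  distribution (P N) (@a N i) B = distribution P0 afrak B.
Hypothesis a_indep :
  forall N, mutually_independent (P N) (fun i => @a N i : Omega N -> R).
Hypotheses (beta0 : 0 < beta) (C0 : 0 < C) (C10 : 0 < C1).
Hypothesis tail : forall t : R, 1 < t ->
  P0 [set w | afrak w > t] = (C * t `^ (- beta))%:E.
Hypothesis ltail : forall t : R, 1 < t ->
  (P0 [set w | (afrak w < - t)%R] <= (C1 * t `^ (- beta))%:E)%E.

Definition large (delta : R) : set R := [set x | delta < `|x|].

Lemma measurable_large delta : measurable (large delta).
Proof.
by apply: measurable_gt; exact: normr_measurable.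
Qed.

(** Both tails enter: the exact upper one gives C and the bound on the lower one gives C1. *)
Lemma near_large_prob (delta : R) : 0 < delta -> \forall N \near \oo,
  forall i, fine (P N [set w | large delta (sample beta a w i)]) <=
    (C + C1) * delta `^ (- beta) / N%:R.
Proof.
move=> t0; near=> N => i; rewrite (sample_law beta a_law i); last exact: measurable_large.
have tN : delta `^ (- beta) < N%:R by near: N; exact: near_gt_nat.
have N0 : 0 < N%:R :> R by rewrite (le_lt_trans (powR_ge0 _ _) tN).
have s0 : 0 < N%:R `^ beta^-1 :> R by rewrite powR_gt0.
have hup : P0 [set w | delta < N%:R `^ (- beta^-1) * afrak w] =
   (C * delta `^ (- beta) / N%:R)%:E.
  by near: N; exact: near_sample_tail.
have scN : (N%:R `^ beta^-1 * delta) `^ (- beta) = delta `^ (- beta) / N%:R.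
  rewrite powRM ?ltW// -powRrM mulrN mulVf ?gt_eqF// powR_inv1 ?ltW//.
  by rewrite mulrC.
have sc1 : 1 < N%:R `^ beta^-1 * delta.
  have : delta^-1 < N%:R `^ beta^-1.
    have -> : delta^-1 = (delta `^ (- beta)) `^ beta^-1.
      by rewrite -powRrM mulNr mulfV ?gt_eqF// powR_inv1// ltW.
    by apply: gt0_ltr_powR; rewrite ?invr_gt0 ?nnegrE ?powR_ge0// ltW.
  by rewrite -ltr_pdivrMr// div1r.
have mu : measurable [set w | delta < N%:R `^ (- beta^-1) * afrak w].
  by apply: measurable_gt; apply: measurable_funM => //; exact: measurable_cst.
have ml : measurable [set w | (afrak w < - (N%:R `^ beta^-1 * delta))%R].
  rewrite (_ : [set w | _] = [set w | N%:R `^ beta^-1 * delta < - afrak w]).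
    by apply: measurable_gt; exact: measurable_funN.
  by apply/seteqP; split=> w /=; rewrite ltrNr.
have sub : [set w | large delta (N%:R `^ (- beta^-1) * afrak w)] `<=`
   [set w | delta < N%:R `^ (- beta^-1) * afrak w] `|`
   [set w | (afrak w < - (N%:R `^ beta^-1 * delta))%R].
  move=> w; rewrite /large /= lter_normr => /orP[h|h]; [by left|right].
  by rewrite ltrNr -ltr_pdivlMl// -powRN mulrN.
have mL : measurable [set w | large delta (N%:R `^ (- beta^-1) * afrak w)].
  have msc : measurable_fun setT (fun w => N%:R `^ (- beta^-1) * afrak w).
    by apply: measurable_funM => //; exact: measurable_cst.
  rewrite -[X in measurable X]setTI; apply: (msc measurableT).
  exact: measurable_large.
apply: le_trans (fine_prob_le _ mL (measurableU _ _ mu ml) sub) _.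
apply: le_trans (fine_prob_setU_le _ mu ml) _.
rewrite hup /= mulrDl mulrDl lerD2l.
have := ltail sc1; rewrite scN => h.
by rewrite -lee_fin fineK ?fin_num_measure// -mulrA.
Unshelve. all: by end_near. Qed.

(** Indexed by integers and empty from N on, so that n + t + 1 may run past the last site without
    side conditions. *)
Definition large_site (delta : R) N (n : nat) : set (Omega N) :=
  [set w | exists2 i : 'I_N, i = n :> nat & large delta (sample beta a w i)].

Lemma large_siteE delta N (i : 'I_N) :
  large_site delta i = [set w | large delta (sample beta a w i)].
Proof.
apply/seteqP; split=> w /=; last by exists i.
by move=> [j /val_inj ->].
Qed.

Lemma large_site_out delta N n : (N <= n)%N -> @large_site delta N n = set0.
Proof.
move=> Nn; apply/seteqP; split=> // w [i ni _].
by have := ltn_ord i; rewrite ni ltnNge Nn.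
Qed.

Lemma measurable_sample_large delta N (i : 'I_N) :
  measurable [set w | large delta (sample beta a w i)].
Proof.
rewrite -[X in measurable X]setTI; apply: (measurable_sample beta a i measurableT).
exact: measurable_large.
Qed.

Lemma measurable_large_site delta N n : measurable (@large_site delta N n).
Proof.
have [nN|Nn] := ltnP n N; last by rewrite large_site_out.
by rewrite (large_siteE delta (Ordinal nN)); exact: measurable_sample_large.
Qed.

(** The bad event: two large sites at distance at most 2 (L + 1), or one among the L + 1 sites at
    either end. Off it, the geometric hypotheses of [jacobi_eigenvalue] hold. *)
Definition crowded (delta : R) (L N : nat) : set (Omega N) :=
  (\bigcup_(n < N) \bigcup_(t < 2 * L.+1)
     (@large_site delta N n `&` @large_site delta N (n + t.+1))) `|`
  ((\bigcup_(n < L.+1) @large_site delta N n) `|`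
   (\bigcup_(n < L.+1) @large_site delta N (N - n.+1))).

Lemma measurable_crowded delta L N : measurable (@crowded delta L N).
Proof.
apply: measurableU; last first.
  by apply: measurableU; apply: bigcup_measurable => n _; exact: measurable_large_site.
apply: bigcup_measurable => n _; apply: bigcup_measurable => t _.
by apply: measurableI; exact: measurable_large_site.
Qed.

Lemma not_crowded delta L N (w : Omega N) : ~ @crowded delta L N w ->
  (forall i j : 'I_N, delta < `|sample beta a w i| -> delta < `|sample beta a w j| ->
     i != j -> (2 * L.+1 < site_dist i j)%N) /\
  (forall i : 'I_N, delta < `|sample beta a w i| -> (L < i /\ i + L.+1 < N)%N).
Proof.
move=> nc.
have lt_sep (i j : 'I_N) : delta < `|sample beta a w i| -> delta < `|sample beta a w j| ->
     (i < j)%N -> (2 * L.+1 < site_dist i j)%N.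
  move=> hi hj ij; rewrite ltnNge; apply/negP => h; apply: nc; left.
  exists i; first exact: (ltn_ord i).
  exists (j - i).-1; first by move: h ij; rewrite /site_dist /=; clear; lia.
  by split; [exists i|exists j => //; move: ij; clear; lia].
split.
  move=> i j hi hj; case: (ltngtP i j) => [ij|ij|/val_inj ->]; last by rewrite eqxx.
    by move=> _; exact: lt_sep.
  by move=> _; rewrite site_distC; exact: lt_sep.
move=> i hi; split; rewrite ltnNge; apply/negP => h; apply: nc; right.
  by left; exists i => //; exists i.
right; exists (N - i.+1)%N; first by move: h; rewrite /=; clear; lia.
by exists i => //; have := ltn_ord i; clear; lia.
Qed.

(** Union bound: 2 (L + 1) N pairs of probability at most (K / N) ^ 2 by independence, and 2 (L + 1)
    sites near the ends of probability at most K / N. With L fixed, the total is O(1 / N). *)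
Lemma crowded_small delta L (p : R) : 0 < delta -> 0 < p ->
  \forall N \near \oo, fine (P N (@crowded delta L N)) <= p.
Proof.
move=> delta0 p0; pose K := (C + C1) * delta `^ (- beta).
have K0 : 0 < K by rewrite mulr_gt0 ?addr_gt0 ?powR_gt0.
have lim := cvg_const_over_nat ((2 * L.+1)%:R * K ^+ 2 + 2 * L.+1%:R * K).
move/cvgrPdist_le/(_ _ p0) : lim => lim.
near=> N.
have N0 : 0 < N%:R :> R by near: N; exact: near_gt_nat.
have hp : `|0 - ((2 * L.+1)%:R * K ^+ 2 + 2 * L.+1%:R * K) / N%:R| <= p by near: N.
rewrite sub0r normrN in hp.
have hq : forall i, fine (P N [set w | large delta (sample beta a w i)]) <= K / N%:R.
  by near: N; exact: near_large_prob.
have q0 : 0 <= K / N%:R by apply: divr_ge0; exact: ltW.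
have hs n : fine (P N (@large_site delta N n)) <= K / N%:R.
  have [nN|Nn] := ltnP n N; last by rewrite large_site_out// measure0.
  by rewrite (large_siteE delta (Ordinal nN)).
have hpair n t : fine (P N (@large_site delta N n `&` @large_site delta N (n + t.+1))) <=
   (K / N%:R) ^+ 2.
  have [tN|Nt] := ltnP (n + t.+1) N; last first.
    by rewrite (large_site_out delta Nt) setI0 measure0 sqr_ge0.
  have nN : (n < N)%N by move: tN; clear; lia.
  pose i := Ordinal nN; pose j := Ordinal tN.
  have ij : j != i by rewrite -(inj_eq val_inj) /=; clear; lia.
  rewrite (large_siteE delta i) (large_siteE delta j).
  have mf : measurable_fun setT (fun x : R => N%:R `^ (- beta^-1) * x).
    by apply: measurable_funM => //; exact: measurable_cst.
  have mB : measurable ((fun x : R => N%:R `^ (- beta^-1) * x) @^-1` large delta).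
    by rewrite -[X in measurable X]setTI; apply: (mf measurableT); exact: measurable_large.
  (* Taking the full line away from i and j extracts the product rule for this pair from mutual
     independence. *)
  pose B (l : 'I_N) := if (l == i) || (l == j) then
     (fun x : R => N%:R `^ (- beta^-1) * x) @^-1` large delta else setT.
  have mB' l : measurable (B l) by rewrite /B; case: ifP.
  have := a_indep mB'.
  have -> : \bigcap_l (@a N l @^-1` B l) = [set w | large delta (sample beta a w i)] `&`
      [set w | large delta (sample beta a w j)].
    apply/seteqP; split=> w.
      move=> h; split; first by have := h i I; rewrite /B /= eqxx.
      by have := h j I; rewrite /B /= eqxx orbT.
    move=> [hi hj] l _; rewrite /B /=; case: eqP => [->//|_] /=.
    by case: eqP => [->//|_].
  move=> ->; rewrite /B (bigD1 i)//= (bigD1 j)//= eqxx ?orbT /= big1 ?mule1; last first.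
    move=> l /andP[/negPf -> /negPf ->] /=.
    by rewrite preimage_setT probability_setT.
  rewrite eqxx orbT fineM; last first.
  - exact/fin_num_measure/(measurable_sample_large delta j).
  - exact/fin_num_measure/(measurable_sample_large delta i).
  by rewrite expr2; apply: ler_pM; rewrite ?fine_ge0 ?hq.
rewrite /crowded.
have m1 : measurable (\bigcup_(n < N) \bigcup_(t < 2 * L.+1)
     (@large_site delta N n `&` @large_site delta N (n + t.+1))).
  apply: bigcup_measurable => n _; apply: bigcup_measurable => t _.
  by apply: measurableI; exact: measurable_large_site.
have m2 : measurable (\bigcup_(n < L.+1) @large_site delta N n).
  by apply: bigcup_measurable => n _; exact: measurable_large_site.
have m3 : measurable (\bigcup_(n < L.+1) @large_site delta N (N - n.+1)).
  by apply: bigcup_measurable => n _; exact: measurable_large_site.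
apply: le_trans (fine_prob_setU_le _ m1 (measurableU _ _ m2 m3)) _.
have h1 : fine (P N (\bigcup_(n < N) \bigcup_(t < 2 * L.+1)
     (@large_site delta N n `&` @large_site delta N (n + t.+1)))) <=
     N%:R * ((2 * L.+1)%:R * (K / N%:R) ^+ 2).
  apply: union_bound => n.
    apply: bigcup_measurable => t _.
    by apply: measurableI; exact: measurable_large_site.
  move=> _; apply: union_bound => t; last by move=> _; exact: hpair.
  by apply: measurableI; exact: measurable_large_site.
have h2 : fine (P N (\bigcup_(n < L.+1) @large_site delta N n)) <= L.+1%:R * (K / N%:R).
  by apply: union_bound => n; [exact: measurable_large_site|move=> _; exact: hs].
have h3 : fine (P N (\bigcup_(n < L.+1) @large_site delta N (N - n.+1))) <=
    L.+1%:R * (K / N%:R).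
  by apply: union_bound => n; [exact: measurable_large_site|move=> _; exact: hs].
have h4 := fine_prob_setU_le (P N) m2 m3.
apply: le_trans hp; apply: le_trans (ler_norm _).
have -> : ((2 * L.+1)%:R * K ^+ 2 + 2 * L.+1%:R * K) / N%:R =
  N%:R * ((2 * L.+1)%:R * (K / N%:R) ^+ 2) + (L.+1%:R * (K / N%:R) + L.+1%:R * (K / N%:R)).
  by field; rewrite gt_eqF.
by apply: lerD => //; apply: le_trans h4 _; exact: lerD.
Unshelve. all: by end_near. Qed.

End separation.

(** * Convergence of the largest eigenvalues in the regime of (a) *)

Section part_a.
Variables (R : realType) (alpha C C1 : R) (d0 : measure_display)
  (Omega0 : measurableType d0) (P0 : probability Omega0 R) (afrak : {RV P0 >-> R})
  (d : nat -> measure_display) (Omega : forall N, measurableType (d N))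
  (P : forall N, probability (Omega N) R)
  (a : forall N, 'I_N -> {RV (P N) >-> R})
  (d' : measure_display) (Omega' : measurableType d')
  (Q : probability Omega' R) (eta : nat -> {RV Q >-> R}).
Hypothesis a_law : forall N (i : 'I_N) (B : set R), measurable B ->
  distribution (P N) (@a N i) B = distribution P0 afrak B.
Hypothesis a_indep :
  forall N, mutually_independent (P N) (fun i => @a N i : Omega N -> R).
Hypotheses (alpha0 : 0 < alpha) (C0 : 0 < C) (C10 : 0 < C1).
Hypothesis tail : forall t : R, 1 < t ->
  P0 [set w | afrak w > t] = (C * t `^ (- alpha^-1))%:E.
Hypothesis ltail : forall t : R, 1 < t ->
  (P0 [set w | (afrak w < - t)%R] <= (C1 * t `^ (- alpha^-1))%:E)%E.
Hypothesis pp : poisson_process (pareto_density alpha^-1 C) eta.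

Let beta0 : 0 < alpha^-1. Proof. by rewrite invr_gt0. Qed.

Definition bump_energy (x : R) : R := Num.sqrt (x ^+ 2 + 4).

Lemma continuous_bump_energy : continuous bump_energy.
Proof.
move=> x; apply: (@continuous_comp _ _ _ (fun x : R => x ^+ 2 + 4) Num.sqrt).
  by apply: continuousD; [exact: exprn_continuous|exact: cst_continuous].
exact: sqrt_continuous.
Qed.

Lemma continuous_map_row k (g : R -> R) : continuous g ->
  continuous (fun v : 'rV[R]_k => \row_i g (v 0 i)).
Proof.
move=> cg v.
apply/(@cvg_ballP R _ _ (nbhs v) _) => e e0.
have h i : \forall v' \near nbhs v, ball  (g (v 0 i)) e (g ((v' : 'rV[R]_k) 0 i)).
  have : {for v, continuous (fun v : 'rV[R]_k => g (v 0 i))}.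
    apply: (@continuous_comp _ _ _ (fun v : 'rV[R]_k => v 0 i) g); last exact: cg.
    exact: coord_continuous.
  by move=> /(@cvg_ballP R _ _ (nbhs v) _)/(_ _ e0).
have {}h : \forall v' \near nbhs v, forall i, ball (g (v 0 i)) e (g ((v' : 'rV[R]_k) 0 i)).
  by apply: filter_forall => i; exact: h.
near=> v'; split=> // i j; rewrite !mxE.
by move: j; near: v'.
Unshelve. all: by end_near. Qed.

(** The intermediate vector Z is the image of the order statistics, which converges by continuous
    mapping. The eigenvalues differ from it by at most delta + 2 / (L + 1) off a bad event. *)
Lemma eigenvalues_cvg k :
  cvg_vec P Q
    (fun N w => \row_(i < k) (eigenvalues (Hmx alpha (fun i => @a N i w)))`_i)
    (fun w => \row_(i < k) bump_energy (eta i w)).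
Proof.
have mlam N j : measurable_fun setT (fun w => (eigenvalues (Hmx alpha (fun i => @a N i w)))`_j).
  exact: (measurable_Hmx_eigenvalue alpha j (fun i => measurable_funPT (@a N i))).
have mg (d1 : measure_display) (T : measurableType d1) (f : T -> R) :
    measurable_fun setT f -> measurable_fun setT (fun w => bump_energy (f w)).
  move=> mf; apply: (measurableT_comp _ mf).
  exact: continuous_measurable_fun continuous_bump_energy.
pose Z N (w : Omega N) : 'rV[R]_k :=
  \row_(j < k) bump_energy (Num.max (sample_stats alpha^-1 a w j) 0).
apply: (slutsky (Z := Z)).
- by move=> N i; apply: measurable_row_coord => j.
- move=> N i; apply: measurable_row_coord => j; apply: mg.
  by apply: measurable_maxr => //; exact: measurable_sample_stats.
- by move=> i; apply: measurable_row_coord => j; exact: mg.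
- move=> F cF [M FM].
  pose F' (v : 'rV[R]_k) := F (\row_i bump_energy (v 0 i)).
  have cF' : continuous F'.
    move=> v; apply: (@continuous_comp _ _ _ (fun v : 'rV[R]_k => \row_i bump_energy (v 0 i)) F).
      exact: (continuous_map_row continuous_bump_energy).
    exact: cF.
  have := order_stats_cvg a_law a_indep beta0 C0 tail pp (k := k) cF'.
  move=> /(_ (ex_intro _ M (fun x => FM _))).
  have -> : (fun n => mean (P n) (F' \o (fun w => \row_(j < k) Num.max (sample_stats alpha^-1 a w j) 0))) =
            (fun n => mean (P n) (F \o @Z n)).
    apply/funext => N; congr mean; apply/funext => w; rewrite /F' /Z /=; congr F.
    by apply/rowP => i; rewrite !mxE.
  have -> : F' \o (fun w => \row_(j < k) eta j w) =
            F \o (fun w => \row_(i < k) bump_energy (eta i w)).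
    apply/funext => w; rewrite /F' /=; congr F.
    by apply/rowP => i; rewrite !mxE.
  by [].
move=> e p e0 p0; have p2 : 0 < p / 2 by rewrite divr_gt0.
have [del del0 hdel] := sample_stats_small a_law a_indep beta0 C0 tail pp k p2.
have e2 : 0 < e / 2 by rewrite divr_gt0.
(* At most del, so the statistic of index k is above delta with high probability; at most e / 2, so
   that it takes half of the allowed error. The term 2 / (L + 1) takes the other half. *)
pose delta := Num.min del (e / 2).
have delta0 : 0 < delta by rewrite lt_min del0.
pose L := Num.bound (4 / e).
have hL : 2 / L.+1%:R <= e / 2.
  have e4 : 4 / e < L.+1%:R.
    apply: lt_trans (archi_boundP _) _; first by rewrite divr_ge0 ?ltW.
    by rewrite ltr_nat.
  rewrite ler_pdivrMr// mulrC; move: e4; rewrite ltr_pdivrMr// => e4; lra.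
exists (fun N => [set w | sample_stats alpha^-1 a w k <= delta] `|` crowded alpha^-1 a delta L (N := N)).
  move=> N; apply: measurableU; last exact: measurable_crowded.
  by apply: measurable_le_set; exact: measurable_sample_stats.
have cs := crowded_small a_law a_indep beta0 C0 C10 tail ltail L delta0 p2.
near=> N; split.
  have ms t : measurable [set w : Omega N | sample_stats alpha^-1 a w k <= t].
    by apply: measurable_le_set; exact: measurable_sample_stats.
  apply: le_trans (fine_prob_setU_le (P N) (ms delta) (measurable_crowded alpha^-1 a delta L N)) _.
  rewrite [leRHS]splitr lerD//; last by near: N.
  apply: le_trans (_ : fine (P N [set w | sample_stats alpha^-1 a w k <= del]) <= _); last by near: N.
  apply: fine_prob_le; [exact: ms|exact: ms|].
  by move=> w /= /le_trans; apply; rewrite ge_min lexx.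
move=> w nB i; rewrite !mxE.
have zk : delta < sample_stats alpha^-1 a w k.
  by rewrite ltNge; apply/negP => h; apply: nB; left.
have nc : ~ crowded alpha^-1 a delta L w by move=> h; apply: nB; right.
have [kN zki] := sample_stats_le (ltnW (ltn_ord i)) (lt_trans delta0 zk).
have zi : delta < sample_stats alpha^-1 a w i by apply: lt_le_trans zki.
rewrite (max_idPl (ltW (lt_trans delta0 zi))).
have iN : (i < N)%N by apply: ltn_trans kN.
have [sep bd] := not_crowded nc.
have sp := Hmx_spectrum alpha (fun i => @a N i w).
(* At beta = 1 / alpha the rescaled sample is the diagonal of the matrix itself. *)
have sE : (fun i => N%:R `^ (- alpha) * @a N i w) = sample alpha^-1 a w.
  by apply/funext => j; rewrite /sample invrK.
move: sp; rewrite -[X in spectrum (_ + diag_mx X)]/(\row_i ((fun i => N%:R `^ (- alpha) * @a N i w) i)) sE => sp.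
have := jacobi_eigenvalue sp (ltW delta0) iN sep bd zi.
move/le_trans; apply; rewrite [leRHS]splitr lerD// ge_min lexx orbT//.
Unshelve. all: by end_near. Qed.

End part_a.

(** * From vectors to point measures *)

Lemma continuous_prod_topology (I : Type) (K : I -> topologicalType)
    (X : topologicalType) (f : X -> prod_topology K) :
  (forall i, continuous (fun x => f x i)) -> continuous f.
Proof.
move=> cf x; apply/cvg_sup => i U [?/= [[W oW <-]]] /= Wfx /filterS; apply.
by apply: (cf i); exact: open_nbhs_nbhs.
Qed.

Definition row_fun (R : nmodType) k (v : 'rV[R]_k) (j : nat) : R :=
  oapp (fun i => v 0 i) 0 (insub j).

Lemma row_funE (R : nmodType) k (y : nat -> R) j : (j < k)%N ->
  row_fun (\row_(i < k) y i) j = y j.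
Proof. by move=> jk; rewrite /row_fun insubT /= mxE. Qed.

Lemma continuous_row_fun (R : realType) k j :
  continuous (fun v : 'rV[R]_k => row_fun v j).
Proof.
rewrite /row_fun; case: insubP => [i _ _|_] /=; first exact: coord_continuous.
exact: cst_continuous.
Qed.

Definition finite_point_measure (R : realType) (m : nat) (y : nat -> R) :
  borel_measure R := msum (fun j => dirac (y j)) m.

Lemma finite_point_measure_eq (R : realType) m (y z : nat -> R) :
  (forall j, (j < m)%N -> y j = z j) ->
  finite_point_measure m y = finite_point_measure m z.
Proof.
move=> yz; apply: eq_measure; apply/funext => B.
by rewrite /finite_point_measure /= /msum; apply: eq_bigr => j _; rewrite yz.
Qed.

Lemma finite_point_measure_finite (R : realType) m (y : nat -> R) :
  @finite_measures R (finite_point_measure m y).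
Proof.
apply: (@le_lt_trans _ _ (\sum_(j < m) (\d_(y j) [set: R] : \bar R))%E); first by [].
by apply: lte_sum_pinfty => j _; rewrite diracT ltry.
Qed.

Lemma dirac_mrestr (R : realType) (c y : R) (B : set R) :
  (\d_y (B `&` `]c, +oo[%classic) : \bar R) = if c < y then \d_y B else 0%E.
Proof.
rewrite !diracE; case: ifPn => cy.
  congr (nat_of_bool _)%:R%:E; apply/idP/idP => /set_mem h; apply/mem_set.
    by case: h.
  by split=> //=; rewrite in_itv /= cy.
rewrite memNset//= => -[_]; rewrite in_itv /= andbT; exact/negP.
Qed.

Lemma restrict_point_measure (R : realType) (c : R) (y : nat -> R) m :
  (forall j, (c < y j) = (j < m)%N) ->
  restrict_measure c (point_measure y) = finite_point_measure m y.
Proof.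
move=> cy; apply: eq_measure; apply/funext => B.
transitivity (\sum_(0 <= j <oo) (\d_(y j) (B `&` `]c, +oo[%classic) : \bar R))%E; first by [].
rewrite (nneseries_split 0%N m)// [X in (_ + X)%E]eseries0 => [|i mi _]; last first.
  by rewrite dirac_mrestr cy ltnNge mi.
rewrite adde0 add0n big_mkord /finite_point_measure /= /msum.
by apply: eq_bigr => j _; rewrite dirac_mrestr cy ltn_ord.
Qed.

Lemma restrict_msum (R : realType) (c : R) (y : nat -> R) m N : (m <= N)%N ->
  (forall j, (j < N)%N -> (c < y j) = (j < m)%N) ->
  restrict_measure c (msum (fun j => dirac (y j)) N) = finite_point_measure m y.
Proof.
move=> mN cy; apply: eq_measure; apply/funext => B.
transitivity (\sum_(j < N) (\d_(y j) (B `&` `]c, +oo[%classic) : \bar R))%E; first by [].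
rewrite /finite_point_measure /= /msum.
rewrite (big_ord_widen N (fun j => (\d_(y j) B : \bar R)) mN) [RHS]big_mkcond.
by apply: eq_bigr => j _; rewrite dirac_mrestr cy.
Qed.

Lemma integral_finite_point_measure (R : realType) (f : R -> R) m (y : nat -> R) :
  measurable_fun setT f ->
  (\int[finite_point_measure m y]_x (f x)%:E = (\sum_(j < m) f (y j))%:E)%E.
Proof.
move=> mf; rewrite integralE.
have mfE : measurable_fun setT (EFin \o f) by exact/measurable_EFinP.
rewrite !ge0_integral_measure_sum//; last 2 first.
- exact: measurable_funeneg.
- exact: measurable_funepos.
have h (g : R -> \bar R) : measurable_fun setT g -> (forall x, (0 <= g x)%E) ->
    (\sum_(n < m) \int[dirac (y n)]_x g x = \sum_(n < m) g (y n))%E.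
  move=> mg g0; apply: eq_bigr => j _.
  by rewrite integral_dirac// diracT mul1e.
rewrite !h//; last 2 first.
- exact: measurable_funeneg.
- exact: measurable_funepos.
have e1 (x : R) : ((fun x => (f x)%:E)^\+ x = (Num.max (f x) 0)%:E)%E.
  by rewrite funeposE -EFin_max.
have e2 (x : R) : ((fun x => (f x)%:E)^\- x = (Num.max (- f x) 0)%:E)%E.
  by rewrite funenegE -EFin_max.
under eq_bigr do rewrite e1; under [X in (_ - X)%E]eq_bigr do rewrite e2.
rewrite !sumEFin -EFinB -sumrB; congr EFin; apply: eq_bigr => j _.
by case: (leP 0 (f (y j))) => fy; rewrite /Num.max; case: ltP; case: ltP; lra.
Qed.

(** The weak topology is initial for the integrals, and the integral of f is the sum of m continuous
    functions of the coordinates. Continuity relies on the number m of points being fixed. *)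
Lemma continuous_finite_point_measure (R : realType) k m :
  continuous (fun v : 'rV[R]_k =>
    finite_point_measure m (row_fun v) : weak_measures R).
Proof.
apply: continuous_comp_initial; apply: continuous_prod_topology => -[f [cf bf]].
have -> : (fun v : 'rV[R]_k => (@integrals R \o (fun v => finite_point_measure m (row_fun v)))
      v (exist _ f (conj cf bf))) =
    (fun v => (\sum_(j < m) f (row_fun v j))%:E).
  apply/funext => v; rewrite /= /integrals /= integral_finite_point_measure//.
  exact: continuous_measurable_fun.
move=> v; apply: (@cvg_EFin R _ (nbhs v)); first by apply: nearW => x.
have : continuous (fun v : 'rV[R]_k => \sum_(j < m) f (row_fun v j)).
  elim: m => [|m IH] x.
    under eq_fun do rewrite big_ord0; exact: cst_continuous.
  under eq_fun do rewrite big_ord_recr /=.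
  apply: continuousD; first exact: IH.
  apply: (@continuous_comp _ _ _ (fun v : 'rV[R]_k => row_fun v m) f); last exact: cf.
  exact: continuous_row_fun.
by apply.
Qed.

Lemma continuous_sumr (R : realType) (T : topologicalType) (n : nat)
    (f : nat -> T -> R) :
  (forall i, continuous (f i)) -> continuous (fun x => \sum_(i < n) f i x).
Proof.
move=> cf; elim: n => [|n IH] x.
  under eq_fun do rewrite big_ord0; exact: cst_continuous.
under eq_fun do rewrite big_ord_recr /=.
by apply: continuousD; [exact: IH|exact: cf].
Qed.

Section point_processes.
Variables (R : realType) (c : R) (F : weak_measures R -> R).
Hypothesis cF : {within @finite_measures R, continuous F}.

Definition count_functional k m (v : 'rV[R]_k) : R :=
  F (finite_point_measure m (row_fun v)).

Lemma continuous_count_functional k m : continuous (@count_functional k m).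
Proof.
move=> v; have /subspace_continuousP/(_ _ (finite_point_measure_finite m (row_fun v))) h := cF.
apply: cvg_trans h => U /= hU.
have := @continuous_finite_point_measure R k m v _ hU.
apply: (@filterS _ (nbhs v)) => v' h'; apply: h'.
exact: finite_point_measure_finite.
Qed.

Definition count_above (y : nat -> R) (m : nat) : Prop :=
  forall j, (c < y j) = (j < m)%N.

Lemma count_functionalE k m (y : nat -> R) : (m <= k)%N ->
  count_functional m (\row_(i < k) y i) = F (finite_point_measure m y).
Proof.
move=> mk; rewrite /count_functional; congr F; apply: finite_point_measure_eq => j jm.
by rewrite row_funE// (leq_trans jm).
Qed.

(** No sigma-algebra on measures is needed: on the event that exactly m points lie above c, F of X
    is a continuous function of m coordinates, and there are countably many m. *)
Lemma measurable_functional (d : measure_display) (T : measurableType d)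
    (y : T -> nat -> R) (X : T -> weak_measures R) :
  (forall j, measurable_fun setT (fun w => y w j)) ->
  (forall w, exists m, count_above (y w) m) ->
  (forall w m, count_above (y w) m -> X w = finite_point_measure m (y w)) ->
  measurable_fun setT (F \o X).
Proof.
move=> my hy hX _ B mB; rewrite setTI.
have -> : (F \o X) @^-1` B = \bigcup_m ([set w | count_above (y w) m] `&`
    (count_functional m \o (fun w => \row_(i < m) y w i)) @^-1` B).
  apply/seteqP; split=> w.
    move=> Bw; have [m hm] := hy w; exists m => //; split=> //=.
    by rewrite count_functionalE// -(hX _ _ hm).
  move=> [m _ [hm]] /=; rewrite count_functionalE// => h.
  by rewrite (hX _ _ hm).
apply: bigcupT_measurable => m; apply: measurableI.
  have -> : [set w | count_above (y w) m] =
      \bigcap_j (if (j < m)%N then [set w | c < y w j] else ~` [set w | c < y w j]).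
    apply/seteqP; split=> w /= h.
      by move=> j _; have := h j; case: ifP => _ /= ->.
    move=> j; have := h j I; by case: ifP => //= _ /negP/negbTE ->.
  apply: bigcapT_measurable => j; case: ifP => _; last apply: measurableC; exact: measurable_gt.
have mcf : measurable_fun setT (count_functional m \o (fun w => \row_(i < m) y w i)).
  apply: measurable_fun_row; last exact: continuous_count_functional.
  by move=> i; apply: measurable_row_coord.
by have := mcf measurableT B mB; rewrite setTI.
Qed.

Definition cutoff (del t : R) : R := clamp ((t - c) / del).

(* The exact weight of count_functional m is the indicator of m points above c;
   it is replaced by a continuous one, equal to it when no y j is in
   ]c, c + del[. *)
Definition smoothed_functional (del : R) k (v : 'rV[R]_k.+1) : R :=
  \sum_(m < k.+1) (if (m : nat) is m'.+1 then cutoff del (row_fun v m') else 1) *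
     (1 - cutoff del (row_fun v m)) * count_functional m v.

Lemma continuous_cutoff_row (del : R) k j :
  continuous (fun v : 'rV[R]_k => cutoff del (row_fun v j)).
Proof.
move=> v; apply: (@continuous_comp _ _ _ (fun v : 'rV[R]_k => (row_fun v j - c) / del) (@clamp R)); last exact: continuous_clamp.
apply: continuousM; last exact: cst_continuous.
apply: continuousB; [exact: continuous_row_fun|exact: cst_continuous].
Qed.

Lemma continuous_smoothed_functional (del : R) k :
  continuous (@smoothed_functional del k).
Proof.
pose low m (v : 'rV[R]_k.+1) : R :=
  if m is m'.+1 then cutoff del (row_fun v m') else 1.
pose high m (v : 'rV[R]_k.+1) : R := 1 - cutoff del (row_fun v m).
have clow m : continuous (low m).
  by case: m => [|m]; [exact: cst_continuous|exact: continuous_cutoff_row].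
have chigh m : continuous (high m).
  move=> x; apply: (@continuousB _ R^o _ (fun=> 1) (fun v : 'rV[R]_k.+1 => cutoff del (row_fun v m))).
    exact: cst_continuous.
  exact: continuous_cutoff_row.
apply: (@continuous_sumr _ _ _ (fun m (v : 'rV[R]_k.+1) =>
    low m v * high m v * count_functional m v)) => m x.
apply: (@continuousM _ _ (fun v => low m v * high m v)); last exact: continuous_count_functional.
by apply: continuousM; [exact: clow|exact: chigh].
Qed.

(** Outside the gap every cutoff is the indicator of j < m, and the condition on y k ensures m <= k,
    so the right term is present in the sum. *)
Lemma smoothed_functionalE (del : R) k (y : nat -> R) m : 0 < del ->
  count_above y m -> y k <= c -> (forall j, (j <= k)%N -> y j <= c \/ c + del <= y j) ->
  smoothed_functional del (\row_(i < k.+1) y i) = F (finite_point_measure m y).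
Proof.
move=> del0 ym yk gap.
have mk : (m < k.+1)%N by rewrite ltnS leqNgt -ym -leNgt.
have cut j : (j <= k)%N -> cutoff del (row_fun (\row_(i < k.+1) y i) j) = (j < m)%N%:R.
  move=> jk; rewrite row_funE// /cutoff -ym; have [cy|yc] := ltP c (y j).
    case: (gap j jk) => h; first by rewrite leNgt cy in h.
    by rewrite clamp1// ler_pdivlMr// mul1r lerBrDl.
  by rewrite clamp0// pmulr_lle0 ?invr_gt0// subr_le0.
rewrite /smoothed_functional (bigD1 (Ordinal mk))//= big1 ?addr0 => [|i im].
  rewrite cut; last by rewrite -ltnS.
  rewrite ltnn subr0 mulr1 count_functionalE; last exact: ltnW.
  case: m mk ym cut => [|m'] mk ym cut; first by rewrite mul1r.
  by rewrite cut ?ltnSn ?mul1r// ltnW// -ltnS ltnW.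
rewrite -(inj_eq val_inj) /= in im.
(* A term with i < m is killed by the factor 1 - cutoff at i, a term with i > m by the cutoff at i -
   1. *)
case: (ltngtP i m) => [lt|gt|e]; last by rewrite e eqxx in im.
  by rewrite (cut i) ?lt ?subrr ?mulr0 ?mul0r// -ltnS.
case: i im gt => -[//|i'] /= ik im gt.
by rewrite (cut i') ?mul0r//; [rewrite ltnNge -ltnS gt ?mul0r|rewrite ltnW// -ltnS].
Qed.

End point_processes.

Fixpoint gap (R : realType) (c : R) (y : nat -> R) (t : R) (n : nat) : R :=
  if n is n'.+1 then Num.min (gap c y t n') `|y n' - c| else t.

Lemma gap_gt (R : realType) (c : R) (y : nat -> R) (t s : R) n :
  s < gap c y t n -> s < t /\ forall j, (j < n)%N -> s < `|y j - c|.
Proof.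
elim: n => [|n IH] /=; first by move=> st; split.
rewrite lt_min => /andP[/IH[st h] sn]; split=> // j.
by rewrite ltnS leq_eqVlt => /orP[/eqP ->|/h].
Qed.

Lemma gap_le (R : realType) (c : R) (y : nat -> R) (t s : R) n :
  gap c y t n <= s -> t <= s \/ exists j, `|y j - c| <= s.
Proof.
elim: n => [|n IH] /=; first by left.
by rewrite ge_min => /orP[/IH//|yn]; right; exists n.
Qed.

Lemma eq_gap (R : realType) (c : R) (y z : nat -> R) (t : R) n :
  (forall j, (j < n)%N -> y j = z j) -> gap c y t n = gap c z t n.
Proof.
elim: n => //= n IH yz; rewrite yz// IH// => j jn; apply: yz; exact: ltnW.
Qed.

(** Positive exactly when the last coordinate is below c and no coordinate equals c. A lower bound
    del on it provides the hypotheses of [smoothed_functionalE]. *)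
Definition row_gap (R : realType) (c : R) k (v : 'rV[R]_k.+1) : R :=
  gap c (row_fun v) (Num.max 0 (c - row_fun v k)) k.+1.

Lemma row_gapE (R : realType) (c : R) k (y : nat -> R) :
  row_gap c (\row_(i < k.+1) y i) = gap c y (Num.max 0 (c - y k)) k.+1.
Proof.
rewrite /row_gap row_funE//; apply: eq_gap => j jk; exact: row_funE.
Qed.

Lemma continuous_row_gap (R : realType) (c : R) k : continuous (@row_gap R c k).
Proof.
suff h n : continuous (fun v : 'rV[R]_k.+1 =>
    gap c (row_fun v) (Num.max 0 (c - row_fun v k)) n) by exact: h.
elim: n => [|n IH] v /=.
  apply: (@continuous_max R _ (fun=> 0) (fun v : 'rV[R]_k.+1 => c - row_fun v k)); first exact: cst_continuous.
  by apply: continuousB; [exact: cst_continuous|exact: continuous_row_fun].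
apply: (@continuous_min R _ _ (fun v : 'rV[R]_k.+1 => `|row_fun v n - c|)); first exact: IH.
apply: (@continuous_comp _ _ _ (fun v : 'rV[R]_k.+1 => row_fun v n - c) Num.norm).
  by apply: continuousB; [exact: continuous_row_fun|exact: cst_continuous].
exact: norm_continuous.
Qed.

Section point_process_convergence.
Variables (R : realType) (c : R).
Variables (d : nat -> measure_display) (Omega : forall n, measurableType (d n))
  (P : forall n, probability (Omega n) R)
  (d' : measure_display) (Omega' : measurableType d') (Q : probability Omega' R).
Variables (y : forall n, Omega n -> nat -> R) (y' : Omega' -> nat -> R).
Variables (X : forall n, Omega n -> weak_measures R) (Y : Omega' -> weak_measures R).
Hypothesis my : forall n j, measurable_fun setT (fun w => @y n w j).
Hypothesis my' : forall j, measurable_fun setT (fun w => y' w j).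
Hypothesis hy : forall n w, exists m, count_above c (@y n w) m.
Hypothesis hy' : forall w, exists m, count_above c (y' w) m.
Hypothesis yX : forall n w m, count_above c (@y n w) m ->
  @X n w = finite_point_measure m (@y n w).
Hypothesis yY : forall w m, count_above c (y' w) m ->
  Y w = finite_point_measure m (y' w).
Hypothesis yy : forall k, cvg_vec P Q (fun n w => \row_(i < k) @y n w i)
  (fun w => \row_(i < k) y' w i).
Hypothesis no_atom : forall j, Q [set w | y' w j = c] = 0%E.
Hypothesis small : forall e, 0 < e -> exists k, fine (Q [set w | c <= y' w k]) <= e.

(** As del decreases to 0 the events shrink to one where the point of index k is still at or above
    c, unlikely for large k, or where some point equals c, a null event. *)
Lemma row_gap_small (p : R) : 0 < p ->
  exists k del, 0 < del /\
    fine (Q [set w | row_gap c (\row_(i < k.+1) y' w i) <= del]) <= p.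
Proof.
move=> p0; have p2 : 0 < p / 2 by rewrite divr_gt0.
have [k hk] := small p2; exists k.
pose A n := [set w | row_gap c (\row_(i < k.+1) y' w i) <= n.+1%:R^-1].
have mA n : measurable (A n).
  apply: measurable_le_set.
  apply: (@measurable_fun_row _ _ _ _ (fun w => \row_(i < k.+1) y' w i)); last exact: continuous_row_gap.
  by move=> i; apply: measurable_row_coord => j.
have decA n : A n.+1 `<=` A n.
  by move=> w /=; rewrite /A /= => h; apply: le_trans h _; rewrite lef_pV2 ?posrE ?ltr0n// ler_nat.
have [n hn] := decreasing_prob_near Q p2 mA decA.
exists n.+1%:R^-1; split; first by rewrite invr_gt0 ltr0n.
have mI : measurable (\bigcap_n A n) by apply: bigcapT_measurable.
have mk : measurable [set w | c <= y' w k] by exact: measurable_ge.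
have mj j : measurable [set w | y' w j = c].
  rewrite (_ : [set w | _] = (fun w => y' w j) @^-1` [set c])//.
  by rewrite -[X in measurable X]setTI; apply: my'.
have null : Q.-negligible (\bigcup_j [set w | y' w j = c]).
  by apply: negligible_bigcup => j; apply/(negligibleP Q (mj j)); exact: no_atom.
have mU : measurable (\bigcup_j [set w | y' w j = c]) by exact: bigcupT_measurable.
have null0 : Q (\bigcup_j [set w | y' w j = c]) = 0%E by exact/negligibleP.
have sub : \bigcap_n A n `<=` [set w | c <= y' w k] `|` \bigcup_j [set w | y' w j = c].
  move=> w hw; have h0 : row_gap c (\row_(i < k.+1) y' w i) <= 0.
    rewrite leNgt; apply/negP => /ltr_add_invr[m]; rewrite add0r ltNge => /negP; apply.
    exact: hw.
  move: h0; rewrite row_gapE => /gap_le[|[j]].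
    by rewrite ge_max lexx /= subr_le0; left.
  by rewrite normr_le0 subr_eq0 => /eqP hj; right; exists j.
apply: le_trans hn _.
have : fine (Q (\bigcap_n A n)) <= fine (Q [set w | c <= y' w k]).
  rewrite fine_le ?fin_num_measure//.
  apply: (@le_trans _ _ (Q ([set w | c <= y' w k] `|` \bigcup_j [set w | y' w j = c]))).
    by apply: le_measure => //; rewrite inE//; exact: measurableU.
  by apply: le_trans (measureU2 _ mk mU) _; rewrite [X in (_ + X)%E]null0 adde0.
by move=> h; apply: le_trans (lerD (le_trans h hk) (lexx _)) _; rewrite -splitr.
Qed.

(** F of the measure is replaced by a bounded continuous function G of k + 1 points. They agree when
    the gap exceeds del; the exceptional event is small under Q by the choice of k and del, and
    eventually under P n by [cvg_vec_event]. *)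
Lemma point_process_cvg : cvg_in_law (@finite_measures R) P X Q Y.
Proof.
move=> F cF [M FM].
have mFX n : measurable_fun setT (F \o @X n).
  exact: (measurable_functional cF (@my n) (@hy n) (@yX n)).
have mFY : measurable_fun setT (F \o Y).
  exact: (measurable_functional cF my' hy' yY).
have FX n w : `|F (@X n w)| <= M.
  have [m hm] := hy w; rewrite (yX hm); apply: FM; exact: finite_point_measure_finite.
have FY w : `|F (Y w)| <= M.
  have [m hm] := hy' w; rewrite (yY hm); apply: FM; exact: finite_point_measure_finite.
split=> //; apply: cvg_expectation => //.
- by move=> n; exists M => w; exact: FX.
- by exists M => w; exact: FY.
have M0 : 0 <= M.
  apply: le_trans (normr_ge0 _) (FM (finite_point_measure 0 (fun=> 0)) _).
  exact: finite_point_measure_finite.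
apply: cvg_approx => e e0.
have M8 : 0 < 6 * M + 6 by rewrite ltr_wpDl// mulr_ge0.
pose p := e / (6 * M + 6).
have p0 : 0 < p by rewrite divr_gt0.
have [k [r [r0 hr]]] := row_gap_small p0.
(* The interval from del to r leaves room for the continuous function f that compares the gap events
   under P n and Q. *)
pose del := r / 2.
have del0 : 0 < del by rewrite divr_gt0.
(* Truncated at M because the smoothed weights may add up to more than 1 on vectors that are not
   decreasing. *)
pose G (v : 'rV[R]_k.+1) : R := Num.max (- M) (Num.min M (smoothed_functional c F del v)).
have cG : continuous G.
  move=> v; apply: (@continuous_max R _ (fun=> - M) (fun v : 'rV[R]_k.+1 =>
    Num.min M (smoothed_functional c F del v))); first exact: cst_continuous.
  apply: (@continuous_min R _ (fun=> M)); first exact: cst_continuous.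
  exact: continuous_smoothed_functional.
have GM v : `|G v| <= M.
  by rewrite ler_norml /G le_max lexx /= ge_max ge_min lexx andbT ge0_cp.
have GE (z : nat -> R) m : count_above c z m ->
    del < row_gap c (\row_(i < k.+1) z i) ->
    G (\row_(i < k.+1) z i) = F (finite_point_measure m z).
  move=> zm; rewrite row_gapE => /gap_gt[].
  rewrite lt_max ltNge (ltW del0) /= => zk h.
  have := FM _ (finite_point_measure_finite m z).
  rewrite /G (smoothed_functionalE F del0 zm) ?ler_norml.
  - by move=> /andP[h1 h2]; rewrite (min_idPr h2) (max_idPr h1).
  - by rewrite -subr_ge0 ltW//; exact: lt_trans zk.
  - move=> j jk; have := h j jk; have [cz|zc] := leP (z j) c; first by left.
    rewrite gtr0_norm ?subr_gt0//.
    by move=> h1; right; rewrite -lerBrDl ltW.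
pose f (v : 'rV[R]_k.+1) := clamp (2 - row_gap c v / del).
have cf : continuous f.
  move=> v; apply: (@continuous_comp _ _ _ (fun v : 'rV[R]_k.+1 => 2 - row_gap c v / del) (@clamp R)); last exact: continuous_clamp.
  apply: continuousB; first exact: cst_continuous.
  by apply: continuousM; [exact: continuous_row_gap|exact: cst_continuous].
have mZ n i : measurable_fun setT (fun w => (\row_(i < k.+1) @y n w i) 0 i).
  by apply: measurable_row_coord => j.
have mZ' i : measurable_fun setT (fun w => (\row_(i < k.+1) y' w i) 0 i).
  by apply: measurable_row_coord => j.
have mg n : measurable_fun setT (fun w => row_gap c (\row_(i < k.+1) @y n w i)).
  by apply: (measurable_fun_row (mZ n)); exact: continuous_row_gap.
have mg' : measurable_fun setT (fun w => row_gap c (\row_(i < k.+1) y' w i)).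
  by apply: (measurable_fun_row mZ'); exact: continuous_row_gap.
have ev : \forall n \near \oo,
    fine (P n [set w | row_gap c (\row_(i < k.+1) @y n w i) <= del]) <=
    fine (Q [set w | row_gap c (\row_(i < k.+1) y' w i) <= r]) + p.
  apply: (cvg_vec_event (yy (k := k.+1)) mZ mZ' cf) => //.
  - by move=> v; rewrite clamp_ge0 clamp_le1.
  - by move=> n; exact: measurable_le_set.
  - exact: measurable_le_set.
  - move=> n w /= h; rewrite /f clamp1//.
    have : row_gap c (\row_(i < k.+1) @y n w i) / del <= 1 by rewrite ler_pdivrMr// mul1r.
    lra.
  - move=> w /= /negP; rewrite -ltNge => h; rewrite /f clamp0// subr_le0.
    by rewrite ler_pdivlMr// /del; lra.
exists (fun n => mean (P n) (G \o (fun w => \row_(i < k.+1) @y n w i))),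
  (mean Q (G \o (fun w => \row_(i < k.+1) y' w i))).
have p6 : 2 * M * (2 * p) <= e.
  rewrite /p -subr_ge0.
  have -> : e - 2 * M * (2 * (e / (6 * M + 6))) = e * (2 * M + 6) / (6 * M + 6).
    by field; rewrite gt_eqF.
  by rewrite divr_ge0 ?mulr_ge0 ?addr_ge0 ?mulr_ge0// ltW.
split.
- by apply: yy => //; exists M.
- apply: le_trans (mean_close (M := M) (e := 0) Q mFY _ FY _ (measurable_le_set del mg') _ _) _ => //.
  + by apply: measurable_fun_row.
  + by move=> w; exact: GM.
  + move=> w /= /negP; rewrite -ltNge => h; have [m hm] := hy' w.
    by rewrite (GE _ _ hm h) (yY hm) subrr normr0.
  rewrite add0r; apply: le_trans p6; rewrite ler_wpM2l ?mulr_ge0//.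
  have h : fine (Q [set w | row_gap c (\row_(i < k.+1) y' w i) <= del]) <=
     fine (Q [set w | row_gap c (\row_(i < k.+1) y' w i) <= r]).
    rewrite fine_le ?fin_num_measure//; try exact: measurable_le_set.
    apply: le_measure; rewrite ?inE; try exact: measurable_le_set.
    by move=> w /= h; apply: le_trans h _; rewrite /del; lra.
  by apply: le_trans h _; apply: le_trans hr _; lra.
near=> n.
apply: le_trans (mean_close (M := M) (e := 0) (P n) (mFX n) _ (FX n) _ (measurable_le_set del (mg n)) _ _) _ => //.
- by apply: measurable_fun_row.
- by move=> w; exact: GM.
- move=> w /= /negP; rewrite -ltNge => h; have [m hm] := hy w.
  by rewrite (GE _ _ hm h) (yX hm) subrr normr0.
rewrite add0r; apply: le_trans p6; rewrite ler_wpM2l ?mulr_ge0//.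
have h : fine (P n [set w | row_gap c (\row_(i < k.+1) @y n w i) <= del]) <=
    fine (Q [set w | row_gap c (\row_(i < k.+1) y' w i) <= r]) + p by near: n.
by apply: le_trans h _; move: hr; move: (fine _) => *; lra.
Unshelve. all: by end_near. Qed.

End point_process_convergence.

Lemma count_above_exists (R : realType) (c : R) (y : nat -> R) :
  (forall j, c < y j.+1 -> c < y j) -> (exists k, y k <= c) ->
  exists m, count_above c y m.
Proof.
move=> dec ex; case: (ex_minnP ex) => m ym min; exists m => j.
have [jm|mj] := ltnP j m.
  by rewrite ltNge; apply: contraTN jm => /min; rewrite leqNgt.
apply/negbTE; rewrite -leNgt -(subnK mj).
elim: (j - m)%N => [//|i]; rewrite addSn.
by rewrite !leNgt; apply: contraNN; exact: dec.
Qed.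

Lemma bump_energy_lt (R : realType) (x y : R) : 0 <= x -> 0 < y ->
  (bump_energy x < bump_energy y) = (x < y).
Proof.
move=> x0 y0; rewrite /bump_energy ltr_sqrt; last by have := sqr_ge0 y; lra.
by rewrite ltrD2r ltr_pXn2r// nnegrE// ltW.
Qed.

(** A threshold above 2, the value at 0, corresponds to a positive level s, above which the Poisson
    process has finitely many points. *)
Lemma bump_energy_preimage (R : realType) (c : R) : 2 < c ->
  exists2 s, 0 < s & bump_energy s = c.
Proof.
move=> c2; have c4 : 0 < c ^+ 2 - 4 by nra.
exists (Num.sqrt (c ^+ 2 - 4)); first by rewrite sqrtr_gt0.
by rewrite /bump_energy sqr_sqrtr ?ltW// subrK sqrtr_sqr gtr0_norm//; lra.
Qed.

(** A singleton is Lebesgue-null, so the number of points at s is Poisson of rate 0, that is, almost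
    surely 0. *)
Lemma poisson_no_atom (R : realType) (d : measure_display)
    (Omega : measurableType d) (Q : probability Omega R) (rho : R -> R)
    (eta : nat -> {RV Q >-> R}) j (s : R) :
  poisson_process rho eta -> Q [set w | eta j w = s] = 0%E.
Proof.
move=> [_ law _].
have i0 : intensity rho [set s] = 0%E.
  by apply: (@integral_Sset1 _ _ _ s); exact: subIsetr.
have := law [set s] (measurable_set1 s); rewrite i0 => /(_ (ltry 0) 0%N).
rewrite /poisson_mass oppr0 expR0 expr0 fact0 divr1 mulr1.
set A := [set w | _] => QA1.
have mj i : measurable [set w | eta i w = s].
  by have := measurable_funPT (eta i) measurableT _ (measurable_set1 s); rewrite setTI.
have mA : measurable A.
  have := @measurable_count R d Omega Q eta [set s] (measurable_set1 s) measurableT _ (emeasurable_set1 (0 : \bar R)%E).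
  by rewrite setTI.
have AE : A `<=` ~` [set w | eta j w = s].
  move=> w Aw /= ejs; have : (\d_(eta j w) [set s] <= (0 : \bar R))%E.
    rewrite -[leRHS]Aw.
    rewrite /point_measure /= /mseries.
    rewrite (@nneseriesD1 _ (fun j => \d_(eta j w) [set s] : \bar R) j)//.
    by rewrite leeDl// nneseries_ge0.
  by rewrite ejs diracE mem_set// lee_fin ler10.
have : (Q A <= Q (~` [set w | eta j w = s]))%E.
  by apply: le_measure => //; rewrite inE//; exact: measurableC.
rewrite QA1 probability_setC//.
have : (Q [set w | eta j w = s] \is a fin_num) by exact: fin_num_measure.
have : (0 <= Q [set w | eta j w = s])%E by exact: measure_ge0.
case: (Q _) => // r; rewrite lee_fin => r0 _; rewrite -EFinB lee_fin => r1.
by congr EFin; lra.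
Qed.

Section pareto_process.
Variables (R : realType) (beta C : R) (d : measure_display)
  (Omega : measurableType d) (Q : probability Omega R).
Variable eta : nat -> {RV Q >-> R}.
Hypothesis pp : poisson_process (pareto_density beta C) eta.

Lemma poisson_point_small (s e : R) : 0 < s -> 0 < e ->
  exists k, fine (Q [set w | s <= eta k w]) <= e.
Proof.
move=> s0 e0; apply: decreasing_prob_small => //.
- by move=> k; exact: measurable_ge.
- by move=> k w /= h; apply: le_trans h _; exact: (eta_le pp).
apply/seteqP; split=> // w h; have s2 : 0 < s / 2 by rewrite divr_gt0.
have [K hK] := eventually_le pp w s2.
by have := h K I; rewrite /=; lra.
Qed.

End pareto_process.

(** The nonnegativity of c places the default value 0 of the indices beyond N below the
    threshold. *)
Lemma nth_eigenvalues_count (R : realType) N (alpha : R) (V : 'I_N -> R) (c : R) : 0 <= c ->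
  exists m, count_above c (fun i => (eigenvalues (Hmx alpha V))`_i) m.
Proof.
move=> c0; have sp := Hmx_spectrum alpha V; have sz := spectrum_size sp.
apply: count_above_exists; last by exists N; rewrite nth_default ?sz.
move=> j; have [jN|Nj] := ltnP j.+1 N; last by rewrite nth_default ?sz// ltNge c0.
by move=> /lt_le_trans; apply; apply: (spectrum_le sp); rewrite leqnSn.
Qed.
Theorem theorem1p3 (R : realType) (alpha : R) (halpha : 0 < alpha)
    (* the random variable whose law is that of the diagonal entries *)
    (d0 : measure_display) (Omega0 : measurableType d0)
    (P0 : probability Omega0 R) (afrak : {RV P0 >-> R})
    (* for each N, N i.i.d. copies of it *)
    (d : nat -> measure_display) (Omega : forall N, measurableType (d N))
    (P : forall N, probability (Omega N) R)
    (a : forall N, 'I_N -> {RV (P N) >-> R})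
    (a_law : forall N (i : 'I_N) (B : set R), measurable B ->
      distribution (P N) (a N i) B = distribution P0 afrak B)
    (a_indep : forall N, mutually_independent (P N) (fun i => a N i : Omega N -> R))
    (* a space carrying the limiting Poisson processes *)
    (d' : measure_display) (Omega' : measurableType d')
    (Q : probability Omega' R) :
  let H N (w : Omega N) := Hmx alpha (fun i => a N i w) in
  let lambda N (w : Omega N) (i : nat) := (eigenvalues (H N w))`_i in
  (forall C C1 : R, 0 < C -> 0 < C1 ->
    (forall t : R, 1 < t ->
      P0 [set w | afrak w > t] = (C * t `^ (- alpha^-1))%:E /\
      (P0 [set w | (afrak w < - t)%R] <= (C1 * t `^ (- alpha^-1))%:E)%E) ->
    forall eps : R, 0 < eps ->
    forall eta : nat -> {RV Q >-> R},
      poisson_process (fun x => C / (alpha * x `^ (alpha^-1 + 1))) eta ->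
      cvg_in_law (@finite_measures R) P
        (fun N w => restrict_measure (2 + eps)
           (msum (fun i => dirac (lambda N w i)) N))
        Q
        (fun w => restrict_measure (2 + eps)
           (point_measure (fun j => Num.sqrt (eta j w ^+ 2 + 4))))) /\
  (forall beta C C1 : R, 0 < beta -> beta < alpha^-1 -> 0 < C -> 0 < C1 ->
    (forall t : R, 1 < t ->
      P0 [set w | afrak w > t] = (C * t `^ (- beta))%:E /\
      (P0 [set w | (afrak w < - t)%R] <= (C1 * t `^ (- beta))%:E)%E) ->
    forall eta : nat -> {RV Q >-> R},
      poisson_process (fun x => C * beta / x `^ (beta + 1)) eta ->
      forall k : nat,
      cvg_in_law [set: 'rV[R]_k] P
        (fun N w => \row_(i < k) (N%:R `^ (alpha - beta^-1) * lambda N w i))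
        Q
        (fun w => \row_(i < k) eta i w)).

Proof.
move=> H lambda; split.
  move=> C C1 C0 C10 tails eps eps0 eta pp.
  have {}pp : poisson_process (pareto_density alpha^-1 C) eta.
    rewrite (_ : pareto_density alpha^-1 C =
      fun x => C / (alpha * x `^ (alpha^-1 + 1)))//.
    by apply/funext => x; rewrite /pareto_density invfM mulrA.
  have tail t (t1 : 1 < t) := (tails t t1).1.
  have ltail t (t1 : 1 < t) := (tails t t1).2.
  have beta0 : 0 < alpha^-1 by rewrite invr_gt0.
  set c := 2 + eps.
  have c2 : 2 < c by rewrite ltrDl.
  have [s s0 sc] := bump_energy_preimage c2.
  have etap j w : 0 < eta j w by have [/(_ w)[]] := pp.
  have cE j w : (c < bump_energy (eta j w)) = (s < eta j w).
    by rewrite -sc bump_energy_lt// ltW.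
  have leE j w : (c <= bump_energy (eta j w)) = (s <= eta j w).
    by rewrite -sc !leNgt bump_energy_lt// ltW.
  have mb j : measurable_fun setT (fun w => bump_energy (eta j w)).
    apply: (measurableT_comp _ (measurable_funPT (eta j))).
    exact: continuous_measurable_fun (@continuous_bump_energy R).
  apply: (@point_process_cvg R c d Omega P d' Omega' Q
    lambda (fun w j => bump_energy (eta j w))).
  - move=> N j; exact: (measurable_Hmx_eigenvalue alpha j (fun i => measurable_funPT (@a N i))).
  - exact: mb.
  - move=> N w; apply: nth_eigenvalues_count; lra.
  - move=> w; apply: count_above_exists.
      by move=> j; rewrite !cE => /lt_le_trans; apply; exact: (eta_le pp).
    have [K hK] := eventually_le pp w s0; exists K.
    by rewrite leNgt cE -leNgt.
  - move=> N w m wm; apply: restrict_msum => [|j _]; last exact: wm.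
    (* At most N points lie above c: the entry of index N is the default 0, which is below c. *)
    rewrite leqNgt; apply/negP => Nm; have := wm N; rewrite Nm /lambda nth_default.
      by rewrite ltNge => /negP; apply; lra.
    by rewrite (spectrum_size (Hmx_spectrum _ _)).
  - by move=> w m wm; exact: restrict_point_measure.
  - exact: (eigenvalues_cvg a_law a_indep halpha C0 C10 tail ltail pp).
  (* By strict monotonicity of the energy, a point at c comes from a Poisson point at s. *)
  - move=> j; rewrite (_ : [set w | _] = [set w | eta j w = s]); first exact: (poisson_no_atom j s pp).
    apply/seteqP; split=> w /=; last by move=> ->.
    move=> e; apply/eqP; rewrite eq_le -leE e lexx andbT leNgt.
    by rewrite -cE e ltxx.
  - move=> e e0; have [k hk] := poisson_point_small pp s0 e0; exists k.
    by rewrite (_ : [set w | _] = [set w | s <= eta k w])//; apply/seteqP; split=> w /=; rewrite leE.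
move=> beta C C1 beta0 ba C0 C10 tails eta pp k.
have tail t (t1 : 1 < t) := (tails t t1).1.
apply: cvg_vec_in_law.
- move=> N i; apply: measurable_row_coord => j; apply: measurable_funM; first exact: measurable_cst.
  exact: (measurable_Hmx_eigenvalue alpha j (fun i => measurable_funPT (@a N i))).
- by move=> i; apply: measurable_row_coord.
exact: (scaled_eigenvalues_cvg a_law a_indep beta0 C0 tail pp).
Qed.
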